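(* Let $K$ be a number field or a function field of characteristic $0$, let $d\geq 2$ be an integer, let $b\in K$, and let $\phi(x,y)=(y,\,x+y^d+b)$ be the corresponding Hénon map of $\mathbb{A}^2$ defined over $K$. Then there exists a positive integer $B$ such that if $P\in\mathbb{A}^2(K)$ is not periodic for $\phi$ of period at most $B$, then $$\hat{h}_\phi(P)\ \geq\ \epsilon\,\max\{h(b),1\},$$ where $\epsilon>0$ is a constant depending on $d$ and the places of $K$ dividing $b$.
   Context: The map $\phi$ is an automorphism of $\mathbb{A}^2$ with inverse $\phi^{-1}(x,y)=(y-x^d-b,\,x)$. For $N\ge 0$, $\phi^N$ is the $N$-fold composition of $\phi$ with itself and $\phi^{-N}$ is the $N$-fold composition of $\phi^{-1}$. A point $P$ is periodic for $\phi$ of period at most $B$ if $\phi^n(P)=P$ for some integer $1\le n\le B$. $h$ denotes the usual absolute logarithmic Weil height, both on $\mathbb{A}^2(\overline{K})$ and on elements of $\overline{K}$. For a number field $K$ with set of places $M_K$ it is given by $h(b)=\sum_{v\in M_K}\frac{[K_v:\mathbb{Q}_v]}{[K:\mathbb{Q}]}\log\max\{1,|b|_v\}$ and $h(x,y)=\sum_{v\in M_K}\frac{[K_v:\mathbb{Q}_v]}{[K:\mathbb{Q}]}\log\max\{1,|x|_v,|y|_v\}$ for $b,x,y\in K$, where $|\cdot|_v$ extends a standard absolute value of $\mathbb{Q}$; for function fields one uses the usual analogue. The canonical heights of $\phi$ are $$\hat{h}^+_\phi(P)=\lim_{N\to\infty}\frac{h(\phi^N(P))}{d^N},\qquad \hat{h}^-_\phi(P)=\lim_{N\to\infty}\frac{h(\phi^{-N}(P))}{d^N},\qquad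 \hat{h}_\phi(P)=\hat{h}^+_\phi(P)+\hat{h}^-_\phi(P).$$ The set $S$ of ''places dividing $b$'' is understood in the paper as the set of places of bad reduction, so that $|b|_v\le 1$ for every place $v\notin S$.
   Formalization: When K is a function field over k, b is assumed nonconstant (not algebraic over k); for constant b the claim fails, e.g. b = 0, P = (1,1) is not periodic but has canonical height 0. *)

(* Defs.v *)
From HB Require Import structures.
From mathcomp Require Import all_boot all_order all_algebra all_field.
From mathcomp Require Import all_classical all_reals all_analysis.

Set Implicit Arguments.
Unset Strict Implicit.
Unset Printing Implicit Defensive.

Import Order.TTheory GRing.Theory Num.Theory.
Import numFieldNormedType.Exports.

Local Open Scope classical_set_scope.
Local Open Scope ring_scope.

(* A number field is a [K : fieldExtType rat]; a function field of
   characteristic 0 is a finite extension [K] of k(t), where the field k of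
   characteristic 0 is otherwise arbitrary.  In both cases K is a finite
   extension of [base_field s], over which degrees are taken. *)
Variant global_base :=
  | RationalNumbers
  | RationalFunctions (k : fieldType) of [pchar k] =i pred0.

Definition base_field (s : global_base) : fieldType :=
  match s with
  | RationalNumbers => rat
  | RationalFunctions k _ => {fraction {poly k}}
  end.

(* In a function field over k, the constants are the elements algebraic
   over k.  For a constant parameter b, all constant points have canonical
   height 0 without being periodic of bounded period, so the height bound is
   only meaningful for nonconstant b. *)
Definition is_constant (s : global_base) :
    forall K : fieldExtType (base_field s), K -> Prop :=
  match s with
  | RationalNumbers => fun _ _ => False
  | RationalFunctions k _ => fun K x =>
      algebraicOver (fun c : k => in_alg K (tofrac c%:P)) x
  end.

Definition poly_mult (k : fieldType) (p f : {poly k}) : nat :=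
  (\max_(i < size f | (p ^+ i %| f)%R) i)%N.

Section Places.
Variable R : realType.

Definition absolute_value (L : fieldType) (u : L -> R) : Prop :=
  [/\ forall x, 0 <= u x,
      forall x, u x = 0 <-> x = 0,
      forall x y, u (x * y) = u x * u y
    & forall x y, u (x + y) <= u x + u y].

(* An absolute value on Q, resp. k(t), is determined by its values on the
   nonnegative integers, resp. on k[t]; only those are prescribed.  On k(t) the
   finite places are |f|_p = exp (- deg p * ord_p f) and the infinite one is
   |f| = exp (deg f), so that the product formula holds. *)
Definition standard (s : global_base) : (base_field s -> R) -> Prop :=
  match s with
  | RationalNumbers => fun u =>
      (forall n : nat, u n%:R = n%:R) \/
      (exists2 p : nat, prime p &
         forall n : nat, (0 < n)%N -> u n%:R = p%:R ^- logn p n)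
  | RationalFunctions k _ => fun u =>
      (forall f : {poly k}, f != 0 -> u (tofrac f) = expR (size f).-1%:R) \/
      (exists2 p : {poly k}, irreducible_poly p &
         forall f : {poly k}, f != 0 ->
           u (tofrac f) = expR (- ((size p).-1 * poly_mult p f)%:R))
  end.

Variables (s : global_base) (K : fieldExtType (base_field s)).

(* The set M_K: a place is identified with the unique absolute value in its
   class that extends a standard absolute value of the base field. *)
Definition places : set (K -> R) :=
  [set v | absolute_value v /\ standard (fun a => v (in_alg K a))].

Definition cauchy_for (V : zmodType) (v : V -> R) (x : nat -> V) : Prop :=
  forall e : R, 0 < e ->
    exists N : nat, forall m n, (N <= m)%N -> (N <= n)%N -> v (x m - x n) < e.

Definition null_for (V : zmodType) (v : V -> R) (x : nat -> V) : Prop :=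
  v (x n) @[n --> \oo] --> (0 : R).

(* With F = base_field s, the completions K_v and F_v are presented as Cauchy
   sequences modulo null sequences; [e] represents a basis of K_v over F_v. *)
Definition completion_basis (v : K -> R) (n : nat) (e : 'I_n -> nat -> K) : Prop :=
  let cauchyF := cauchy_for (fun a : base_field s => v (in_alg K a)) in
  let nullF := null_for (fun a : base_field s => v (in_alg K a)) in
  [/\ forall i, cauchy_for v (e i),
      forall x : nat -> K, cauchy_for v x ->
        exists2 a : 'I_n -> nat -> base_field s, forall i, cauchyF (a i) &
          null_for v (fun m => x m - \sum_(i < n) a i m *: e i m)
    & forall a : 'I_n -> nat -> base_field s, (forall i, cauchyF (a i)) ->
        null_for v (fun m => \sum_(i < n) a i m *: e i m) ->
        forall i, nullF (a i)].

(* [K_v : F_v] *)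
Definition local_degree (v : K -> R) : nat :=
  xget 0%N [set n | exists e : 'I_n -> nat -> K, completion_basis v e].

Definition weight (v : K -> R) : R := (local_degree v)%:R / (\dim {:K})%:R.

(* The sums are over infinitely many places, but all but finitely many terms
   vanish, which is what [\sum_(_ \in _)] requires. *)
Definition height (x : K) : R :=
  \sum_(v \in places) weight v * ln (Num.max 1 (v x)).

Definition height2 (P : K * K) : R :=
  \sum_(v \in places) weight v * ln (Num.max 1 (Num.max (v P.1) (v P.2))).

End Places.

Arguments places R {s} K _.

Section Henon.
Variables (K : fieldType) (d : nat) (b : K).

Definition henon (P : K * K) : K * K := (P.2, P.1 + P.2 ^+ d + b).

Definition henon_inv (P : K * K) : K * K := (P.2 - P.1 ^+ d - b, P.1).

Lemma henonK : cancel henon henon_inv.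
Proof. by case=> x y; rewrite /henon /henon_inv /= addrAC addrK addrK. Qed.

Lemma henon_invK : cancel henon_inv henon.
Proof. by case=> x y; rewrite /henon /henon_inv /= addrAC subrK subrK. Qed.

Definition periodic_at_most (B : nat) (P : K * K) : Prop :=
  exists n : nat, [/\ (1 <= n)%N, (n <= B)%N & iter n henon P = P].

End Henon.

Section CanonicalHeight.
Variables (R : realType) (s : global_base) (K : fieldExtType (base_field s)).
Variables (d : nat) (b : K).

Definition canonical_height_plus (P : K * K) : R :=
  limn (fun N : nat => height2 R (iter N (henon d b) P) / d%:R ^+ N).

Definition canonical_height_minus (P : K * K) : R :=
  limn (fun N : nat => height2 R (iter N (henon_inv d b) P) / d%:R ^+ N).

Definition canonical_height (P : K * K) : R :=
  canonical_height_plus P + canonical_height_minus P.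

End CanonicalHeight.

(* Main.v *)
Require Import Defs.
From HB Require Import structures.
From mathcomp Require Import all_boot all_order all_algebra all_field.
From mathcomp Require Import all_classical all_reals all_analysis.
From mathcomp Require Import complex ring lra zify.

(** The proof follows an orbit segment y_0, ..., y_2N of first coordinates,
    centred at P = (y_N, y_(N+1)), so that y_(i+2) = y_i + y_(i+1)^d + b. If the
    canonical height of P is less than a small multiple of max (h(b), 1), then
    for suitable N the two ends of the segment are small compared with d^N
    (low_height_orbit). A point that is large at a place v grows by the power d
    at each step, forward or backward, hence makes one of the ends large. So at
    each place the points y_k shortly after y_N satisfy
    log |y_k|_v <= max (log |b|_v / d, small), up to a constant at the
    archimedean places (orbit_point_bound).

    At a place where log |b|_v is a sizeable part of h(b), this forces
    y_k^d + b = y_(k+1) - y_(k-1) to be much smaller than b, so that y_k is near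
    one of the at most d clusters of d-th roots of -b (cluster_coloring). Call
    the sequence of clusters visited the itinerary. If two points have the same
    itinerary over a few steps, then comparing y^d - y'^d with y - y' shows that
    |y - y'|_v <= |b|_v^(-1/16) (close_points_contract). There are finitely many
    itineraries at the places of S, so among boundedly many points two share it
    at all these places; the product formula then shows that they coincide, and
    P is periodic of bounded period (contraction_gap). This needs h(b) to be
    large compared with the archimedean error terms. If instead K is a number
    field and h(b) is bounded, the points are bounded at every place, two of
    them are close together at all archimedean places, and again the product
    formula makes them equal (archimedean_gap). Over a function field there are
    no error terms, and the height of a nonconstant b is bounded below
    (nonconstant_height_ge).

    These arguments use the following facts on the places of K, proved from the
    definition of a place as an absolute value that extends a standard one. An
    absolute value that extends a given one u on the base field F is conjugate
    to any fixed extension of u to a splitting field, by weak approximation and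
    because the powers of an element have bounded characteristic polynomials
    (extension_is_conjugate). Such an extension to a splitting field exists:
    over the primes it comes from a subring maximal among those in which the
    prime is not invertible (valuation_ring_exists, ultrametric_extension), and
    over the real place from the complex numbers. Summing over conjugates, the
    product formula for the norm gives one for K, with multiplicities between 1
    and [K : F] (ext_product_formula). These multiplicities and the local
    degrees that define the height are compared by crude bounds: a local degree
    is at least 1 (local_degree_gt0), so a sum over places is at most [K : F]
    times the corresponding height, and the weights of the finitely many places
    of S enter through the constants. *)

Set Implicit Arguments.
Unset Strict Implicit.
Unset Printing Implicit Defensive.

Import Order.TTheory GRing.Theory Num.Theory.
Import numFieldNormedType.Exports.

Local Open Scope classical_set_scope.
Local Open Scope ring_scope.

(** * Absolute values and weak approximation *)

Section AbsoluteValues.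
Variables (R : realType) (L : fieldType) (v : L -> R).
Hypothesis av : absolute_value v.

Lemma av_ge0 x : 0 <= v x. Proof. by case: av. Qed.

Lemma avM x y : v (x * y) = v x * v y. Proof. by case: av. Qed.

Lemma avD x y : v (x + y) <= v x + v y. Proof. by case: av. Qed.

Lemma av_eq0 x : (v x == 0) = (x == 0).
Proof. by case: av => _ v0 _ _; apply/eqP/eqP => /v0. Qed.

Lemma av0 : v 0 = 0. Proof. by apply/eqP; rewrite av_eq0. Qed.

Lemma av_gt0 x : x != 0 -> 0 < v x.
Proof. by move=> x0; rewrite lt_def av_ge0 av_eq0 x0. Qed.

Lemma av1 : v 1 = 1.
Proof.
have v1 : v 1 != 0 by rewrite av_eq0 oner_neq0.
by apply: (mulfI v1); rewrite -avM !mulr1.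
Qed.

Lemma avX x n : v (x ^+ n) = v x ^+ n.
Proof. by elim: n => [|n IH]; rewrite ?expr0 ?av1 // !exprS avM IH. Qed.

Lemma avN x : v (- x) = v x.
Proof.
apply/eqP; rewrite -(@eqrXn2 _ 2) ?av_ge0 //; first by rewrite -!avX sqrrN.
Qed.

Lemma avB x y : v (x - y) <= v x + v y.
Proof. by rewrite -(avN y) avD. Qed.

Lemma avV x : v x^-1 = (v x)^-1.
Proof.
have [->|x0] := eqVneq x 0; first by rewrite invr0 av0 invr0.
have vx : v x != 0 by rewrite av_eq0.
by apply: (mulfI vx); rewrite -avM !divff // av1.
Qed.

Lemma av_prod (I : Type) (s : seq I) (f : I -> L) :
  v (\prod_(i <- s) f i) = \prod_(i <- s) v (f i).
Proof. exact: (big_morph v avM av1). Qed.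

Lemma av_sum (I : Type) (s : seq I) (f : I -> L) :
  v (\sum_(i <- s) f i) <= \sum_(i <- s) v (f i).
Proof.
elim/big_rec2: _ => [|i y x _ le_xy]; first by rewrite av0.
by apply: le_trans (avD _ _) _; rewrite lerD2l.
Qed.

Lemma av_exprz x (z : int) : v (x ^ z) = v x ^ z.
Proof. by case: z => n; rewrite ?NegzE -?exprnP -?exprnN ?avV ?avX // -?exprVn. Qed.

End AbsoluteValues.

Lemma av_comp (R : realType) (K L : fieldType) (f : {rmorphism K -> L}) (v : L -> R) :
  absolute_value v -> absolute_value (v \o f).
Proof.
move=> av; split=> [x|x|x y|x y] /=.
- exact: av_ge0.
- by split=> [/eqP|->]; rewrite ?rmorph0 ?(av0 av) // (av_eq0 av) fmorph_eq0 => /eqP.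
- by rewrite rmorphM avM.
- by rewrite rmorphD avD.
Qed.

Section Powers.
Variable R : realType.
Implicit Types r e C : R.

Lemma expr_unbounded r C : 1 < r ->
  exists m0, forall m, (m0 <= m)%N -> C < r ^+ m.
Proof.
move=> r1; have r0 : 0 < r - 1 by rewrite subr_gt0.
have bern m : 1 + m%:R * (r - 1) <= r ^+ m.
  elim: m => [|m IH]; first by rewrite expr0 mul0r addr0.
  rewrite exprS; apply: (@le_trans _ _ (r * (1 + m%:R * (r - 1)))); last first.
    by rewrite ler_pM2l // (lt_trans ltr01).
  have : 0 <= m%:R * (r - 1) * (r - 1) by rewrite !mulr_ge0 // ltW.
  rewrite -natr1; nra.
exists (Num.truncn (C / (r - 1))).+1 => m le_m; apply: lt_le_trans (bern m).
have : C / (r - 1) < m%:R.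
  by apply: lt_le_trans (truncnS_gt _) _; rewrite ler_nat.
rewrite ltr_pdivrMr // => /lt_trans; apply.
by rewrite ltrDr ltr01.
Qed.

Lemma expr_vanishing r e : 0 <= r -> r < 1 -> 0 < e ->
  exists m0, forall m, (m0 <= m)%N -> r ^+ m < e.
Proof.
move=> r0 r1 e0; have [->|rn0] := eqVneq r 0.
  by exists 1%N => -[|m] // _; rewrite expr0n.
have rp : 0 < r by rewrite lt_def rn0.
have [|m0 hm] := @expr_unbounded r^-1 e^-1; first by rewrite invf_gt1.
by exists m0 => m /hm; rewrite exprVn ltf_pV2 // posrE exprn_gt0.
Qed.

Lemma common_bound n (P : nat -> nat -> Prop) :
  (forall i, (i < n)%N -> exists m0, forall m, (m0 <= m)%N -> P i m) ->
  exists m0, forall m, (m0 <= m)%N -> forall i, (i < n)%N -> P i m.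
Proof.
elim: n => [|n IH] h; first by exists 0%N.
have [m1 h1] := IH (fun i lt_in => h i (ltnW lt_in)).
have [m2 h2] := h n (ltnSn n).
exists (maxn m1 m2) => m; rewrite geq_max => /andP[le1 le2] i.
by rewrite ltnS leq_eqVlt => /orP[/eqP->|]; [exact: h2 | exact: h1].
Qed.

Lemma le1_of_bounded_powers r C : (forall m : nat, r ^+ m <= C) -> r <= 1.
Proof.
move=> h; rewrite leNgt; apply/negP => /expr_unbounded -/(_ C)[m0 /(_ m0 (leqnn _))].
by rewrite ltNge h.
Qed.

End Powers.

(** Weak approximation. Given x large for v and small for the first n absolute
    values, and y separating v from the last one, the product of y with x^m or
    with x^m / (1 + x^m) works for large m: the second factor tends to 1 where
    x is large and to 0 where x is small. *)
Lemma artin_whaples (R : realType) (K : fieldType) (v : K -> R)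
    (n : nat) (w : nat -> K -> R) :
  absolute_value v -> (forall i, (i < n)%N -> absolute_value (w i)) ->
  (forall i, (i < n)%N -> exists2 y, 1 < v y & w i y < 1) ->
  (exists y, 1 < v y) ->
  exists2 x, 1 < v x & forall i, (i < n)%N -> w i x < 1.
Proof.
move=> av; elim: n => [|n IH] aw sep [y0 vy0]; first by exists y0.
have awn : absolute_value (w n) by apply: aw.
have [|||x vx wx] := IH.
- by move=> i lt_in; apply: aw; apply: ltnW.
- by move=> i lt_in; apply: sep; apply: ltnW.
- by exists y0.
have [y vy wy] := sep n (ltnSn n).
have small e : 0 < e -> exists m0, forall m, (m0 <= m)%N ->
    forall i, (i < n)%N -> w i x ^+ m * w i y < e /\ w i x ^+ m < e.
  move=> e0; apply: common_bound => i lt_in.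
  have awi := aw i (ltnW lt_in); have wy0 := av_ge0 awi y.
  have [|m0 hm] := @expr_vanishing _ (w i x) (e / (1 + w i y)) (av_ge0 awi x) (wx i lt_in).
    by rewrite divr_gt0 // ltr_pwDl.
  exists m0 => m /hm; rewrite ltr_pdivlMr ?ltr_pwDl // mulrDr mulr1 => h.
  have p0 : 0 <= w i x ^+ m by rewrite exprn_ge0 // (av_ge0 awi).
  have q0 : 0 <= w i x ^+ m * w i y by rewrite mulr_ge0.
  by split; lra.
have [wnx|wnx] := leP (w n x) 1.
  have [m0 hm] := small 1 ltr01.
  exists (x ^+ m0 * y).
    rewrite (avM av) (avX av) (lt_le_trans vy) // ler_peMl ?(av_ge0 av) //.
    by rewrite exprn_ege1 // ltW.
  move=> i; rewrite ltnS leq_eqVlt => /orP[/eqP->|lt_in].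
    rewrite (avM awn) (avX awn) (le_lt_trans _ wy) // ler_piMl ?(av_ge0 awn) //.
    by rewrite exprn_ile1 // (av_ge0 awn).
  have awi := aw i (ltnW lt_in).
  by rewrite (avM awi) (avX awi); have [] := hm m0 (leqnn _) i lt_in.
have vy1 : 0 < v y - 1 by rewrite subr_gt0.
have wy1 : 0 < 1 - w n y by rewrite subr_gt0.
have half0 : 0 < 2^-1 :> R by rewrite invr_gt0.
have [m1 hm1] := small _ half0.
have [m2 hm2] := expr_unbounded (v y - 1)^-1 vx.
have [m3 hm3] := expr_unbounded (1 - w n y)^-1 wnx.
pose m := (maxn m1 (maxn m2 m3)).+1.
have le1 : (m1 <= m)%N by rewrite leqW // leq_maxl.
have le2 : (m2 <= m)%N by rewrite leqW // leq_max leq_maxl orbT.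
have le3 : (m3 <= m)%N by rewrite leqW // leq_max leq_maxr orbT.
have {}hm2 := hm2 m le2; have {}hm3 := hm3 m le3.
have vxm : 1 < v x ^+ m by rewrite exprn_egt1.
have wxm : 1 < w n x ^+ m by rewrite exprn_egt1.
have d0 : 1 + x ^+ m != 0.
  apply: contraTneq vxm => /eqP; rewrite addr_eq0 => /eqP h.
  by rewrite -(avX av) -(avN av) -h (av1 av) ltxx.
exists (x ^+ m / (1 + x ^+ m) * y).
  rewrite (avM av) (avM av) (avV av) (avX av) mulrAC ltr_pdivlMr ?(av_gt0 av) // mul1r.
  apply: le_lt_trans (avD av _ _) _; rewrite (av1 av) (avX av).
  by move: hm2; rewrite -div1r ltr_pdivrMr // mulrBr mulr1; lra.
move=> i; rewrite ltnS leq_eqVlt => /orP[/eqP->|lt_in].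
  rewrite (avM awn) (avM awn) (avV awn) (avX awn) mulrAC ltr_pdivrMr ?(av_gt0 awn) // mul1r.
  have := avB awn (1 + x ^+ m) 1; rewrite addrAC subrr add0r (av1 awn) (avX awn).
  by move: hm3; rewrite -div1r ltr_pdivrMr // mulrBr mulr1; lra.
have awi := aw i (ltnW lt_in); have [h1 h2] := hm1 m le1 i lt_in.
rewrite (avM awi) (avM awi) (avV awi) (avX awi) mulrAC ltr_pdivrMr ?(av_gt0 awi) // mul1r.
by have := avB awi (1 + x ^+ m) (x ^+ m); rewrite addrK (av1 awi) (avX awi); lra.
Qed.

(** * Conjugates and extensions of an absolute value *)

Definition ultrametric (R : realType) (L : fieldType) (v : L -> R) : Prop :=
  forall x y, v (x + y) <= Num.max (v x) (v y).

Lemma ultrametric_sum (R : realType) (L : fieldType) (v : L -> R) (I : Type)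
    (s : seq I) (f : I -> L) (C : R) :
  absolute_value v -> ultrametric v -> 0 <= C -> (forall i, v (f i) <= C) ->
  v (\sum_(i <- s) f i) <= C.
Proof.
move=> av uv C0 fC; elim/big_rec: _ => [|i y _ yC]; first by rewrite (av0 av).
by apply: le_trans (uv _ _) _; rewrite ge_max fC.
Qed.

Section RootBounds.
Variables (R : realType) (L : fieldType) (v : L -> R).
Hypothesis av : absolute_value v.

(** Each linear factor at most doubles the total size of the coefficients. *)
Lemma coef_sum_prod_XsubC (s : seq L) (N : nat) :
  (forall z, z \in s -> v z <= 1) ->
  \sum_(k < N) v (\prod_(z <- s) ('X - z%:P))`_k <= 2 ^+ size s.
Proof.
elim: s N => [|z s IH] N hs.
  rewrite big_nil expr0; case: N => [|N]; first by rewrite big_ord0.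
  rewrite big_ord_recl coef1 /= (av1 av) big1 ?addr0 // => i _.
  by rewrite coef1 (av0 av).
rewrite big_cons; set p := \prod_(_ <- s) _.
have hp N' : \sum_(k < N') v p`_k <= 2 ^+ size s.
  by apply: IH => z' z's; apply: hs; rewrite inE z's orbT.
have vz : v z <= 1 by apply: hs; rewrite inE eqxx.
have step : \sum_(k < N) v (('X - z%:P) * p)`_k
    <= \sum_(k < N) v ('X * p)`_k + v z * \sum_(k < N) v p`_k.
  rewrite mulr_sumr -big_split /=; apply: ler_sum => k _.
  by rewrite mulrBl coefB coefCM -(avM av) avB.
apply: le_trans step _; rewrite exprS mulr_natl mulr2n lerD //.
  case: N => [|N]; first by rewrite big_ord0 exprn_ge0.
  rewrite big_ord_recl coefXM /= (av0 av) add0r.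
  rewrite (eq_bigr (fun k : 'I_N => v p`_k)); first exact: hp.
  by move=> k _; rewrite coefXM.
apply: le_trans (hp N); apply: ler_piMl => //.
by apply: sumr_ge0 => k _; rewrite (av_ge0 av).
Qed.

Lemma monic_root_eq (p : {poly L}) (n : nat) (y : L) :
  p \is monic -> size p = n.+1 -> root p y -> y ^+ n = - \sum_(k < n) p`_k * y ^+ k.
Proof.
move=> mp sp /rootP; rewrite horner_coef sp big_ord_recr /= => /eqP.
move/monicP: mp; rewrite lead_coefE sp /= => ->.
by rewrite mul1r addrC addr_eq0 => /eqP.
Qed.

Lemma monic_root_bound (p : {poly L}) (n : nat) (y : L) :
  p \is monic -> size p = n.+1 -> root p y -> 1 <= v y ->
  v y <= \sum_(k < n) v p`_k.
Proof.
move=> mp sp ry vy; have := monic_root_eq mp sp ry.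
case: n sp => [|n] sp.
  by rewrite expr0 big_ord0 oppr0 => /eqP; rewrite oner_eq0.
move=> /(congr1 v); rewrite (avN av) (avX av) => e.
have vy0 : 0 < v y by apply: lt_le_trans vy.
have : v y ^+ n.+1 <= (\sum_(k < n.+1) v p`_k) * v y ^+ n.
  rewrite e; apply: le_trans (av_sum av _ _) _; rewrite mulr_suml; apply: ler_sum => k _.
  rewrite (avM av) (avX av) ler_wpM2l ?(av_ge0 av) //.
  by rewrite ler_weXn2l // -ltnS.
by rewrite exprS ler_pM2r // exprn_gt0.
Qed.

Hypothesis uv : ultrametric v.

Lemma ultrametric_integral (p : {poly L}) (y : L) :
  p \is monic -> (forall k, v p`_k <= 1) -> root p y -> v y <= 1.
Proof.
move=> mp hp ry; rewrite leNgt; apply/negP => vy.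
have sp : size p = (size p).-1.+1.
  by rewrite prednK // lt0n size_poly_eq0 monic_neq0.
have := monic_root_eq mp sp ry; case: (size p).-1 => [|n].
  by rewrite expr0 big_ord0 oppr0 => /eqP; rewrite oner_eq0.
move=> /(congr1 v); rewrite (avN av) (avX av) => e.
have vy0 : 0 < v y by apply: lt_trans vy.
have : v y ^+ n.+1 <= v y ^+ n.
  rewrite e; apply: ultrametric_sum => // [|k]; first by rewrite exprn_ge0 // ltW.
  rewrite (avM av) (avX av) -[leRHS]mul1r ler_pM ?(av_ge0 av) ?exprn_ge0 ?(av_ge0 av) //.
  by rewrite ler_weXn2l ?ltW // -ltnS.
by rewrite exprS ger_pMl ?exprn_gt0 // leNgt vy.
Qed.

Lemma ultrametric_coef_prod_XsubC (s : seq L) (r : R) (k : nat) :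
  1 <= r -> (forall z, z \in s -> v z <= r) ->
  v (\prod_(z <- s) ('X - z%:P))`_k <= r ^+ size s.
Proof.
move=> r1; have r0 : 0 <= r by apply: le_trans r1.
elim: s k => [|z s IH] k hs.
  by rewrite big_nil coef1 expr0; case: (k == 0)%N; rewrite ?(av1 av) ?(av0 av).
have {}IH k' := IH k' (fun z' z's => hs z' (mem_behead (s := z :: s) z's)).
rewrite big_cons mulrBl coefB coefXM coefCM; apply: le_trans (uv _ _) _.
rewrite ge_max (avN av) (avM av) /= exprS; apply/andP; split.
  case: (k == 0)%N; first by rewrite (av0 av) mulr_ge0 // exprn_ge0.
  by apply: le_trans (IH _) _; rewrite ler_peMl // exprn_ge0.
by rewrite ler_pM ?(av_ge0 av) ?hs // inE eqxx.
Qed.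

End RootBounds.

(** The embeddings sigma of K into M over F, together with a polynomial chi x
    over F whose roots are the images of x. *)
Definition conjugates (F K M : fieldType) (j : {rmorphism F -> K})
    (iota : {rmorphism F -> M}) (chi : K -> {poly F}) (n : nat)
    (sigma : 'I_n -> {rmorphism K -> M}) : Prop :=
  [/\ (0 < n)%N, forall i c, sigma i (j c) = iota c
    & forall x, map_poly iota (chi x) = \prod_(i < n) ('X - (sigma i x)%:P)].

Section Conjugates.
Variables (R : realType) (F K M : fieldType) (j : {rmorphism F -> K}).
Variables (iota : {rmorphism F -> M}) (chi : K -> {poly F}) (n : nat).
Variable sigma : 'I_n -> {rmorphism K -> M}.
Hypothesis conj : conjugates j iota chi sigma.

Lemma conjugate_charpoly x :
  [/\ chi x \is monic, size (chi x) = n.+1 & root (map_poly j (chi x)) x].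
Proof.
have [n0 sj /(_ x) chiE] := conj; split => //.
- by rewrite -(map_monic iota) chiE monic_prod_XsubC.
- by rewrite -(size_map_poly iota) chiE size_prod_XsubC /index_enum -enumT size_enum_ord.
- rewrite -(fmorph_root (sigma (Ordinal n0))) -map_poly_comp.
  rewrite (eq_map_poly (g := iota)); last by move=> c /=; rewrite sj.
  by rewrite chiE (bigD1 (Ordinal n0)) //= rootM root_XsubC eqxx.
Qed.

Variables (v : K -> R) (w : M -> R).
Hypotheses (av : absolute_value v) (aw : absolute_value w).
Hypothesis vw : forall c, v (j c) = w (iota c).

(** All powers of x are roots of monic polynomials whose coefficients are
    bounded by the same constant, so these powers are bounded for v. *)
Lemma le1_of_conjugates x : (forall i, w (sigma i x) <= 1) -> v x <= 1.
Proof.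
move=> hx; apply: (@le1_of_bounded_powers _ _ (2 ^+ n)) => m; rewrite -(avX av).
have [vx1|/ltW vx1] := leP (v (x ^+ m)) 1.
  by apply: le_trans vx1 _; rewrite exprn_ege1 // ler1n.
have [_ _ chiE] := conj; have [mchi schi rchi] := conjugate_charpoly (x ^+ m).
apply: le_trans (monic_root_bound av (n := n) _ _ rchi vx1) _.
- by rewrite map_monic.
- by rewrite size_map_poly.
have := @coef_sum_prod_XsubC _ _ _ aw [seq sigma i (x ^+ m) | i <- enum 'I_n] n.
rewrite big_map big_enum /= -chiE size_map size_enum_ord.
rewrite (eq_bigr (fun k : 'I_n => v (map_poly j (chi (x ^+ m)))`_k)); last first.
  by move=> k _; rewrite !coef_map vw.
apply=> z /mapP[i _ ->]; rewrite rmorphXn (avX aw) exprn_ile1 ?(av_ge0 aw) //.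
Qed.

(** Were v different from every conjugate, approximation would produce an
    element large for v and small for all conjugates. *)
Lemma extension_is_conjugate : (exists c, 1 < v (j c)) ->
  exists i, v = w \o sigma i.
Proof.
have [n0 sj _] := conj; move=> [c vc]; apply: contrapT => /forallNP nv.
have aws i : absolute_value (w \o sigma i) by apply: av_comp.
have sep i : exists2 y, 1 < v y & w (sigma i y) < 1.
  have [x0 vwx0] : exists x, v x <> w (sigma i x).
    by apply: contrapT => /forallNP h; apply: (nv i); apply/funext => x; apply: contrapT (h x).
  have x00 : x0 != 0.
    by apply/eqP => x00; apply: vwx0; rewrite x00 rmorph0 (av0 av) (av0 aw).
  have [x xn0 lt_wv] : exists2 x, x != 0 & w (sigma i x) < v x.
    move/eqP: vwx0; rewrite neq_lt => /orP[lt_vw|lt_wv]; last by exists x0.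
    exists x0^-1; first by rewrite invr_eq0.
    by rewrite fmorphV (avV aw) (avV av) ltf_pV2 // posrE av_gt0 // fmorph_eq0.
  have wx0 : 0 < w (sigma i x) by rewrite (av_gt0 aw) // fmorph_eq0.
  have vx0 : 0 < v x by rewrite (av_gt0 av).
  (* x^a / c^k straddles 1 once a times the logarithmic gap exceeds log |c|. *)
  pose l := ln (v (j c)); have l0 : 0 < l by rewrite ln_gt0.
  pose a := (Num.truncn (l / (ln (v x) - ln (w (sigma i x))))).+1.
  have d0 : 0 < ln (v x) - ln (w (sigma i x)) by rewrite subr_gt0 ltr_ln ?posrE.
  have la : l < a%:R * ln (v x) - a%:R * ln (w (sigma i x)).
    by rewrite -mulrBr -ltr_pdivrMr // truncnS_gt.
  pose k := Num.floor (a%:R * ln (w (sigma i x)) / l) + 1.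
  have k1 : a%:R * ln (w (sigma i x)) < k%:~R * l.
    by rewrite -ltr_pdivrMr // floorD1_gt.
  have k2 : k%:~R * l < a%:R * ln (v x).
    have : (Num.floor (a%:R * ln (w (sigma i x)) / l))%:~R * l <= a%:R * ln (w (sigma i x)).
      by rewrite -ler_pdivlMr // floor_le.
    by rewrite /k intrD mulrDl mul1r; lra.
  have vc0 : 0 < v (j c) by apply: lt_trans vc.
  have lnz : ln (v (j c) ^ k) = k%:~R * l.
    rewrite /l; case: (k) => m; rewrite ?NegzE -?exprnP -?exprnN.
      by rewrite lnXn // mulr_natl.
    by rewrite lnV ?posrE ?exprn_gt0 // lnXn // -mulr_natl mulrNz mulNr.
  exists (x ^+ a / j c ^ k).
    rewrite (avM av) (avV av) (avX av) (av_exprz av) ltr_pdivlMr ?exprz_gt0 // mul1r.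
    by rewrite -ltr_ln ?posrE ?exprz_gt0 ?exprn_gt0 // lnz lnXn // -mulr_natl.
  rewrite rmorphM fmorphV rmorphXn fmorphXz sj (avM aw) (avV aw) (avX aw) (av_exprz aw).
  rewrite -vw ltr_pdivrMr ?exprz_gt0 // mul1r.
  by rewrite -ltr_ln ?posrE ?exprz_gt0 ?exprn_gt0 // lnz lnXn // -mulr_natl.
have [|||x vx wx] := @artin_whaples R K v n
    (fun m => if insub m is Some i then w \o sigma i else v) av.
- by move=> m lt_mn; rewrite insubT /=; apply: aws.
- by move=> m lt_mn; rewrite insubT /=; apply: sep.
- by exists (j c).
suff : v x <= 1 by rewrite leNgt vx.
apply: le1_of_conjugates => i; apply: ltW.
by have := wx i (ltn_ord i); rewrite valK.
Qed.

End Conjugates.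

(** * Embeddings of a finite extension *)

Lemma rmorphism_of_fun (A B : pzRingType) (f : A -> B) :
  (forall x y, f (x - y) = f x - f y) -> (forall x y, f (x * y) = f x * f y) ->
  f 1 = 1 -> exists g : {rmorphism A -> B}, g =1 f.
Proof.
move=> fB fM f1.
pose zf := GRing.isZmodMorphism.Build A B f fB.
pose mf := GRing.isMonoidMorphism.Build A B f (f1, fM).
pose g : {rmorphism A -> B} := HB.pack f zf mf.
by exists g.
Qed.

Section PrimitiveElement.
Variables (F : fieldType) (K : fieldExtType F).
Hypothesis F0 : [pchar F] =i pred0.

Lemma primitive_minpoly : exists (alpha : K) (f : {poly F}),
  [/\ size f = (\dim {:K}).+1, f \is monic, separable_poly f,
      forall g, root (map_poly (in_alg K) g) alpha = (f %| g)
    & forall x, exists g : {poly F}, x = (map_poly (in_alg K) g).[alpha] ].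
Proof.
have K0 : [pchar K] =i pred0 by move=> p; rewrite pchar_lalg F0.
have sep : separable 1%AS {:K}%AS.
  by apply/separableP => y _; apply: pcharf0_separable.
pose alpha := separable_generator 1%AS {:K}%AS.
have fullE : ({:K} = <<1; alpha>>)%VS.
  exact: (eq_adjoin_separable_generator sep (sub1v _)).
have /polyOver1P[f fE] := minPolyOver 1%AS alpha.
exists alpha, f; split.
- rewrite -(size_map_poly (in_alg K)) -fE size_minPoly fullE.
  by rewrite dim_Fadjoin dimv1 muln1.
- by rewrite -(map_monic (in_alg K)) -fE monic_minPoly.
- rewrite -(separable_map (in_alg K)) -fE.
  exact: (pcharf0_separable 1%AS K0 alpha).
- move=> g; rewrite -(dvdp_map (in_alg K)) -fE; apply/idP/idP => [rg|].
    by apply: minPoly_dvdp => //; apply/polyOver1P; exists g.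
  by move=> /dvdpP[q ->]; rewrite rootM root_minPoly orbT.
- move=> x; have : x \in <<1; alpha>>%VS by rewrite -fullE memvf.
  by case/Fadjoin_polyP => p /polyOver1P[g ->] ->; exists g.
Qed.

(** chi x is the characteristic polynomial of multiplication by x. In the basis
    of powers of a primitive element, the Vandermonde matrix of the roots of f
    diagonalizes this multiplication, with the conjugates of x as eigenvalues. *)
Lemma conjugates_exist : exists (f : {poly F}) (chi : K -> {poly F}), f != 0 /\
  forall (M : fieldType) (iota : {rmorphism F -> M}) (s : seq M),
    map_poly iota f %= \prod_(z <- s) ('X - z%:P) ->
    exists sigma : 'I_(\dim {:K}) -> {rmorphism K -> M},
      conjugates (in_alg K : {rmorphism F -> K}) iota chi sigma.
Proof.
have [alpha [f [szf mf sepf rootf genf]]] := primitive_minpoly.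
pose g x := sval (cid (genf x)).
have gE x : x = (map_poly (in_alg K) (g x)).[alpha] by rewrite /g; case: cid.
set n := \dim {:K} in szf *.
pose A x : 'M[F]_n := \matrix_(i, k) ((g x * 'X^i) %% f)`_k.
have f0 : f != 0 by apply: monic_neq0.
exists f, (fun x => char_poly (A x)); split=> // M iota s fs.
have szs : size s = n.
  by apply/eqP; rewrite -eqSS -(size_prod_XsubC s id) -(eqp_size fs) size_map_poly szf.
have us : uniq s.
  by rewrite -separable_prod_XsubC -(eqp_separable fs) separable_map.
have n0 : (0 < n)%N by rewrite /n adim_gt0.
pose z (i : 'I_n) := nth 0 s i.
have zroot i p : f %| p -> (map_poly iota p).[z i] = 0.
  rewrite -(dvdp_map iota) (eqp_dvdl _ fs) => h; apply/rootP.
  have : root (\prod_(z <- s) ('X - z%:P)) (z i).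
    by rewrite root_prod_XsubC mem_nth // szs.
  by case/dvdpP: h => q -> rz; rewrite rootM rz orbT.
have ev i p q : (map_poly (in_alg K) p).[alpha] = (map_poly (in_alg K) q).[alpha] ->
    (map_poly iota p).[z i] = (map_poly iota q).[z i].
  move=> /eqP; rewrite -subr_eq0 -hornerN -hornerD -rmorphB => pq.
  apply/eqP; rewrite -subr_eq0 -hornerN -hornerD -rmorphB zroot //.
  by rewrite -rootf.
have /choice[sigma sigmaE] : forall i : 'I_n, exists sg : {rmorphism K -> M},
    sg =1 fun x => (map_poly iota (g x)).[z i].
  move=> i; apply: rmorphism_of_fun => [x y|x y|].
  - by rewrite -hornerN -hornerD -rmorphB; apply: ev; rewrite -gE rmorphB hornerD hornerN -!gE.
  - by rewrite -hornerM -rmorphM; apply: ev; rewrite -gE rmorphM hornerM -!gE.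
  - have -> : 1 = (map_poly iota 1).[z i] by rewrite rmorph1 -polyC1 hornerC.
    by apply: ev; rewrite -gE rmorph1 -polyC1 hornerC.
exists sigma; split => // [i c|x].
  rewrite sigmaE -[RHS](hornerC _ (z i)) -map_polyC; apply: ev.
  by rewrite -gE map_polyC hornerC.
pose r (i : 'I_n) := (g x * 'X^i) %% f.
have szr i : (size (r i) <= n)%N by rewrite -ltnS -szf ltn_modp.
rewrite map_char_poly.
pose V := Vandermonde n (\row_(k < n) z k).
pose D := diag_mx (\row_(k < n) sigma k x).
have AV : map_mx iota (A x) *m V = V *m D.
  apply/matrixP => i k; rewrite mul_mx_diag !mxE.
  transitivity (map_poly iota (r i)).[z k].
    rewrite (@horner_coef_wide _ n) ?size_map_poly //; apply: eq_bigr => l _.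
    by rewrite !mxE coef_map.
  transitivity (map_poly iota (g x * 'X^i)).[z k].
    rewrite [X in _ = (map_poly _ X).[_]](divp_eq _ f) rmorphD hornerD.
    by rewrite (zroot k (_ * f)) ?add0r // dvdp_mull.
  by rewrite rmorphM /= hornerM map_polyXn hornerXn sigmaE mulrC.
have VN0 : \det V != 0.
  rewrite det_Vandermonde; apply/prodf_neq0 => i _; apply/prodf_neq0 => k ik.
  by rewrite !mxE subr_eq0 nth_uniq ?szs // gtn_eqF.
have mV0 : \det (map_mx polyC V) != 0 by rewrite det_map_mx polyC_eq0.
apply: (mulIf mV0); rewrite /char_poly -det_mulmx.
have -> : char_poly_mx (map_mx iota (A x)) *m map_mx polyC V = map_mx polyC V *m char_poly_mx D.
  rewrite mulmxBl mulmxBr -!map_mxM AV; congr (_ - _).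
  by rewrite mul_scalar_mx mul_mx_scalar.
rewrite det_mulmx mulrC; congr (_ * _).
have -> : char_poly_mx D = diag_mx (\row_k ('X - (sigma k x)%:P)).
  apply/matrixP => i k; rewrite !mxE; case: eqVneq => [->|_].
    by rewrite !mulr1n.
  by rewrite !mulr0n polyC0 subr0.
by rewrite det_diag; apply: eq_bigr => k _; rewrite mxE.
Qed.

End PrimitiveElement.

Lemma irreducible_factor (F : fieldType) (p : {poly F}) :
  (1 < size p)%N -> exists2 r, r %| p & irreducible_poly r.
Proof.
move=> p1; pose P k := `[< exists r : {poly F}, [/\ r %| p, (1 < size r)%N & size r = k] >].
have exP : exists k, P k by exists (size p); apply/asboolP; exists p.
have [_ /asboolP[r [rp r1 <-]] rmin] := ex_minnP exP.
exists r => //; split => // q q1 qr.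
have r0 : r != 0 by rewrite -size_poly_gt0 ltnW.
rewrite -dvdp_size_eqp // eqn_leq dvdp_leq //= rmin //; apply/asboolP; exists q.
split => //; first exact: dvdp_trans rp.
rewrite ltn_neqAle eq_sym q1 size_poly_gt0 /=.
by apply: contraTneq qr => ->; rewrite dvd0p.
Qed.

Lemma splitting_extension (F : fieldType) (p : {poly F}) : p != 0 ->
  exists (M : fieldExtType F) (s : seq M),
    map_poly (in_alg M) p %= \prod_(z <- s) ('X - z%:P).
Proof.
have [n le_pn] := ubnP (size p); elim: n => // n IH in F p le_pn * => p0.
have [p1|p1] := leqP (size p) 1.
  exists F^o, [::]; rewrite big_nil -size_poly_eq1 size_map_poly.
  by rewrite eqn_leq p1 size_poly_gt0.
have [r rp irr] := irreducible_factor p1.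
have [L _ [z rz _]] := irredp_FAdjoin irr.
have : root (map_poly (in_alg L) p) z.
  by have /dvdpP[q ->] := rp; rewrite rmorphM rootM rz orbT.
case/factor_theorem => q pE.
have q0 : q != 0.
  by apply: contraNneq p0 => q0; rewrite -(map_poly_eq0 (in_alg L)) pE q0 mul0r.
have szq : (size q < n)%N.
  move: le_pn; rewrite -(size_map_poly (in_alg L)) pE size_Mmonic ?monicXsubC //.
  by rewrite size_XsubC addn2 ltnS.
have [M [s qs]] := IH L q szq q0.
exists (baseFieldType M), (in_alg M z :: s); rewrite big_cons.
have -> : map_poly (in_alg (baseFieldType M)) p
    = map_poly (in_alg M) (map_poly (in_alg L) p).
  by rewrite -map_poly_comp; apply: eq_map_poly => c /=; rewrite -baseField_scaleE.
by rewrite pE rmorphM /= map_polyXsubC mulrC eqp_mull.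
Qed.

Lemma fieldExt_algebraic (F : fieldType) (M : fieldExtType F) (x : M) :
  exists2 g : {poly F}, g != 0 & root (map_poly (in_alg M) g) x.
Proof.
have /polyOver1P[g gE] := minPolyOver 1%AS x; exists g.
  by rewrite -(map_poly_eq0 (in_alg M)) -gE monic_neq0 // monic_minPoly.
by rewrite -gE root_minPoly.
Qed.

(** * Valuation rings and their absolute values *)

Definition is_subring (M : pzRingType) (A : set M) : Prop :=
  [/\ A 1, forall x y, A x -> A y -> A (x - y) & forall x y, A x -> A y -> A (x * y)].

Section Subring.
Variables (M : pzRingType) (A : set M).
Hypothesis subA : is_subring A.

Lemma subring0 : A 0. Proof. by case: subA => A1 AB _; rewrite -(subrr 1); apply: AB. Qed.

Lemma subringN x : A x -> A (- x).
Proof. by case: subA => _ AB _ Ax; rewrite -sub0r; apply: AB => //; apply: subring0. Qed.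

Lemma subringD x y : A x -> A y -> A (x + y).
Proof. by case: subA => _ AB _ Ax Ay; rewrite -(opprK y); apply: AB => //; apply: subringN. Qed.

Lemma subringM x y : A x -> A y -> A (x * y). Proof. by case: subA => _ _; apply. Qed.

Lemma subringX x n : A x -> A (x ^+ n).
Proof.
move=> Ax; elim: n => [|n IH]; first by rewrite expr0; case: subA.
by rewrite exprS; apply: subringM.
Qed.

Lemma subring_sum (I : Type) (s : seq I) (f : I -> M) :
  (forall i, A (f i)) -> A (\sum_(i <- s) f i).
Proof.
by move=> Af; elim/big_ind: _ => // [|x y]; [exact: subring0|exact: subringD].
Qed.

End Subring.

Section ValuationRing.
Variables (M : fieldType) (pi : M).

Lemma maximal_subring (O : set M) : is_subring O -> ~ O pi^-1 ->
  exists A, [/\ is_subring A, O `<=` A, ~ A pi^-1 &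
    forall B, is_subring B -> A `<=` B -> ~ B pi^-1 -> B `<=` A].
Proof.
move=> subO Opi.
pose good A := [/\ is_subring A, O `<=` A & ~ A pi^-1].
have goodO : good O by split.
(* The empty set is included so that the empty chain has an upper bound. *)
have [|A [[A0|gA] maxA]] := @Zorn_bigcup M (fun A => A = set0 \/ good A).
- move=> C CP Ctot; have [[A CA gA]|noA] := pselect (exists2 A, C A & good A); last first.
    left; rewrite -subset0 => x [A CA Ax].
    by have [A0|gA] := CP A CA; [rewrite A0 in Ax | case: noA; exists A].
  have [sA OA _] := gA.
  have gC B x : C B -> B x -> good B.
    by move=> CB Bx; have [B0|] := CP B CB; first by rewrite B0 in Bx.
  have up x y : (\bigcup_(X in C) X) x -> (\bigcup_(X in C) X) y ->
      exists B, [/\ C B, is_subring B, B x & B y].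
    move=> [B CB Bx] [B' CB' B'y].
    have [sB _ _] := gC B x CB Bx; have [sB' _ _] := gC B' y CB' B'y.
    by have [BB'|B'B] := Ctot B B' CB CB'; [exists B'|exists B]; split; auto.
  right; split.
  + split=> [|x y Cx Cy|x y Cx Cy].
    * by exists A => //; case: sA.
    * by have [B [CB [_ BB _] Bx By]] := up x y Cx Cy; exists B => //; apply: BB.
    * by have [B [CB [_ _ BM] Bx By]] := up x y Cx Cy; exists B => //; apply: BM.
  + by move=> x /OA Ax; exists A.
  + by move=> [B CB Bpi]; have [_ _ ] := gC B _ CB Bpi; apply.
- case: (maxA O); last by right.
  rewrite A0; split; first by move=> ? [].
  by case: subO => O1 _ _ /(_ 1); apply.
- have [sA OA nA] := gA; exists A; split => // B sB AB nB.
  apply: contrapT => BA; apply: (maxA B); first by split.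
  by right; split => // x /OA /AB.
Qed.

(** A subring A maximal among those that exclude pi^-1 is a valuation ring: if
    neither x nor x^-1 lay in A, then pi^-1 would be a polynomial in x and a
    polynomial in x^-1 over A, and the two relations reduce each other's degree
    until pi^-1 lies in A. *)
Lemma valuation_ring_exists (O : set M) : is_subring O -> O pi -> ~ O pi^-1 ->
  exists A, [/\ is_subring A, O `<=` A, ~ A pi^-1,
    forall x, A x \/ A x^-1 & forall a, A a -> A (1 - pi * a)^-1].
Proof.
move=> subO Opi Opi'; have [A [sA OA nA maxA]] := maximal_subring subO Opi'.
have [A1 AB AM] := sA; have Api : A pi by apply: OA.
have pi0 : pi != 0.
  by apply/eqP => pi0; apply: nA; rewrite pi0 invr0; apply: subring0.
pose D x n := exists p : {poly M},
  [/\ (size p <= n.+1)%N, forall k, A p`_k & p.[x] = pi^-1].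
have adjoin x : ~ A x -> exists n, D x n.
  move=> nAx; apply: contrapT => nD.
  pose B y := exists2 p : {poly M}, forall k, A p`_k & p.[x] = y.
  have BA : B `<=` A.
    apply: maxA => [|y Ay|[p Ap px]].
    + split=> [|_ _ [p Ap <-] [q Aq <-]|_ _ [p Ap <-] [q Aq <-]].
      * exists 1; last by rewrite -polyC1 hornerC.
        by move=> k; rewrite coef1; case: (k == 0)%N => //; apply: subring0.
      * by exists (p - q); [move=> k; rewrite coefB; apply: AB | rewrite hornerD hornerN].
      * exists (p * q); last by rewrite hornerM.
        by move=> k; rewrite coefM; apply: subring_sum => // i; apply: AM.
    + exists y%:P; last by rewrite hornerC.
      by move=> k; rewrite coefC; case: (k == 0)%N => //; apply: subring0.
    + by apply: nD; exists (size p), p.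
  apply: nAx; apply: BA; exists 'X; last by rewrite hornerX.
  by move=> k; rewrite coefX; case: (k == 1)%N => //; apply: subring0.
have unit1 a : A a -> A (1 - pi * a)^-1.
  move=> Aa; apply: contrapT => /adjoin[n [p [szp Ap pu]]].
  set u := 1 - pi * a in pu.
  have u0 : u != 0.
    rewrite subr_eq0; apply/eqP => e; apply: nA.
    by rewrite -[pi^-1]mulr1 e mulKf.
  have Au : A u by apply: AB => //; apply: AM.
  have [a' Aa' uE] : exists2 a', A a' & u ^+ n = 1 - pi * a'.
    elim: (n) => [|m [a' Aa' IH]].
      by exists 0; [exact: subring0 | rewrite mulr0 subr0].
    exists (a + a' - pi * a * a'); last by rewrite exprS IH /u; ring.
    apply: AB; first exact: subringD.
    by apply: (AM) => //; apply: AM.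
  have : A (pi^-1 * u ^+ n).
    rewrite -pu (horner_coef_wide _ szp) mulr_suml; apply: subring_sum => // k.
    rewrite -mulrA exprVn [_^-1 * _]mulrC -exprB ?leq_ord ?unitfE //.
    by apply: AM => //; apply: subringX.
  rewrite uE mulrBr mulr1 mulrA mulVf // mul1r => /(subringD sA)/(_ Aa').
  by rewrite subrK.
exists A; split => // x.
have reduce y n m : y != 0 -> (m <= n.+1)%N -> D y n.+1 -> D y^-1 m -> D y n.
  move=> y0 le_mn [p [szp Ap py]] [q [szq Aq qy]].
  set u := 1 - pi * q`_0; have Au : A u^-1 by apply: unit1.
  have u0 : u != 0.
    rewrite subr_eq0; apply/eqP => e; apply: nA.
    by rewrite -[pi^-1]mulr1 e mulKf.
  pose r := \poly_(i < n.+1) (if (i <= n)%N then pi * q`_(n.+1 - i) * u^-1 else 0).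
  have Ar k : A r`_k.
    rewrite coef_poly; case: ifP => _; last exact: subring0.
    by case: ifP => _; [apply: (AM _ _ _ Au); apply: AM | apply: subring0].
  have ry : r.[y] = y ^+ n.+1.
    have szq' : (size q <= n.+2)%N by apply: leq_trans szq _.
    have qE : q.[y^-1] = q`_0 + \sum_(i < n.+1) q`_i.+1 * y^-1 ^+ i.+1.
      by rewrite (horner_coef_wide _ szq') big_ord_recl expr0 mulr1.
    apply: (mulfI u0); rewrite horner_poly mulr_sumr.
    have -> : u * y ^+ n.+1 = pi * ((q.[y^-1] - q`_0) * y ^+ n.+1).
      by rewrite qy /u; field.
    rewrite qE [q`_0 + _]addrC addrK.
    rewrite mulr_suml mulr_sumr (reindex_inj rev_ord_inj) /=; apply: eq_bigr => i _.
    rewrite subSS leq_subr subSn ?leq_subr // subKn -1?ltnS //.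
    have -> : y ^+ n.+1 = y ^+ (n - i) * y ^+ i.+1.
      by rewrite -exprD addnS subnK // -ltnS.
    by rewrite exprVn; field; rewrite u0 expf_neq0.
  exists (take_poly n.+1 p + p`_n.+1 *: r); split.
  - rewrite (leq_trans (size_polyD _ _)) // geq_max size_take_poly.
    by rewrite (leq_trans (size_scale_leq _ _)) // size_poly.
  - move=> k; rewrite coefD coefZ coef_take_poly; apply: subringD => //; last exact: AM.
    by case: ifP => _ //; apply: subring0.
  - rewrite hornerD hornerZ ry -py [in RHS](horner_coef_wide _ szp) big_ord_recr /=.
    congr (_ + _); rewrite (horner_coef_wide _ (size_take_poly _ _)).
    by apply: eq_bigr => i _; rewrite coef_take_poly ltn_ord.
apply: contrapT => /not_orP[nx nx'].
have x0 : x != 0 by apply/eqP => x0; apply: nx; rewrite x0; apply: subring0.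
have D0 y : ~ D y 0.
  move=> [p [szp Ap py]]; apply: nA; rewrite -py (size1_polyC szp) hornerC; exact: Ap.
have [n Dn] := adjoin _ nx; have [m Dm] := adjoin _ nx'.
have [N le_N] := ubnP (n + m); elim: N => // N IH in n m Dn Dm le_N *.
have [le_mn|lt_nm] := leqP m n.
  case: n le_mn Dn le_N => [|n] le_mn Dn le_N; first exact: (D0 x).
  by apply: (IH n m) => //; apply: reduce Dm.
case: m lt_nm Dm le_N => // m lt_nm Dm le_N.
apply: (IH n m) => //; last by rewrite addnS in le_N.
by apply: (reduce _ _ n) => //; rewrite ?invr_eq0 ?invrK // ltnW.
Qed.

End ValuationRing.

Section ValuationAbsoluteValue.
Variables (R : realType) (M : fieldType) (pi : M) (A : set M).
Hypotheses (sA : is_subring A) (nA : ~ A pi^-1) (tA : forall x, A x \/ A x^-1).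
Hypothesis Api : A pi.

Definition ring_unit (x : M) : Prop := [/\ x != 0, A x & A x^-1].

Lemma uniformizer_neq0 : pi != 0.
Proof. by apply/eqP => pi0; apply: nA; rewrite pi0 invr0; apply: subring0. Qed.

Let pi0 := uniformizer_neq0.

Lemma ring_unitM x y : ring_unit x -> ring_unit y -> ring_unit (x * y).
Proof.
by move=> [x0 Ax Ax'] [y0 Ay Ay']; split; rewrite ?mulf_neq0 ?invfM //; apply: subringM.
Qed.

Lemma ring_unitV x : ring_unit x -> ring_unit x^-1.
Proof. by move=> [x0 Ax Ax']; split; rewrite ?invr_eq0 ?invrK. Qed.

Lemma ring_unitX x n : ring_unit x -> ring_unit (x ^+ n).
Proof.
by move=> [x0 Ax Ax']; split; rewrite ?expf_neq0 -?exprVn //; apply: subringX.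
Qed.

Lemma uniformizerXV n : ~ A (pi ^+ n.+1)^-1.
Proof.
move=> h; apply: nA; have : A (pi ^+ n * (pi ^+ n.+1)^-1) by apply: subringM => //; apply: subringX.
by rewrite exprS invfM mulrCA divff ?mulr1 // expf_neq0.
Qed.

Lemma ring_unit_uniformizer (z : int) : ring_unit (pi ^ z) -> z = 0.
Proof.
case: z => [[|n]|n] [_] //; first by move=> _ /uniformizerXV.
by rewrite NegzE -exprnN => /uniformizerXV.
Qed.

Hypothesis rank1 : forall x, x != 0 ->
  exists m (z : int), (0 < m)%N /\ ring_unit (x ^+ m * pi ^ z).

Variable lam : R.
Hypothesis lam0 : 0 < lam.

Let rel (x : M) (q : R) := exists m (z : int),
  [/\ (0 < m)%N, ring_unit (x ^+ m * pi ^ z) & q = z%:~R / m%:R].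

Let relP x q q' : rel x q -> rel x q' -> q = q'.
Proof.
move=> [m [z [m0 u ->]]] [m' [z' [m0' u' ->]]].
have := ring_unitM (ring_unitX m' u) (ring_unitV (ring_unitX m u')).
have x0 : x != 0.
  case: u; rewrite mulf_eq0 negb_or expf_eq0 m0 => /andP[] //.
have xm0 k : x ^+ k != 0 by rewrite expf_neq0.
have -> : (x ^+ m * pi ^ z) ^+ m' / (x ^+ m' * pi ^ z') ^+ m
    = pi ^ (z * m' - z' * m).
  rewrite !exprMn invfM -!exprM mulnC mulrACA divff // mul1r.
  by rewrite !exprnP !exprz_exp invr_expz -expfzDr.
move/ring_unit_uniformizer/eqP; rewrite subr_eq0 => /eqP e.
apply/eqP; rewrite eqr_div ?pnatr_eq0 -?lt0n //.
by rewrite !pmulrn -!intrM e.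
Qed.

(** If x^m pi^z is a unit, then x has the size of pi^(-z/m); the value z / m does
    not depend on the choice of m and z. *)
Definition valuation_abs (x : M) : R :=
  if x == 0 then 0 else expR (lam * xget 0 (rel x)).

Lemma valuation_absE x m (z : int) : (0 < m)%N -> ring_unit (x ^+ m * pi ^ z) ->
  valuation_abs x = expR (lam * (z%:~R / m%:R)).
Proof.
move=> m0 u; have x0 : x != 0.
  by case: u; rewrite mulf_eq0 negb_or expf_eq0 m0 => /andP[].
rewrite /valuation_abs (negbTE x0); congr (expR (lam * _)).
have r : rel x (z%:~R / m%:R) by exists m, z.
by apply: (relP _ r); apply: (xgetPex 0 (ex_intro _ _ r)).
Qed.

Lemma valuation_abs_uniformizer : valuation_abs pi = expR (- lam).
Proof.
rewrite (@valuation_absE pi 1 (-1)) //; last first.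
  by rewrite expr1 exprN1 divff //; split; rewrite ?oner_neq0 ?invr1 //; case: sA.
by rewrite divr1 mulrN1z mulrN mulr1.
Qed.

Lemma valuation_abs_unit x : ring_unit x -> valuation_abs x = 1.
Proof.
move=> u; have u1 : ring_unit (x ^+ 1 * pi ^ 0) by rewrite expr1 expr0z mulr1.
by rewrite (valuation_absE _ u1) // mulr0z mul0r mulr0 expR0.
Qed.

Lemma valuation_abs_le1 x : A x <-> valuation_abs x <= 1.
Proof.
have [->|x0] := eqVneq x 0.
  by rewrite /valuation_abs eqxx; split=> // _; apply: subring0.
have [m [z [m0 u]]] := rank1 x0; rewrite (valuation_absE m0 u) -[X in _ <= X]expR0 ler_expR.
rewrite pmulr_rle0 // ler_pdivrMr ?ltr0n // mul0r lerz0.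
have [_ u1 u2] := u; split=> [Ax|z0].
  rewrite leNgt; apply/negP; case: z {u} u1 u2 => // -[|n] // _ u2 _.
  apply: (@uniformizerXV n); have : A (x ^+ m * (x ^+ m * pi ^ n.+1)^-1).
    by apply: subringM => //; apply: subringX.
  by rewrite invfM mulrA divff ?expf_neq0 // mul1r.
have Axm : A (x ^+ m).
  rewrite -[x ^+ m](mulfK (expfz_neq0 z pi0)) invr_expz; apply: subringM => //.
  have -> : - z = `|z|%N by lia.
  by rewrite -exprnP; apply: subringX.
have [//|Ax'] := tA x; rewrite -[x]mulr1 -(divff (expf_neq0 m.-1 x0)) mulrA -exprS prednK //.
by rewrite -exprVn; apply: subringM => //; apply: subringX.
Qed.

Let abs0 : valuation_abs 0 = 0. Proof. by rewrite /valuation_abs eqxx. Qed.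

Let abs_gt0 x : x != 0 -> 0 < valuation_abs x.
Proof. by move=> x0; rewrite /valuation_abs (negbTE x0) expR_gt0. Qed.

Let abs_ge0 x : 0 <= valuation_abs x.
Proof. by have [->|/abs_gt0/ltW//] := eqVneq x 0; rewrite abs0. Qed.

Let absM x y : valuation_abs (x * y) = valuation_abs x * valuation_abs y.
Proof.
have [->|x0] := eqVneq x 0; first by rewrite mul0r abs0 mul0r.
have [->|y0] := eqVneq y 0; first by rewrite mulr0 abs0 mulr0.
have [m [z [m0 u]]] := rank1 x0; have [m' [z' [m0' u']]] := rank1 y0.
rewrite (valuation_absE m0 u) (valuation_absE m0' u').
rewrite (@valuation_absE (x * y) (m * m') (z * m' + z' * m)).
- rewrite -expRD -mulrDr; congr (expR (lam * _)).
  by rewrite intrD !intrM natrM addf_div ?pnatr_eq0 -?lt0n.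
- by rewrite muln_gt0 m0.
- have := ring_unitM (ring_unitX m' u) (ring_unitX m u').
  rewrite !exprMn -!exprM [(m' * m)%N]mulnC mulrACA.
  by rewrite expfzDr // !exprnP !exprz_exp.
Qed.

Lemma valuation_abs_ultrametric : ultrametric valuation_abs.
Proof.
suff ultra x y : x != 0 -> valuation_abs y <= valuation_abs x ->
    valuation_abs (x + y) <= valuation_abs x.
  move=> x y; rewrite le_max.
  have [->|x0] := eqVneq x 0; first by rewrite add0r lexx orbT.
  have [->|y0] := eqVneq y 0; first by rewrite addr0 lexx.
  have [yx|/ltW xy] := leP (valuation_abs y) (valuation_abs x); first by rewrite ultra.
  by rewrite addrC ultra // orbT.
move=> x0 yx; have yE : y = x * (y / x) by rewrite mulrC divfK.
have : A (y / x).
  by apply/valuation_abs_le1; rewrite -(ler_pM2l (abs_gt0 x0)) -absM -yE mulr1.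
have A1 : A 1 by case: sA.
move=> /(subringD sA A1)/valuation_abs_le1 h.
by rewrite {1}yE -[x in x + _]mulr1 -mulrDr absM ler_piMr.
Qed.

Lemma valuation_abs_absolute_value : absolute_value valuation_abs.
Proof.
split=> // [x|x y].
  by split=> [|->//]; have [//|/abs_gt0 + e] := eqVneq x 0; rewrite e ltxx.
apply: le_trans (valuation_abs_ultrametric _ _) _.
by rewrite ge_max lerDl lerDr !abs_ge0.
Qed.

End ValuationAbsoluteValue.

(** * Extension of discrete absolute values *)

Section RankOne.
Variables (M : fieldType) (pi : M) (A : set M).
Hypotheses (sA : is_subring A) (nA : ~ A pi^-1) (tA : forall x, A x \/ A x^-1).
Hypothesis Api : A pi.

Let unit1 : ring_unit A 1.
Proof. by split; rewrite ?oner_neq0 ?invr1 //; case: sA. Qed.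

Lemma ring_unitD_nonunit u z : ring_unit A u -> A z -> z = 0 \/ ~ A z^-1 ->
  ring_unit A (u + z).
Proof.
move=> [u0 Au Au'] Az nz; have [->|z0] := eqVneq z 0; first by rewrite addr0.
have {}nz : ~ A z^-1 by case: nz => // z00; rewrite z00 eqxx in z0.
have uz0 : u + z != 0.
  rewrite addr_eq0; apply/eqP => uz; apply: nz.
  by rewrite -[z]opprK -uz invrN; apply: subringN.
split=> //; first exact: subringD.
have [h|] := tA (z / (u + z)).
  have -> : (u + z)^-1 = u^-1 * (1 - z / (u + z)) by field; rewrite u0 uz0.
  by have [A1 AB AM] := sA; apply: AM => //; apply: AB.
rewrite invfM invrK mulrC => h; case: nz.
have -> : z^-1 = u^-1 * ((u + z) * z^-1 - 1) by field; rewrite z0 u0.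
by have [A1 AB AM] := sA; apply: AM => //; apply: AB.
Qed.

(** In a valuation ring a sum has the size of its largest term when no two
    nonzero terms have the same size; so a vanishing sum has two terms of
    the same size. *)
Lemma dominant_term (I : eqType) (s : seq I) (t : I -> M) : uniq s ->
  (forall i j, i \in s -> j \in s -> i != j -> t i != 0 -> t j != 0 ->
     ~ ring_unit A (t i / t j)) ->
  (exists2 i, i \in s & t i != 0) ->
  exists i, [/\ i \in s, t i != 0 & ring_unit A ((\sum_(k <- s) t k) / t i)].
Proof.
elim: s => [|k s IH] //=; first by move=> _ _ [].
move=> /andP[ks us] hs [i0 i0s ti0]; rewrite big_cons.
have hs' i j : i \in s -> j \in s -> i != j -> t i != 0 -> t j != 0 ->
    ~ ring_unit A (t i / t j).
  by move=> is_ js; apply: hs; rewrite inE ?is_ ?js orbT.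
have [[i1 i1s ti1]|no] := pselect (exists2 i, i \in s & t i != 0); last first.
  have z i : i \in s -> t i = 0.
    by move=> is_; apply/eqP; apply: contrapT => /negP h; apply: no; exists i.
  have i0k : i0 = k.
    by move: i0s; rewrite inE => /orP[/eqP//|/z e]; rewrite e eqxx in ti0.
  exists k; rewrite -i0k ti0 inE eqxx /= big_seq big1 => [|i is_]; last exact: z.
  by rewrite addr0 divff.
have [|i [is_ ti u]] := IH us hs'; first by exists i1.
have [tk0|tk0] := eqVneq (t k) 0.
  by exists i; rewrite tk0 add0r inE is_ orbT.
have ki : k != i by apply: contraNneq ks => ->.
have kin : k \in k :: s by rewrite inE eqxx.
have iin : i \in k :: s by rewrite inE is_ orbT.
have [u0 Au Au'] := u; have [A1 AB AM] := sA.
have S0 : \sum_(j <- s) t j != 0 by apply: contraNneq u0 => ->; rewrite mul0r.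
have [Aki|Aik] := tA (t k / t i).
  exists i; split=> //; rewrite mulrDl addrC; apply: ring_unitD_nonunit => //; right => Aki'.
  by apply: (hs k i kin iin ki tk0 ti); split; rewrite ?mulf_neq0 ?invr_eq0.
exists k; split=> //; rewrite mulrDl divff //.
set S := \sum_(j <- s) t j in u u0 Au Au' S0 *.
apply: ring_unitD_nonunit => //.
  have -> : S / t k = (S / t i) * (t k / t i)^-1 by field; rewrite tk0 ti.
  exact: AM.
right => h; apply: (hs k i kin iin ki tk0 ti); split; rewrite ?mulf_neq0 ?invr_eq0 //.
have -> : t k / t i = (S / t k)^-1 * (S / t i) by field; rewrite tk0 ti S0.
exact: AM.
Qed.

(** In an algebraic relation satisfied by x two nonzero terms have the same
    size, which compares a power of x with an element of F, that is, with a
    power of pi up to a unit. *)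
Lemma rank_one_of_algebraic (F : fieldType) (iota : {rmorphism F -> M}) :
  (forall x, exists2 g : {poly F}, g != 0 & root (map_poly iota g) x) ->
  (forall c, c != 0 -> exists z : int, ring_unit A (iota c * pi ^ z)) ->
  forall x, x != 0 -> exists m (z : int), (0 < m)%N /\ ring_unit A (x ^+ m * pi ^ z).
Proof.
move=> alg fin x x0; have [g g0 /rootP gx] := alg x.
rewrite horner_coef size_map_poly in gx.
have [[i [j [ij ti tj u]]]|no] := pselect (exists i j : 'I_(size g), [/\ (j < i)%N,
    g`_i != 0, g`_j != 0 & ring_unit A ((iota g`_i * x ^+ i) / (iota g`_j * x ^+ j))]).
  have [z uz] := fin (g`_i / g`_j) (mulf_neq0 ti (invr_neq0 tj)).
  exists (i - j)%N, (- z); split; first by rewrite subn_gt0.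
  have pi0 := uniformizer_neq0 sA nA.
  have := ring_unitM sA u (ring_unitV uz); congr (ring_unit A _).
  have -> : x ^+ i = x ^+ (i - j) * x ^+ j by rewrite -exprD subnK // ltnW.
  rewrite rmorphM fmorphV -invr_expz; field.
  by rewrite !fmorph_eq0 expfz_neq0 // expf_neq0 // ti tj.
have [|||i [_ _ [+ _ _]]] := @dominant_term _ (index_enum 'I_(size g))
    (fun i => iota g`_i * x ^+ i).
- exact: index_enum_uniq.
- move=> i j _ _ ij; rewrite !mulf_eq0 !negb_or !fmorph_eq0 => /andP[gi _] /andP[gj _] u.
  move: ij; rewrite neq_ltn => /orP[ij|ji]; apply: no; last by exists i, j.
  by exists j, i; split=> //; rewrite -invf_div; apply: ring_unitV.
- have lt_g : ((size g).-1 < size g)%N by rewrite ltn_predL size_poly_gt0.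
  exists (Ordinal lt_g); first by rewrite mem_index_enum.
  by rewrite /= mulf_neq0 ?expf_neq0 // fmorph_eq0 -lead_coefE lead_coef_eq0.
- rewrite (eq_bigr (fun k : 'I__ => (map_poly iota g)`_k * x ^+ k)) ?gx ?mul0r ?eqxx //.
  by move=> k _; rewrite coef_map.
Qed.

End RankOne.

(** Such an element becomes a unit in every local ring that contains D and whose
    maximal ideal contains p. *)
Definition unit_mod (F : fieldType) (D : set F) (p a : F) : Prop :=
  D a /\ exists r s, [/\ D r, D s & a * r = 1 - p * s].

(** A valuation ring of M that contains D, and in which p is not invertible,
    defines w. It has rank one because M is algebraic over F and every element
    of F is a power of p up to a unit. *)
Lemma ultrametric_extension (R : realType) (F M : fieldType) (iota : {rmorphism F -> M})
    (D : set F) (p : F) (lam : R) :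
  (forall x, exists2 g : {poly F}, g != 0 & root (map_poly iota g) x) ->
  is_subring D -> D p -> ~ D p^-1 ->
  (forall c, c != 0 -> exists (z : int) a b,
     [/\ unit_mod D p a, unit_mod D p b & c = p ^ z * (a / b)]) ->
  0 < lam ->
  exists w : M -> R, [/\ absolute_value w, ultrametric w,
    w (iota p) = expR (- lam) & forall a, unit_mod D p a -> w (iota a) = 1].
Proof.
move=> alg sD Dp Dp' dec lam0.
pose O : set M := [set iota a | a in D].
have sO : is_subring O.
  have [D1 DB DM] := sD; split=> [|_ _ [a Da <-] [b Db <-]|_ _ [a Da <-] [b Db <-]].
  - by exists 1; rewrite ?rmorph1.
  - by exists (a - b); rewrite ?rmorphB //; apply: DB.
  - by exists (a * b); rewrite ?rmorphM //; apply: DM.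
have [|[a Da]|A [sA OA nA tA uA]] := @valuation_ring_exists M (iota p) O sO.
- by exists p.
- by rewrite -fmorphV => /fmorph_inj ap; rewrite ap in Da.
have DA a : D a -> A (iota a) by move=> Da; apply: OA; exists a.
have p0 : p != 0 by apply/eqP => p0; apply: Dp'; rewrite p0 invr0; apply: subring0.
have unitA a : unit_mod D p a -> ring_unit A (iota a).
  move=> [Da [r [s [Dr Ds e]]]].
  have a0 : a != 0.
    apply/eqP => a0; apply: Dp'; move/eqP: e; rewrite a0 mul0r eq_sym subr_eq0 => /eqP e.
    by rewrite -[p^-1]mulr1 e mulKf.
  split; [by rewrite fmorph_eq0 | exact: DA | ].
  have := uA _ (DA _ Ds); rewrite -rmorphM -[1 in X in X -> _](rmorph1 iota) -rmorphB -e => h.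
  have r0 : r != 0.
    apply/eqP => r0; apply: Dp'; move/eqP: e; rewrite r0 mulr0 eq_sym subr_eq0 => /eqP e.
    by rewrite -[p^-1]mulr1 e mulKf.
  have -> : (iota a)^-1 = iota r * (iota (a * r))^-1.
    by rewrite -!fmorphV -rmorphM; congr (iota _); field; rewrite a0 r0.
  by apply: subringM => //; apply: DA.
have rk := rank_one_of_algebraic sA nA tA alg.
have {}rk : forall x, x != 0 ->
    exists m (z : int), (0 < m)%N /\ ring_unit A (x ^+ m * iota p ^ z).
  apply: rk => c /dec[z [a [b [ua ub ->]]]]; exists (- z).
  have := ring_unitM sA (unitA _ ua) (ring_unitV (unitA _ ub)); congr (ring_unit A _).
  rewrite rmorphM fmorphXz fmorph_div mulrAC -expfzDr ?fmorph_eq0 // subrr expr0z mul1r //.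
have Ap := DA _ Dp.
exists (valuation_abs (iota p) A lam); split.
- exact: valuation_abs_absolute_value.
- exact: valuation_abs_ultrametric.
- exact: valuation_abs_uniformizer.
- by move=> a ua; apply: valuation_abs_unit => //; apply: unitA.
Qed.

(** * Places and product formula from unique factorization *)

(** The sum of ln (u c) over all of U vanishes; it is presented by the finite
    lists that contain every u with u c != 1. *)
Definition product_formula_at (R : realType) (F : fieldType) (U : set (F -> R)) (c : F) : Prop :=
  exists l0 : seq (F -> R),
    [/\ forall u, u \in l0 -> U u,
        forall u, U u -> u \notin l0 -> u c = 1
      & forall l, uniq l -> (forall u, u \in l -> U u) -> {subset l0 <= l} ->
          \sum_(u <- l) ln (u c) = 0].

Section ProductFormula.
Variables (R : realType) (F : fieldType) (U : set (F -> R)).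
Hypothesis absU : forall u, U u -> absolute_value u.

Lemma product_formulaM c c' : c != 0 -> c' != 0 -> product_formula_at U c ->
  product_formula_at U c' -> product_formula_at U (c * c').
Proof.
move=> c0 c0' [l [lU l1 lS]] [l' [lU' l1' lS']]; exists (l ++ l'); split.
- by move=> u; rewrite mem_cat => /orP[/lU|/lU'].
- move=> u Uu; rewrite mem_cat negb_or => /andP[ul ul'].
  by rewrite (avM (absU Uu)) l1 // l1' // mulr1.
- move=> s us sU sub; have sl : {subset l <= s}.
    by move=> u ul; apply: sub; rewrite mem_cat ul.
  have sl' : {subset l' <= s} by move=> u ul; apply: sub; rewrite mem_cat ul orbT.
  transitivity (\sum_(u <- s) ln (u c) + \sum_(u <- s) ln (u c')); last first.
    by rewrite lS // lS' // addr0.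
  rewrite -big_split /=.
  apply: eq_big_seq => u /sU/absU au.
  by rewrite (avM au) lnM // posrE (av_gt0 au).
Qed.

Lemma product_formulaV c : product_formula_at U c -> product_formula_at U c^-1.
Proof.
have [->|c0] := eqVneq c 0; first by rewrite invr0.
move=> [l [lU l1 lS]]; exists l; split => // [u Uu ul|s us sU sl].
  by rewrite (avV (absU Uu)) l1 // invr1.
transitivity (- \sum_(u <- s) ln (u c)); last by rewrite lS // oppr0.
rewrite -sumrN.
apply: eq_big_seq => u /sU/absU au.
by rewrite (avV au) lnV // posrE (av_gt0 au).
Qed.

Lemma product_formula_unit c : (forall u, U u -> u c = 1) -> product_formula_at U c.
Proof.
move=> u1; exists [::]; split => // [u Uu _|l _ lU _]; first exact: u1.
by apply: big1_seq => u /lU /u1 ->; rewrite ln1.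
Qed.

End ProductFormula.

(** Here A0 stands for Z or k[X], with fraction field F, P for a set of
    representatives of its primes, and lam p for the logarithm of the size of p
    at infinity. An absolute value on F is determined by its values on the units
    of A0 and on P. *)
Section Primes.
Variables (R : realType) (A0 : idomainType) (F : fieldType).
Variables (e : {rmorphism A0 -> F}) (P : set A0) (lam : A0 -> R).
Hypothesis fracF : forall c, exists f g : A0, g != 0 /\ c = e f / e g.
Hypothesis e_inj : injective e.
Hypothesis factorization : forall f : A0, f != 0 ->
  exists x (l : seq A0), [/\ x \is a GRing.unit, forall p, p \in l -> P p
    & f = x * \prod_(p <- l) p].
Hypothesis bezout : forall p p', P p -> P p' -> p != p' -> exists r s, p' * r = 1 - p * s.
Hypothesis prime_nonunit : forall p, P p -> p \isn't a GRing.unit.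
Hypothesis prime_neq0 : forall p, P p -> p != 0.
Hypothesis lam_gt0 : forall p, P p -> 0 < lam p.

Definition at_infinity (u : F -> R) : Prop :=
  (forall x, x \is a GRing.unit -> u (e x) = 1) /\
  (forall p, P p -> u (e p) = expR (lam p)).

Definition at_prime (p : A0) (u : F -> R) : Prop :=
  [/\ forall x, x \is a GRing.unit -> u (e x) = 1, u (e p) = expR (- lam p)
    & forall p', P p' -> p' != p -> u (e p') = 1].

Definition base_places : set (F -> R) :=
  [set u | absolute_value u /\ (at_infinity u \/ exists2 p, P p & at_prime p u)].

Let base_abs u : base_places u -> absolute_value u. Proof. by case. Qed.

Let e_eq0 f : (e f == 0) = (f == 0).
Proof. by rewrite -[in RHS](inj_eq e_inj) rmorph0. Qed.

Lemma base_place_ext (u u' : F -> R) : absolute_value u -> absolute_value u' ->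
  (forall x, x \is a GRing.unit -> u (e x) = u' (e x)) ->
  (forall p, P p -> u (e p) = u' (e p)) -> u = u'.
Proof.
move=> au au' hx hp; have hf f : u (e f) = u' (e f).
  have [->|/factorization[x [l [ux lP ->]]]] := eqVneq f 0.
    by rewrite rmorph0 (av0 au) (av0 au').
  rewrite rmorphM rmorph_prod (avM au) (avM au') (av_prod au) (av_prod au') hx //.
  by congr (_ * _); apply: eq_big_seq => p /lP; apply: hp.
apply/funext => c; have [f [g [_ ->]]] := fracF c.
by rewrite (avM au) (avM au') (avV au) (avV au') !hf.
Qed.

Lemma at_infinity_unique (u u' : F -> R) : absolute_value u -> absolute_value u' ->
  at_infinity u -> at_infinity u' -> u = u'.
Proof.
move=> au au' [ux up] [ux' up']; apply: base_place_ext => // [x hx|p hp].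
  by rewrite ux // ux'.
by rewrite up // up'.
Qed.

Lemma at_prime_unique p (u u' : F -> R) : absolute_value u -> absolute_value u' -> P p ->
  at_prime p u -> at_prime p u' -> u = u'.
Proof.
move=> au au' Pp [ux up uq] [ux' up' uq']; apply: base_place_ext => // [x hx|q Pq].
  by rewrite ux // ux'.
by have [->|qp] := eqVneq q p; rewrite ?up ?up' // uq // uq'.
Qed.

Let D : set F := range e.

Let sD : is_subring D.
Proof.
split=> [|_ _ [a _ <-] [b _ <-]|_ _ [a _ <-] [b _ <-]].
- by exists 1; rewrite ?rmorph1.
- by exists (a - b); rewrite ?rmorphB.
- by exists (a * b); rewrite ?rmorphM.
Qed.

Let unit_modM p a b : unit_mod D (e p) a -> unit_mod D (e p) b -> unit_mod D (e p) (a * b).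
Proof.
move=> [Da [r [s [Dr Ds E]]]] [Db [r' [s' [Dr' Ds' E']]]]; split; first exact: subringM.
exists (r * r'), (s + s' - e p * s * s'); split; first exact: subringM.
  have [_ DB DM] := sD; apply: DB; first exact: subringD.
  by apply: (DM) => //; apply: DM => //; exists p.
by rewrite mulrACA E E'; ring.
Qed.

Let unit_mod_unit p x : x \is a GRing.unit -> unit_mod D (e p) (e x).
Proof.
move=> ux; split; first by exists x.
exists (e x^-1), 0; split; [by exists x^-1 | exact: subring0 | ].
by rewrite -rmorphM divrr // rmorph1 mulr0 subr0.
Qed.

Let unit_mod_prime p q : P p -> P q -> q != p -> unit_mod D (e p) (e q).
Proof.
move=> Pp Pq qp; split; first by exists q.
have [|r [s E]] := bezout Pp Pq; first by rewrite eq_sym.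
exists (e r), (e s); split; [by exists r | by exists s | ].
by rewrite -!rmorphM E rmorphB rmorph1 rmorphM.
Qed.

Let prime_part p f : P p -> f != 0 ->
  exists n h, f = p ^+ n * h /\ unit_mod D (e p) (e h).
Proof.
move=> Pp /factorization[x [l [ux lP ->]]]; elim: l lP => [|q l IH] lP.
  by exists 0%N, x; rewrite big_nil mulr1 expr0 mul1r; split=> //; apply: unit_mod_unit.
have [|n [h [E uh]]] := IH; first by move=> q' q'l; apply: lP; rewrite inE q'l orbT.
rewrite big_cons mulrCA E; have [->|qp] := eqVneq q p.
  by exists n.+1, h; rewrite exprS mulrA.
exists n, (q * h); rewrite mulrCA; split=> //; rewrite rmorphM; apply: unit_modM => //.
by apply: unit_mod_prime => //; apply: lP; rewrite inE eqxx.
Qed.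

Lemma at_prime_extension (M : fieldType) (iota : {rmorphism F -> M}) p : P p ->
  (forall x, exists2 g : {poly F}, g != 0 & root (map_poly iota g) x) ->
  exists w : M -> R, [/\ absolute_value w, ultrametric w & at_prime p (w \o iota)].
Proof.
move=> Pp alg; have p0 := prime_neq0 Pp.
have [|[a _]|c c0||w [aw uw wp w1]] := @ultrametric_extension R F M iota D (e p) (lam p) alg sD.
- by exists p.
- move=> /(congr1 (fun z => e p * z)); rewrite divff ?e_eq0 // -rmorphM -(rmorph1 e).
  by move=> /e_inj pa; have := prime_nonunit Pp; case/negP; apply/unitrPr; exists a.
- have [f [g [g0 cE]]] := fracF c.
  have f0 : f != 0 by apply: contraNneq c0 => f0; rewrite cE f0 rmorph0 mul0r.
  have [n [h [fE uh]]] := prime_part Pp f0; have [m [k [gE uk]]] := prime_part Pp g0.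
  exists (n%:Z - m%:Z), (e h), (e k); split=> //.
  rewrite cE fE gE !rmorphM !rmorphXn expfzDr ?e_eq0 // -exprnN -exprnP; field.
  have k0 : k != 0 by apply: contraNneq g0 => k0; rewrite gE k0 mulr0.
  by rewrite !e_eq0 k0 expf_neq0 // e_eq0.
- exact: lam_gt0.
exists w; split=> //; split=> [x ux|//|q Pq qp] /=; apply: w1.
  exact: unit_mod_unit.
exact: unit_mod_prime.
Qed.

Lemma at_prime_exists p : P p -> exists2 u, absolute_value u & at_prime p u.
Proof.
move=> Pp; have [M _] := splitting_extension (oner_neq0 {poly F}).
have [w [aw _ pw]] := at_prime_extension Pp (@fieldExt_algebraic _ M).
by exists (w \o in_alg M) => //; apply: av_comp.
Qed.

Variable uoo : F -> R.
Hypotheses (auoo : absolute_value uoo) (at_uoo : at_infinity uoo).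

(** By multiplicativity it suffices to treat a prime p: only the places at
    infinity and at p contribute, with opposite logarithms. *)
Lemma product_formula_base c : c != 0 -> product_formula_at base_places c.
Proof.
have PFp p : P p -> product_formula_at base_places (e p).
  move=> Pp; have [up aup pup] := at_prime_exists Pp.
  have [_ uoop] := at_uoo; have [_ upp _] := pup.
  have l0 := lam_gt0 Pp; have uneq : uoo != up.
    apply/eqP => E; have := uoop p Pp; rewrite E upp => /expR_inj; lra.
  exists [:: uoo; up]; split.
  - move=> u; rewrite !inE => /orP[]/eqP->; first by split=> //; left.
    by split=> //; right; exists p.
  - move=> u [au [ou|[q Pq pu]]]; rewrite !inE negb_or => /andP[uo up'].
      by rewrite (at_infinity_unique au auoo ou at_uoo) eqxx in uo.
    have [qp|qp] := eqVneq q p.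
      by rewrite qp in pu; rewrite (at_prime_unique au aup Pp pu pup) eqxx in up'.
    by have [_ _] := pu; apply=> //; rewrite eq_sym.
  - move=> l ul lU sub.
    have uool : uoo \in l by apply: sub; rewrite !inE eqxx.
    have upl : up \in l by apply: sub; rewrite !inE eqxx orbT.
    have uprem : up \in rem uoo l by rewrite mem_rem_uniq // !inE eq_sym uneq.
    rewrite (big_rem uoo) //= (big_rem up) //= uoop // upp // !expRK.
    rewrite big1_seq; first by rewrite addr0 subrr.
    move=> u; rewrite andTb (mem_rem_uniq _ (rem_uniq _ ul)) !inE mem_rem_uniq // !inE.
    move=> /and3P[uup uuo /lU[au [ou|[q Pq pu]]]].
      by rewrite (at_infinity_unique au auoo ou at_uoo) eqxx in uuo.
    have [qp|qp] := eqVneq q p.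
      by rewrite qp in pu; rewrite (at_prime_unique au aup Pp pu pup) eqxx in uup.
    by have [_ _ ->] := pu; rewrite ?ln1 // eq_sym.
have PFe f : f != 0 -> product_formula_at base_places (e f).
  move=> /factorization[x [l [ux lP ->]]]; rewrite rmorphM rmorph_prod.
  have x0 : e x != 0 by rewrite e_eq0; apply: contraTneq ux => ->; rewrite unitr0.
  apply: product_formulaM => //.
  - rewrite prodf_seq_neq0; apply/allP => p /lP Pp; apply/implyP => _.
    by rewrite e_eq0 prime_neq0.
  - apply: product_formula_unit => u [_ [[ux' _]|[q _ [ux' _ _]]]]; exact: ux'.
  - elim: l lP => [|p l IH] lP.
      rewrite big_nil; apply: product_formula_unit => u /base_abs au.
      exact: av1.
    rewrite big_cons; have Pp : P p by apply: lP; rewrite inE eqxx.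
    have lP' q : q \in l -> P q by move=> ql; apply: lP; rewrite inE ql orbT.
    apply: product_formulaM; [exact: base_abs | | | exact: PFp | exact: IH].
      by rewrite e_eq0 prime_neq0.
    rewrite prodf_seq_neq0; apply/allP => q /lP' Pq; apply/implyP => _.
    by rewrite e_eq0 prime_neq0.
have [f [g [g0 ->]]] := fracF c => fg0.
have f0 : f != 0 by apply: contraNneq fg0 => ->; rewrite rmorph0 mul0r.
apply: product_formulaM; [exact: base_abs | by rewrite e_eq0 | | exact: PFe | ].
  by rewrite invr_eq0 e_eq0.
by apply: product_formulaV => //; apply: PFe.
Qed.

Lemma base_place_nontrivial u : (exists p, P p) -> base_places u -> exists c, 1 < u c.
Proof.
move=> [p Pp] [au [[_ /(_ p Pp) up]|[q Pq [_ uq _]]]].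
  by exists (e p); rewrite up expR_gt1 lam_gt0.
exists (e q)^-1; rewrite (avV au) uq -expRN opprK expR_gt1 lam_gt0 //.
Qed.

Let finite_le1 p u f : absolute_value u -> P p -> at_prime p u -> u (e f) <= 1.
Proof.
move=> au Pp [ux up uq]; have [->|/factorization[x [l [hx lP ->]]]] := eqVneq f 0.
  by rewrite rmorph0 (av0 au).
rewrite rmorphM rmorph_prod (avM au) ux // mul1r (av_prod au).
elim: l lP => [|q l IH] lP; first by rewrite big_nil.
rewrite big_cons mulr_ile1 ?(av_ge0 au) //; last first.
- by apply: IH => q' q'l; apply: lP; rewrite inE q'l orbT.
- have Pq : P q by apply: lP; rewrite inE eqxx.
  have [->|qp] := eqVneq q p; last by rewrite uq.
  by rewrite up expR_le1 // oppr_le0 ltW // lam_gt0.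
- by apply: prodr_ge0 => q' _; apply: av_ge0.
Qed.

(** An element without poles at the primes is cleared of its denominator one
    prime at a time; without a pole at infinity its numerator has no prime
    factor either. *)
Lemma base_unit_of_le1 c : c != 0 -> (forall u, base_places u -> u c <= 1) ->
  exists2 x, x \is a GRing.unit & c = e x.
Proof.
move=> c0 hc; have [f [g [g0 cE]]] := fracF c.
have [y [l [uy lP gE]]] := factorization g0.
have [h hE] : exists h, c = e h.
  elim: l lP f g gE g0 cE => [|p l IH] lP f g gE g0 cE.
    by exists (f / y); rewrite rmorphM rmorphV //= cE gE big_nil mulr1.
  have Pp : P p by apply: lP; rewrite inE eqxx.
  have lP' q : q \in l -> P q by move=> ql; apply: lP; rewrite inE ql orbT.
  have [u au pu] := at_prime_exists Pp.
  have f0 : f != 0 by apply: contraNneq c0 => f0; rewrite cE f0 rmorph0 mul0r.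
  have [x [m [ux mP fE]]] := factorization f0.
  have gE' : g = p * (y * \prod_(q <- l) q) by rewrite gE big_cons mulrCA.
  have pm : p \in m.
    apply: contraT => pm; have [ux' up uq] := pu.
    have uf : u (e f) = 1.
      rewrite fE rmorphM rmorph_prod (avM au) ux' // mul1r (av_prod au).
      rewrite big1_seq // => q /andP[_ qm]; rewrite uq //; first exact: mP.
      by apply: contraNneq pm => <-.
    have : u c <= 1 by apply: hc; split=> //; right; exists p.
    rewrite cE (avM au) (avV au) uf mul1r invf_le1 ?(av_gt0 au) ?e_eq0 // gE' rmorphM (avM au) up.
    move=> h; have : expR (- lam p) < 1 by rewrite expR_lt1 oppr_lt0 lam_gt0.
    rewrite ltNge; have := finite_le1 (y * \prod_(q <- l) q) au Pp pu.
    by move=> h'; rewrite (le_trans h) // ler_piMr // expR_ge0.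
  have gn : y * \prod_(q <- l) q != 0 by apply: contraNneq g0 => z; rewrite gE' z mulr0.
  apply: (IH lP' (x * \prod_(q <- rem p m) q) (y * \prod_(q <- l) q)) => //.
  rewrite cE gE' fE (big_rem p pm) /= mulrCA !(rmorphM e p).
  move: (y * _) (x * _) gn => G H gn; field.
  by rewrite !e_eq0 gn prime_neq0.
have h0 : h != 0 by apply: contraNneq c0 => h0; rewrite hE h0 rmorph0.
have [x [m [ux mP hE']]] := factorization h0; exists x => //.
have [uoox uoop] := at_uoo.
have := hc uoo (conj auoo (or_introl at_uoo)).
rewrite hE hE' rmorphM rmorph_prod (avM auoo) uoox // mul1r (av_prod auoo).
case: m mP {hE'} => [|p m] mP; first by rewrite !big_nil mulr1.
rewrite !big_cons => h1.
have Pp : P p by apply: mP; rewrite inE eqxx.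
have : 1 < expR (lam p) by rewrite expR_gt1 lam_gt0.
rewrite ltNge; case/negP; rewrite -uoop //; apply: le_trans h1.
rewrite ler_peMr ?(av_ge0 auoo) //.
have mP' q : q \in m -> P q by move=> qm; apply: mP; rewrite inE qm orbT.
elim: m mP' {mP} => [|q m IH] mP'; first by rewrite big_nil.
have Pq : P q by apply: mP'; rewrite inE eqxx.
rewrite big_cons mulr_ege1 //; first by rewrite uoop // -expR0 ler_expR ltW // lam_gt0.
by apply: IH => q' q'm; apply: mP'; rewrite inE q'm orbT.
Qed.

Lemma base_place_discrete u c : (forall p, exists n : nat, lam p = n%:R) ->
  base_places u -> c != 0 -> exists z : int, u c = expR z%:~R.
Proof.
move=> lamn [au hu]; have hp p : P p -> exists z : int, u (e p) = expR z%:~R.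
  move=> Pp; have [n ln_] := lamn p; case: hu => [[_ up]|[q Pq [_ uq uq']]].
    by exists n%:Z; rewrite up // ln_ pmulrn.
  have [->|pq] := eqVneq p q; last by exists 0; rewrite uq' // expR0.
  by have [m lm] := lamn q; exists (- m%:Z); rewrite uq lm mulrNz pmulrn.
have hx x : x \is a GRing.unit -> u (e x) = 1.
  by move=> ux; case: hu => [[h _]|[q _ [h _ _]]]; apply: h.
have hf f : f != 0 -> exists z : int, u (e f) = expR z%:~R.
  move=> /factorization[x [l [ux lP ->]]]; rewrite rmorphM rmorph_prod (avM au) hx // mul1r.
  rewrite (av_prod au); elim: l lP => [|p l IH] lP.
    by exists 0; rewrite big_nil expR0.
  have [|z zE] := IH; first by move=> q ql; apply: lP; rewrite inE ql orbT.
  have [|w wE] := hp p; first by apply: lP; rewrite inE eqxx.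
  by exists (w + z); rewrite big_cons zE wE -expRD intrD.
have [f [g [g0 ->]]] := fracF c => fg0.
have f0 : f != 0 by apply: contraNneq fg0 => ->; rewrite rmorph0 mul0r.
have [z zE] := hf f f0; have [w wE] := hf g g0.
by exists (z - w); rewrite (avM au) (avV au) zE wE -expRN -expRD rmorphB.
Qed.

End Primes.

(** * Places that extend to splitting fields *)

(** Total boundedness of the bounded sets, in the form in which the pigeonhole
    principle uses it. *)
Definition bounded_coloring (R : realType) (L : fieldType) (v : L -> R) : Prop :=
  forall r eps : R, 0 < eps -> exists (T : finType) (col : L -> T),
    forall x y, v x <= r -> v y <= r -> col x = col y -> v (x - y) <= eps.

(** U plays the part of the places of a global field F, and A that of the
    archimedean ones. The places of an extension of F are found among the
    conjugates of the absolute value w of a splitting field. *)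
Definition base_with_places (R : realType) (F : fieldType) (U A : set (F -> R)) : Prop :=
  [/\ forall u, U u -> absolute_value u,
      forall u, U u -> exists c, 1 < u c,
      forall c, c != 0 -> product_formula_at U c,
      forall u (f : {poly F}), U u -> f != 0 ->
        exists (M : fieldType) (iota : {rmorphism F -> M}) (s : seq M) (w : M -> R),
          [/\ map_poly iota f %= \prod_(z <- s) ('X - z%:P), absolute_value w,
              u = w \o iota
            & (~ A u /\ ultrametric w) \/ (A u /\ bounded_coloring w) ]
    & finite_set A ].

Section ComplexAbsoluteValue.
Variable R : realType.

Definition complex_abs (z : R[i]) : R := Normc.normc z.

Lemma complex_abs_absolute_value : absolute_value complex_abs.
Proof.
split=> [[a b]|z|x y|x y].
- by rewrite /complex_abs /= sqrtr_ge0.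
- by split=> [/Normc.eq0_normc//|->]; exact: Normc.normc0.
- exact: Normc.normcM.
- exact: le_normcD.
Qed.

Lemma complex_abs_nat n : complex_abs n%:R = n%:R.
Proof. by rewrite -[RHS](congr1 (fun x => x *+ n) (Normc.normc1 R)); exact: normcMn. Qed.

Lemma complex_bounded_coloring : bounded_coloring complex_abs.
Proof.
(* A grid of mesh eps / 2 in both coordinates. *)
move=> r eps eps0; pose del := eps / 2; have del0 : 0 < del by rewrite divr_gt0.
pose q := Num.truncn ((r + r) / del).
pose col (a : R) : 'I_q.+1 := inord (Num.truncn ((a + r) / del)).
have colP a b : `|a| <= r -> `|b| <= r -> col a = col b -> `|a - b| <= del.
  move=> ar br /(congr1 val) /=.
  have pos c : `|c| <= r -> 0 <= (c + r) / del.
    by rewrite ler_norml => /andP[c1 _]; rewrite divr_ge0 ?(ltW del0) //; lra.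
  have bnd c : `|c| <= r -> (Num.truncn ((c + r) / del) < q.+1)%N.
    move=> cr; rewrite ltnS /q le_truncn // ler_pM2r ?invr_gt0 //.
    by move: cr; rewrite ler_norml => /andP[_ cr]; lra.
  rewrite !inordK ?bnd // => E.
  have := truncn_itv (pos a ar); have := truncn_itv (pos b br); rewrite E.
  set m := Num.truncn _ => /andP[h1 h2] /andP[h3 h4].
  rewrite ler_pdivlMr // in h1; rewrite ltr_pdivrMr // in h2.
  rewrite ler_pdivlMr // in h3; rewrite ltr_pdivrMr // in h4.
  rewrite -natr1 mulrDl mul1r in h2 h4.
  by rewrite ler_norml; apply/andP; split; lra.
exists ('I_q.+1 * 'I_q.+1)%type, (fun z => (col (complex.Re z), col (complex.Im z))).
have part (a b : R) : (`|a| <= complex_abs (a +i* b)%C) /\ (`|b| <= complex_abs (a +i* b)%C).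
  by rewrite /complex_abs /= -!sqrtr_sqr !ler_sqrt ?addr_ge0 ?sqr_ge0 // lerDl lerDr !sqr_ge0.
move=> [a b] [a' b'] hx hy [ea eb].
have [/le_trans/(_ hx) xa /le_trans/(_ hx) xb] := part a b.
have [/le_trans/(_ hy) ya /le_trans/(_ hy) yb] := part a' b'.
have h1 := colP _ _ xa ya ea; have h2 := colP _ _ xb yb eb.
have -> : eps = del + del by rewrite /del; field.
rewrite /complex_abs /=; apply: (@le_trans _ _ (`|a - a'| + `|b - b'|)); last exact: lerD.
rewrite -[leRHS]ger0_norm ?addr_ge0 // -sqrtr_sqr ler_sqrt ?sqr_ge0 //.
rewrite [leRHS]sqrrD !real_normK ?num_real // lerD2r lerDl.
by rewrite mulrn_wge0 // mulr_ge0.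
Qed.

End ComplexAbsoluteValue.

(** * The places of Q *)

Section Rationals.
Variable R : realType.

Definition int_prime : set int := [set z | exists2 q : nat, prime q & z = q%:Z].

Definition int_prime_size (z : int) : R := ln (`|z|%N%:R).

Let e : {rmorphism int -> rat} := intr.

Lemma nat_prime_ind (Q : nat -> Prop) : Q 1%N ->
  (forall q n, prime q -> (0 < n)%N -> Q n -> Q (q * n)%N) -> forall n, (0 < n)%N -> Q n.
Proof.
move=> Q1 QS n; have [m] := ubnP n; elim: m n => // m IH n; rewrite ltnS => le_nm n0.
have [n1|n1] := leqP n 1; first by have -> : n = 1%N by apply/eqP; rewrite eqn_leq n1.
have pn := pdiv_prime n1; rewrite -(divnK (pdiv_dvd n)) mulnC.
have d0 : (0 < n %/ pdiv n)%N by rewrite divn_gt0 ?pdiv_gt0 // pdiv_leq.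
by apply: QS => //; apply: IH => //; apply: leq_trans le_nm; rewrite ltn_Pdiv // prime_gt1.
Qed.

Lemma int_unit x : (x \is a GRing.unit) = (`|x|%N == 1%N) :> bool.
Proof. by case: x => [[|[|n]]|[|n]]. Qed.

Lemma int_fraction (c : rat) : exists f g : int, g != 0 /\ c = e f / e g.
Proof. by exists (numq c), (denq c); rewrite denq_neq0 /e /= divq_num_den. Qed.

Lemma int_factorization (f : int) : f != 0 -> exists x (l : seq int),
  [/\ x \is a GRing.unit, forall p, p \in l -> int_prime p & f = x * \prod_(p <- l) p].
Proof.
move=> f0; have : (0 < `|f|)%N by rewrite absz_gt0.
have H : forall n, (0 < n)%N ->
    exists2 l : seq int, forall p, p \in l -> int_prime p & n%:Z = \prod_(p <- l) p.
  apply: nat_prime_ind => [|q n pq _ [l lP lE]]; first by exists [::]; rewrite ?big_nil.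
  exists (q%:Z :: l); last by rewrite big_cons -lE.
  by move=> p; rewrite inE => /orP[/eqP->|/lP//]; exists q.
move=> /H[l lP lE]; exists (sgz f), l; split=> //.
  by rewrite int_unit; case: (f) f0 => [[|n]|n].
by rewrite -lE -intEsg.
Qed.

Lemma int_bezout (p p' : int) : int_prime p -> int_prime p' -> p != p' ->
  exists r s, p' * r = 1 - p * s.
Proof.
move=> [q pq ->] [q' pq' ->] qq'.
have : coprimez q%:Z q'%:Z by rewrite coprimezE /= prime_coprime // dvdn_prime2.
by move=> /coprimezP[[r s] /= E]; exists s, r; rewrite -E mulrC; ring.
Qed.

Lemma int_prime_neq0 p : int_prime p -> p != 0.
Proof. by move=> [q pq ->]; rewrite -lt0n prime_gt0. Qed.

Lemma int_prime_nonunit p : int_prime p -> p \isn't a GRing.unit.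
Proof. by move=> [q pq ->]; rewrite int_unit; case: q pq => [|[|]]. Qed.

Lemma int_prime_size_gt0 p : int_prime p -> 0 < int_prime_size p.
Proof. by move=> [q pq ->]; rewrite ln_gt0 // ltr1n prime_gt1. Qed.

Lemma expR_int_prime_size q : prime q -> expR (int_prime_size q%:Z) = q%:R.
Proof. by move=> pq; rewrite lnK // posrE ltr0n prime_gt0. Qed.

Lemma e_nat n : e n%:Z = n%:R. Proof. by rewrite /e /= pmulrn. Qed.

Lemma av_nat_unit (L : fieldType) (u : L -> R) (f : {rmorphism int -> L}) x :
  absolute_value u -> x \is a GRing.unit -> u (f x) = 1.
Proof.
move=> au; rewrite int_unit; case: x => [[|[|n]]|[|n]] // _; first by rewrite rmorph1 av1.
by rewrite NegzE rmorphN (avN au) rmorph1 av1.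
Qed.

Lemma rat_standardE (u : rat -> R) : absolute_value u ->
  (standard (R := R) (s := RationalNumbers) u) <->
  at_infinity e int_prime int_prime_size u \/
  exists2 p, int_prime p & at_prime e int_prime int_prime_size p u.
Proof.
move=> au; have ux x : x \is a GRing.unit -> u (e x) = 1 by apply: av_nat_unit.
split=> [[uoo|[p pp up]]|[[_ uoo]|[_ [p pp ->] [_ up uq]]]].
- left; split=> // _ [q pq ->].
  by rewrite e_nat uoo expR_int_prime_size.
- right; exists p%:Z; first by exists p.
  split=> // [|_ [q pq ->] qp].
    by rewrite e_nat up ?prime_gt0 // logn_prime // eqxx expr1 expRN expR_int_prime_size.
  rewrite e_nat up ?prime_gt0 // logn_prime // eqz_nat in qp *.
  by rewrite eq_sym (negbTE qp) expr0 invr1.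
- left; case=> [|n]; first by rewrite (av0 au).
  move: n.+1 (ltn0Sn n); apply: nat_prime_ind => [|q m pq _ um]; first exact: av1.
  rewrite natrM (avM au) um -e_nat uoo; last by exists q.
  by rewrite expR_int_prime_size // natrM.
- right; exists p => //; apply: nat_prime_ind => [|q m pq m0 um].
    by rewrite (av1 au) logn1 expr0 invr1.
  rewrite natrM (avM au) um lognM ?(prime_gt0 pq) // exprD invfM; congr (_ * _).
  rewrite logn_prime //; have [qp|qp] := eqVneq p q.
    by rewrite -qp expr1 -e_nat up expRN expR_int_prime_size.
  by rewrite -e_nat uq ?expr0 ?invr1 //; [exists q | rewrite eqz_nat eq_sym].
Qed.

Definition rat_places : set (rat -> R) :=
  [set u | absolute_value u /\ standard (s := RationalNumbers) u].

Lemma rat_placesE : rat_places = base_places e int_prime int_prime_size.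
Proof.
apply/seteqP; split=> u [au hu]; split=> //.
  exact/(rat_standardE au).
exact/(rat_standardE au).
Qed.

(** The usual absolute value factors through the complex numbers, where the
    polynomials over Q split. *)
Definition rat_infinity (c : rat) : R := complex_abs (ratr c : R[i]).

Lemma rat_infinity_abs : absolute_value rat_infinity.
Proof.
exact: (av_comp (ratr : {rmorphism rat -> R[i]}) (@complex_abs_absolute_value R)).
Qed.

Lemma rat_infinity_nat n : rat_infinity n%:R = n%:R.
Proof. by rewrite /rat_infinity ratr_nat complex_abs_nat. Qed.

Lemma at_rat_infinity : at_infinity e int_prime int_prime_size rat_infinity.
Proof.
split=> [x|_ [q pq ->]]; first exact/av_nat_unit/rat_infinity_abs.
by rewrite e_nat rat_infinity_nat expR_int_prime_size.
Qed.

Lemma rat_base_with_places : base_with_places rat_places [set rat_infinity].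
Proof.
have e_inj : injective e := intr_inj.
rewrite rat_placesE; split.
- by move=> u [].
- move=> u; apply: base_place_nontrivial => //.
  + exact: int_prime_size_gt0.
  + by exists 2%:Z, 2%N.
- move=> c; apply: product_formula_base => //.
  + exact: int_fraction.
  + exact: int_factorization.
  + exact: int_bezout.
  + exact: int_prime_nonunit.
  + exact: int_prime_neq0.
  + exact: int_prime_size_gt0.
  + exact: rat_infinity_abs.
  + exact: at_rat_infinity.
- move=> u f [au [ou|[p Pp pu]]] f0.
    have -> : u = rat_infinity.
      apply: (at_infinity_unique int_fraction int_factorization au rat_infinity_abs ou).
      exact: at_rat_infinity.
    have [s sE] := closed_field_poly_normal (map_poly (ratr : {rmorphism rat -> R[i]}) f).
    exists R[i], (ratr : {rmorphism rat -> R[i]}), s, (@complex_abs R); split=> //.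
    + rewrite {1}sE; apply: eqp_scale; rewrite lead_coef_map fmorph_eq0 lead_coef_eq0 //.
    + exact: complex_abs_absolute_value.
    + by right; split=> //; apply: complex_bounded_coloring.
  have [M [s fs]] := splitting_extension f0.
  have [w [aw uw pw]] := at_prime_extension int_fraction e_inj int_factorization int_bezout
    int_prime_nonunit int_prime_neq0 int_prime_size_gt0 Pp (@fieldExt_algebraic _ M).
  have uE : u = w \o in_alg M.
    apply: (at_prime_unique int_fraction int_factorization au _ Pp pu pw).
    exact: av_comp.
  exists M, (in_alg M), s, w; split=> //; left; split=> // /= ur.
  have [q pq pE] := Pp; have [_ + _] := pu; rewrite ur pE e_nat rat_infinity_nat.
  have q1 : 1 < q%:R :> R by rewrite ltr1n prime_gt1.
  by rewrite expRN expR_int_prime_size // => E; have := q1; rewrite E invf_gt1 ?ltr0n ?prime_gt0 // ltNge ltW.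
- exact: finite_set1.
Qed.

(** A prime power that divides d is at most d, and d <= 2^d. *)
Lemma rat_place_nat_ge (u : rat -> R) d : (0 < d)%N -> rat_places u -> 2 ^- d <= u d%:R.
Proof.
move=> d0 [au hu]; have d2 : 2 ^- d <= d%:R^-1 :> R.
  by rewrite lef_pV2 ?posrE ?exprn_gt0 ?ltr0n // -natrX ler_nat ltnW // ltn_expl.
case: hu => [uoo|[p pp up]].
  apply: le_trans d2 _; rewrite uoo; apply: (@le_trans _ _ 1).
    by rewrite invf_le1 ?ltr0n // ler1n.
  by rewrite ler1n.
have p0 : 0 < p%:R ^+ logn p d :> R by rewrite exprn_gt0 // ltr0n prime_gt0.
apply: le_trans d2 _; rewrite up // lef_pV2 ?posrE ?ltr0n //.
by rewrite -natrX ler_nat dvdn_leq // pfactor_dvdnn.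
Qed.

End Rationals.

(** * The places of k(t) *)

Lemma irreducible_dvdn_size (k : fieldType) (p : {poly k}) : irreducible_poly p ->
  [/\ p != 0, (1 < size p)%N & forall q, ~~ (p %| q) -> coprimep p q].
Proof.
move=> [p1 irr]; have p0 : p != 0 by rewrite -size_poly_gt0 ltnW.
split=> // q npq; rewrite /coprimep.
apply: contraNT npq => g1; have := irr _ g1 (dvdp_gcdl p q).
by rewrite /eqp => /andP[_ /dvdp_trans]; apply; apply: dvdp_gcdr.
Qed.

Section PolyMult.
Variables (k : fieldType) (p : {poly k}).
Hypothesis irr : irreducible_poly p.

Lemma poly_multE n (h : {poly k}) : h != 0 -> ~~ (p %| h) -> poly_mult p (p ^+ n * h) = n.
Proof.
have [p0 p1 cop] := irreducible_dvdn_size irr => h0 ph.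
have pn0 m : p ^+ m != 0 by rewrite expf_neq0.
have sz m : (m < size (p ^+ m))%N.
  rewrite -[size _]prednK ?size_poly_gt0 // ltnS size_exp leq_pmull //.
  by rewrite -ltnS prednK // ltnW.
have dvd i : (p ^+ i %| p ^+ n * h) = (i <= n)%N.
  apply/idP/idP => [|le_in]; last by rewrite dvdp_mulr // dvdp_exp2l.
  by rewrite Gauss_dvdpl ?coprimep_expl ?cop // dvdp_Pexp2l.
have szf : (n < size (p ^+ n * h)%R)%N.
  by apply: (leq_trans (sz n)); rewrite dvdp_leq ?mulf_neq0 // dvdp_mulr.
apply/eqP; rewrite eqn_leq /poly_mult; apply/andP; split.
  by apply/bigmax_leqP => i; rewrite dvd.
by apply: (@leq_bigmax_cond _ _ (fun i => val i) (Ordinal szf)); rewrite dvd.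
Qed.

End PolyMult.

Lemma fraction_numden (A : idomainType) (c : {fraction A}) :
  exists f g : A, g != 0 /\ c = tofrac f / tofrac g.
Proof.
elim/quotW: c => x; exists (frac x).1, (frac x).2; split; first exact: denom_ratioP.
apply: (canRL (mulfK _)); first by rewrite tofrac_eq0 denom_ratioP.
unlock FracField.tofrac; rewrite -[LHS]FracField.pi_mul.
apply/eqmodP; rewrite /= FracField.equivfE /FracField.mulf.
by rewrite !numden_Ratio ?mulf_neq0 ?oner_neq0 ?denom_ratioP // !mulr1 mulrC.
Qed.

Section RationalFunctions.
Variables (R : realType) (k : fieldType).

Definition poly_prime : set {poly k} := [set p | irreducible_poly p /\ p \is monic].

Definition poly_degree (p : {poly k}) : R := (size p).-1%:R.

Let e : {rmorphism {poly k} -> {fraction {poly k}}} := @tofrac _.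

Let fracF := @fraction_numden {poly k}.

Lemma tofrac_inj : injective e.
Proof. by move=> f g /eqP; rewrite tofrac_eq => /eqP. Qed.

Lemma poly_unit_size (x : {poly k}) : (x \is a GRing.unit) = (size x == 1%N) :> bool.
Proof.
rewrite poly_unitE; case: (size x == 1)%N / eqP => //= sx.
rewrite unitfE; apply/eqP => x0; have xC : x = (x`_0)%:P by apply: size1_polyC; rewrite sx.
by move: sx; rewrite xC x0 polyC0 size_poly0.
Qed.

Lemma poly_factorization (f : {poly k}) : f != 0 -> exists x (l : seq {poly k}),
  [/\ x \is a GRing.unit, forall p, p \in l -> poly_prime p & f = x * \prod_(p <- l) p].
Proof.
have [n] := ubnP (size f); elim: n f => // n IH f; rewrite ltnS => le_fn f0.
have [f1|f1] := leqP (size f) 1.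
  exists f, [::]; rewrite big_nil mulr1; split=> //.
  by rewrite poly_unit_size eqn_leq f1 size_poly_gt0.
have [r rf irr] := irreducible_factor f1.
have [r0 r1 _] := irreducible_dvdn_size irr.
have lr0 : lead_coef r != 0 by rewrite lead_coef_eq0.
pose p := (lead_coef r)^-1 *: r.
have pr : p %= r by apply: eqp_scale; rewrite invr_eq0.
have mp : p \is monic by rewrite monicE lead_coefZ mulVf.
have Pp : poly_prime p.
  split=> //; split; first by rewrite (eqp_size pr).
  by move=> q q1 qp; apply: eqp_trans (irr.2 q q1 _) _; rewrite -?(eqp_dvdr _ pr) // eqp_sym.
have /dvdpP[g fE] : p %| f by rewrite (eqp_dvdl _ pr).
have g0 : g != 0 by apply: contraNneq f0 => g0; rewrite fE g0 mul0r.
have [|//|x [l [ux lP gE]]] := IH g.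
  apply: leq_trans le_fn; rewrite fE size_Mmonic //.
  by rewrite (eqp_size pr) -ltnS prednK ?addn_gt0 ?size_poly_gt0 ?g0 // -addn2 leq_add2l.
exists x, (p :: l); split=> //; last by rewrite big_cons fE gE mulrC mulrCA.
by move=> q; rewrite inE => /orP[/eqP->|/lP].
Qed.

Lemma poly_prime_neq0 p : poly_prime p -> p != 0.
Proof. by move=> [/irreducible_dvdn_size[]]. Qed.

Lemma poly_prime_nonunit p : poly_prime p -> p \isn't a GRing.unit.
Proof. by move=> [/irreducible_dvdn_size[_ p1 _] _]; rewrite poly_unit_size gtn_eqF. Qed.

Lemma poly_degree_gt0 p : poly_prime p -> 0 < poly_degree p.
Proof. by move=> [/irreducible_dvdn_size[_ p1 _] _]; rewrite ltr0n -ltnS prednK // ltnW. Qed.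

Lemma poly_prime_coprime p q : poly_prime p -> poly_prime q -> q != p -> ~~ (p %| q).
Proof.
move=> [[p1 _] mp] [[_ irrq] mq]; apply: contraNN => pq.
by rewrite -eqp_monic // eqp_sym; apply: irrq; rewrite // gtn_eqF.
Qed.

Lemma poly_bezout p q : poly_prime p -> poly_prime q -> p != q ->
  exists r s, q * r = 1 - p * s.
Proof.
move=> Pp Pq pq; have [_ _ cop] := irreducible_dvdn_size Pp.1.
have /cop/Bezout_eq1_coprimepP[[r s] /= E] : ~~ (p %| q).
  by apply: poly_prime_coprime; rewrite // eq_sym.
by exists s, r; rewrite -E; ring.
Qed.

Lemma poly_prime_ind (Q : {poly k} -> Prop) : (forall x, x \is a GRing.unit -> Q x) ->
  (forall p f, poly_prime p -> f != 0 -> Q f -> Q (p * f)) -> forall f, f != 0 -> Q f.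
Proof.
move=> Q1 QS f f0; have [x [l [ux lP fE]]] := poly_factorization f0.
elim: l lP f f0 fE => [|p l IH] lP f f0 fE; first by rewrite fE big_nil mulr1; apply: Q1.
have E : f = p * (x * \prod_(q <- l) q) by rewrite fE big_cons mulrCA.
rewrite E; have g0 : x * \prod_(q <- l) q != 0 by apply: contraNneq f0 => z; rewrite E z mulr0.
apply: QS => //; first by apply: lP; rewrite inE eqxx.
by apply: IH => // q ql; apply: lP; rewrite inE ql orbT.
Qed.

Let infinite_standard (u : {fraction {poly k}} -> R) :=
  forall f : {poly k}, f != 0 -> u (tofrac f) = expR (size f).-1%:R.

Let finite_standard (u : {fraction {poly k}} -> R) :=
  exists2 p : {poly k}, irreducible_poly p &
    forall f : {poly k}, f != 0 ->
      u (tofrac f) = expR (- ((size p).-1 * poly_mult p f)%:R).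

Lemma function_standardE (u : {fraction {poly k}} -> R) : absolute_value u ->
  (infinite_standard u \/ finite_standard u) <->
  (at_infinity e poly_prime poly_degree u \/
   exists2 p, poly_prime p & at_prime e poly_prime poly_degree p u).
Proof.
move=> au; have unit0 (x : {poly k}) : x \is a GRing.unit -> x != 0.
  by move=> ux; apply: contraTneq ux => ->; rewrite unitr0.
split=> [[uoo|[q irr uq]]|[[ux up]|[p Pp [ux up uq]]]].
- left; split=> [x ux|p /poly_prime_neq0 p0]; last by rewrite uoo.
  rewrite uoo; last exact: unit0.
  by move: ux; rewrite poly_unit_size => /eqP ->; rewrite expR0.
- right; have [q0 q1 cop] := irreducible_dvdn_size irr.
  have lq0 : lead_coef q != 0 by rewrite lead_coef_eq0.
  pose p := (lead_coef q)^-1 *: q.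
  have pq : p %= q by apply: eqp_scale; rewrite invr_eq0.
  have mp : p \is monic by rewrite monicE lead_coefZ mulVf.
  have Pp : poly_prime p.
    split=> //; split; first by rewrite (eqp_size pq).
    by move=> g g1 gp; apply: eqp_trans (irr.2 g g1 _) _; rewrite -?(eqp_dvdr _ pq) // eqp_sym.
  have mult0 f : f != 0 -> ~~ (q %| f) -> u (e f) = 1.
    move=> f0 qf; rewrite uq //; have := poly_multE irr 0 f0 qf.
    by rewrite expr0 mul1r => ->; rewrite muln0 oppr0 expR0.
  exists p => //; split=> [x ux||p' Pp' pp'].
  + apply: mult0; first exact: unit0.
    apply/negP => /(dvdp_leq (unit0 _ ux)); move: ux; rewrite poly_unit_size => /eqP ->.
    by rewrite leqNgt q1.
  + have c0 : (lead_coef q)^-1%:P != 0 by rewrite polyC_eq0 invr_eq0.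
    rewrite uq ?poly_prime_neq0 // /p -mul_polyC mulrC -[q in q * _]expr1 poly_multE //.
      by rewrite expr1 muln1 mulrC mul_polyC /poly_degree size_scale // invr_eq0.
    by apply/negP => /(dvdp_leq c0); rewrite size_polyC invr_eq0 lq0 leqNgt q1.
  + apply: mult0; first exact: poly_prime_neq0.
    by rewrite -(eqp_dvdl _ pq); apply: poly_prime_coprime.
- left; apply: poly_prime_ind => [x hx|p f Pp f0 uf].
    by rewrite ux //; move: hx; rewrite poly_unit_size => /eqP ->; rewrite expR0.
  have p0 := poly_prime_neq0 Pp; rewrite (rmorphM e) (avM au) up // uf -expRD; congr expR.
  rewrite /poly_degree -natrD size_mul //; move: p0 f0; rewrite -!size_poly_gt0.
  by case: (size p) => // a; case: (size f) => // b _ _; rewrite addSn addnS.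
- right; have [p0 p1 cop] := irreducible_dvdn_size Pp.1; exists p; first exact: Pp.1.
  have H : forall f, f != 0 -> exists n h,
      [/\ h != 0, ~~ (p %| h), f = p ^+ n * h & u (e h) = 1].
    apply: poly_prime_ind => [x hx|q f Pq f0 [n [h [h0 ph fE uh]]]].
      exists 0%N, x; rewrite expr0 mul1r; split=> //; [exact: unit0 | | exact: ux].
      apply/negP => /(dvdp_leq (unit0 _ hx)); move: hx; rewrite poly_unit_size => /eqP ->.
      by rewrite leqNgt p1.
    have [->|qp] := eqVneq q p; first by exists n.+1, h; rewrite exprS fE mulrA.
    exists n, (q * h); rewrite mulf_neq0 ?(poly_prime_neq0 Pq) // fE mulrCA.
    rewrite Gauss_dvdpr ?ph; last by apply: cop; apply: poly_prime_coprime.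
    by rewrite rmorphM (avM au) uq // uh mulr1.
  move=> f /H[n [h [h0 ph -> uh]]]; rewrite (poly_multE Pp.1) //.
  rewrite (rmorphM e) (avM au) uh mulr1 (rmorphXn e) (avX au) up -expRM_natl.
  by rewrite natrM mulrN mulrC.
Qed.

(** The place at infinity of k(t) is the place 1/t = 0 of the ring k[1/t], whose
    elements are the fractions f / t^n with deg f <= n. *)
Section InfinitePlace.
Variables (M : fieldType) (iota : {rmorphism {fraction {poly k}} -> M}).
Hypothesis alg : forall x, exists2 g : {poly {fraction {poly k}}}, g != 0 &
  root (map_poly iota g) x.

Let D : set {fraction {poly k}} :=
  [set c | exists (f : {poly k}) (n : nat), (size f <= n.+1)%N /\ c = e f / e 'X ^+ n].

Let t0 : e 'X != 0. Proof. by rewrite tofrac_eq0 polyX_eq0. Qed.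

Let div_eq (L : fieldType) (a b y : L) : y != 0 -> a = b / y -> a * y = b.
Proof. by move=> y0 ->; rewrite divfK. Qed.

Let subf_div (L : fieldType) (a b x y : L) : x != 0 -> y != 0 ->
  a / x - b / y = (a * y - b * x) / (x * y).
Proof. by move=> x0 y0; field; rewrite x0 y0. Qed.

Let unit_identity (L : fieldType) (a r x y : L) : x != 0 -> y != 0 ->
  a / y * r = 1 - x^-1 * ((y - r * a) * x / y).
Proof. by move=> x0 y0; field; rewrite x0 y0. Qed.

Let fraction_identity (L : fieldType) (a b t : L) m n : b != 0 -> t != 0 ->
  a / b = t^-1 ^ (n%:Z - m%:Z) * ((a / t ^+ m) / (b / t ^+ n)).
Proof.
move=> b0 t0'; have tn i : t ^+ i != 0 by rewrite expf_neq0.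
rewrite expfzDr ?invr_eq0 // -exprnN -exprnP !exprVn invrK; field.
by rewrite b0 !tn.
Qed.

Lemma at_infinity_extension : exists w : M -> R,
  [/\ absolute_value w, ultrametric w & at_infinity e poly_prime poly_degree (w \o iota)].
Proof.
have tn0 n : e 'X ^+ n != 0 by rewrite expf_neq0.
have szM (f g : {poly k}) n m : (size f <= n.+1)%N -> (size g <= m.+1)%N ->
    (size (f * g)%R <= (n + m).+1)%N.
  by move=> fn gm; apply: leq_trans (size_polyMleq _ _) _; lia.
have sD : is_subring D.
  split=> [|_ _ [f [n [fn ->]]] [g [m [gm ->]]]|_ _ [f [n [fn ->]]] [g [m [gm ->]]]].
  - by exists 1, 0%N; rewrite size_poly1 rmorph1 expr0 divr1.
  - exists (f * 'X^m - g * 'X^n), (n + m)%N; split.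
      rewrite (leq_trans (size_polyD _ _)) // geq_max size_polyN; apply/andP; split.
        by apply: szM; rewrite ?size_polyXn.
      by rewrite addnC; apply: szM; rewrite ?size_polyXn.
    by rewrite rmorphB !rmorphM !rmorphXn exprD; apply: (subf_div _ _ (tn0 _) (tn0 _)).
  - exists (f * g), (n + m)%N; split.
      exact: szM.
    by rewrite rmorphM exprD mulf_div.
have nD : ~ D ((e 'X)^-1)^-1.
  rewrite invrK => -[f [n [fn /(div_eq (tn0 n))]]].
  rewrite -exprS -rmorphXn => /tofrac_inj E.
  by move: fn; rewrite -E size_polyXn ltnn.
have lead_unit f : f != 0 -> unit_mod D (e 'X)^-1 (e f / e 'X ^+ (size f).-1).
  move=> f0; set a := (size f).-1; have sf : size f = a.+1 by rewrite prednK // size_poly_gt0.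
  have lf0 : lead_coef f != 0 by rewrite lead_coef_eq0.
  split; first by exists f, a; rewrite sf.
  exists (e (lead_coef f)^-1%:P), (e (('X^a - (lead_coef f)^-1%:P * f) * 'X) / e 'X ^+ a); split.
  - by exists (lead_coef f)^-1%:P, 0%N; rewrite expr0 divr1; split=> //; apply: size_polyC_leq1.
  - exists (('X^a - (lead_coef f)^-1%:P * f) * 'X), a; split=> //.
    rewrite (leq_trans (size_polyMleq _ _)) // size_polyX addn2 /= ltnS.
    apply/leq_sizeP => j le_aj; rewrite coefB coefXn coefCM.
    have [->|ja] := eqVneq j a; first by rewrite /a -lead_coefE mulVf // subrr.
    by rewrite nth_default ?mulr0 ?subr0 // sf ltn_neqAle eq_sym ja.
  - by rewrite rmorphM rmorphB rmorphM rmorphXn; apply: (unit_identity _ _ t0 (tn0 _)).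
have [|c c0||w [aw uw wp w1]] := @ultrametric_extension R _ M iota D (e 'X)^-1 1 alg sD _ nD.
- by exists 1, 1%N; rewrite size_poly1 rmorph1 expr1 div1r.
- have [f [g [g0 cE]]] := fracF c.
  have f0 : f != 0 by apply: contraNneq c0 => f0; rewrite cE f0 tofrac0 mul0r.
  exists ((size g).-1%:Z - (size f).-1%:Z), (e f / e 'X ^+ (size f).-1),
    (e g / e 'X ^+ (size g).-1); split; [exact: lead_unit | exact: lead_unit | ].
  rewrite cE; apply: fraction_identity; [by rewrite tofrac_eq0 | exact: t0].
- exact: ltr01.
exists w; have wt : w (iota (e 'X)) = expR 1.
  by have := wp; rewrite fmorphV (avV aw) expRN => /invr_inj.
have wf f : f != 0 -> w (iota (e f)) = expR (poly_degree f).
  move=> f0; have := w1 _ (lead_unit f f0).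
  rewrite rmorphM fmorphV rmorphXn (avM aw) (avV aw) (avX aw) wt => /eqP.
  by rewrite -expRM_natl mulr1 => /eqP; apply: divr1_eq.
split=> //; split=> [x ux|p /poly_prime_neq0 p0]; rewrite /= wf //.
  by move: ux; rewrite poly_unit_size /poly_degree => /eqP ->; rewrite expR0.
by apply: contraTneq ux => ->; rewrite unitr0.
Qed.

End InfinitePlace.

End RationalFunctions.

Section FunctionFields.
Variables (R : realType) (k : fieldType).

Let e : {rmorphism {poly k} -> {fraction {poly k}}} := @tofrac _.

Notation poly_degree := (@poly_degree R k).
Notation poly_prime := (@poly_prime k).

Lemma function_placesE (k0 : [pchar k] =i pred0) :
  [set u | absolute_value u /\ standard (s := RationalFunctions k0) u] =
    base_places e poly_prime poly_degree.
Proof.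
by apply/seteqP; split=> u [au hu]; split=> //; apply/(function_standardE au).
Qed.

Section FunctionBase.
Hypothesis k0 : [pchar k] =i pred0.

Let U : set ({fraction {poly k}} -> R) :=
  [set u | absolute_value u /\ standard (s := RationalFunctions k0) u].

Lemma function_infinity_exists : exists2 u : {fraction {poly k}} -> R,
  absolute_value u & at_infinity e poly_prime poly_degree u.
Proof.
have [M _] := splitting_extension (oner_neq0 {poly {fraction {poly k}}}).
have [w [aw _ ow]] := at_infinity_extension R (@fieldExt_algebraic _ M).
by exists (w \o in_alg M) => //; apply: av_comp.
Qed.

Let tofrac_e_inj : injective e. Proof. exact: tofrac_inj. Qed.

Let fracF := @fraction_numden {poly k}.

Lemma function_base_with_places : base_with_places U set0.
Proof.
have [uoo auoo ouoo] := function_infinity_exists.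
rewrite /U function_placesE; split.
- by move=> u [].
- move=> u; apply: base_place_nontrivial; first exact: poly_degree_gt0.
  exists ('X - 0%:P); split; [exact: irredp_XsubC | exact: monicXsubC].
- exact: (product_formula_base fracF tofrac_e_inj (@poly_factorization k) (@poly_bezout k)
    (@poly_prime_nonunit k) (@poly_prime_neq0 k) (@poly_degree_gt0 R k) auoo ouoo).
- move=> u f [au hu] f0; have [M [s fs]] := splitting_extension f0.
  have alg := @fieldExt_algebraic _ M.
  have [w [aw uw uE]] : exists w : M -> R,
      [/\ absolute_value w, ultrametric w & u = w \o in_alg M].
    case: hu => [ou|[p Pp pu]].
      have [w [aw uw ow]] := at_infinity_extension R alg; exists w; split; [by []|by []|].
      exact: (at_infinity_unique fracF (@poly_factorization k) au (av_comp _ aw) ou ow).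
    have [w [aw uw pw]] := at_prime_extension fracF tofrac_e_inj (@poly_factorization k)
      (@poly_bezout k) (@poly_prime_nonunit k) (@poly_prime_neq0 k)
      (@poly_degree_gt0 R k) Pp alg.
    exists w; split; [by []|by []|].
    exact: (at_prime_unique fracF (@poly_factorization k) au (av_comp _ aw) Pp pu pw).
  by exists M, (in_alg M), s, w; split; [by []|by []|by []|left; split].
- exact: finite_set0.
Qed.

Lemma function_place_discrete u c : U u -> c != 0 -> exists z : int, u c = expR z%:~R.
Proof.
rewrite /U function_placesE => Uu c0.
apply: (base_place_discrete fracF (@poly_factorization k) _ Uu c0).
by move=> p; exists (size p).-1.
Qed.

(** A rational function without poles, including at infinity, is constant. *)
Lemma function_constant_of_le1 c : c != 0 -> (forall u, U u -> u c <= 1) ->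
  exists a : k, c = tofrac a%:P.
Proof.
have [uoo auoo ouoo] := function_infinity_exists.
rewrite /U function_placesE => c0 hc.
have [x ux ->] := base_unit_of_le1 fracF tofrac_e_inj (@poly_factorization k) (@poly_bezout k)
    (@poly_prime_nonunit k) (@poly_prime_neq0 k) (@poly_degree_gt0 R k) auoo ouoo c0 hc.
by exists x`_0; congr tofrac; apply: size1_polyC; move: ux; rewrite poly_unit_size => /eqP ->.
Qed.

Lemma function_place_nat u d : (0 < d)%N -> U u -> u d%:R = 1.
Proof.
rewrite /U function_placesE => d0 [_ hu].
have ud : (d%:R : {poly k}) \is a GRing.unit.
  have dk : d%:R != 0 :> k by rewrite ((pcharf0P k).1 k0) -lt0n.
  by rewrite poly_unit_size -polyC_natr size_polyC dk.
rewrite -(rmorph_nat e); case: hu => [[h _]|[p _ [h _ _]]]; exact: h.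
Qed.

End FunctionBase.

End FunctionFields.

(** * The places of a finite extension *)

Section Extension.
Variables (R : realType) (F : fieldType) (U A : set (F -> R)) (K : fieldExtType F).
Hypothesis F0 : [pchar F] =i pred0.
Hypothesis base : base_with_places U A.

Definition ext_places : set (K -> R) :=
  [set v | absolute_value v /\ U (fun a => v (in_alg K a))].

Definition ext_archimedean : set (K -> R) :=
  [set v | ext_places v /\ A (fun a => v (in_alg K a))].

Let n := \dim {:K}.

Let n_gt0 : (0 < n)%N. Proof. exact: adim_gt0. Qed.

Let restr (v : K -> R) : F -> R := fun a => v (in_alg K a).

(** Over each place u of F lie the conjugates of one extension of u; they
    exhaust the places over u, and their product is u of the norm, which is up
    to sign the constant coefficient of chi x. *)
Lemma fibers_exist : exists (chi : K -> {poly F}) (fib : (F -> R) -> seq (K -> R)),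
  (forall x, [/\ chi x \is monic, size (chi x) = n.+1
     & root (map_poly (in_alg K) (chi x)) x]) /\
  (forall u, U u ->
   [/\ size (fib u) = n,
       forall v, (v \in fib u) = `[< ext_places v /\ restr v = u >],
       forall x, \prod_(v <- fib u) v x = u (chi x)`_0,
       forall v, v \in fib u -> (~ A u /\ ultrametric v) \/ (A u /\ bounded_coloring v)
     & ~ A u -> forall x r, 1 <= r -> (forall v, v \in fib u -> v x <= r) ->
         forall k, u (chi x)`_k <= r ^+ n]).
Proof.
have [Uabs Unt _ Uext _] := base.
have [f [chi [f0 H]]] := conjugates_exist K F0.
have /choice[fib fibP] : forall u, exists s : seq (K -> R), U u ->
   [/\ size s = n,
       forall v, (v \in s) = `[< ext_places v /\ restr v = u >],
       forall x, \prod_(v <- s) v x = u (chi x)`_0,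
       forall v, v \in s -> (~ A u /\ ultrametric v) \/ (A u /\ bounded_coloring v)
     & ~ A u -> forall x r, 1 <= r -> (forall v, v \in s -> v x <= r) ->
         forall k, u (chi x)`_k <= r ^+ n].
  move=> u; have [Uu|nUu] := pselect (U u); last by exists [::] => /nUu.
  have [M [iota [s [w [fs aw uE loc]]]]] := Uext u f Uu f0.
  have [sigma conj] := H M iota s fs; have [_ sj chiE] := conj.
  have rE i : restr (w \o sigma i) = u.
    by rewrite uE; apply/funext => a; rewrite /restr /= sj.
  have memE i : w \o sigma i \in [seq w \o sigma i | i <- enum 'I_n].
    by apply/mapP; exists i; rewrite ?mem_enum.
  exists [seq w \o sigma i | i <- enum 'I_n] => _; split.
  - by rewrite size_map size_enum_ord.
  - move=> v; apply/mapP/asboolP => [[i _ ->]|[[av Uv] vu]].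
      split=> //; split; first exact: av_comp.
      by rewrite -[X in U X]/(restr _) rE.
    have [c uc] := Unt u Uu.
    have [||i ->] := extension_is_conjugate conj av aw.
    + by move=> a; rewrite -[RHS]/((w \o iota) a) -uE -vu.
    + by exists c; rewrite -[v _]/(restr v c) vu.
    + by exists i; rewrite ?mem_enum.
  - move=> x; rewrite big_map big_enum /= uE /= -coef_map chiE.
    rewrite -horner_coef0 horner_prod (av_prod aw); apply: eq_bigr => i _.
    by rewrite hornerXsubC sub0r (avN aw).
  - move=> v /mapP[i _ ->]; case: loc => [[nA uw]|[Au cw]]; [left|right]; split=> //.
      by move=> x y /=; rewrite rmorphD; apply: uw.
    move=> r eps /(cw r)[T [col colP]]; exists T, (col \o sigma i) => x y hx hy hc /=.
    by rewrite rmorphB; apply: colP.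
  - move=> nA x r r1 hr k; case: loc => [[_ uw]|[/nA]] //; rewrite uE /= -coef_map chiE.
    have := @ultrametric_coef_prod_XsubC _ _ w aw uw [seq sigma i x | i <- enum 'I_n] r k r1.
    rewrite big_map size_map size_enum_ord big_enum /=; apply=> _ /mapP[i _ ->].
    exact: (hr _ (memE i)).
exists chi, fib; split=> // x.
have [M [s fs]] := splitting_extension f0.
have [sigma conj] := H M (in_alg M) s fs.
exact: (conjugate_charpoly conj x).
Qed.

Lemma finite_places_over u : U u -> finite_set [set v | ext_places v /\ restr v = u].
Proof.
have [chi [fib [_ fibP]]] := fibers_exist.
move=> /fibP[_ memE _ _ _].
apply: (sub_finite_set _ (finite_seq (fib u))) => v hv /=.
by rewrite memE; apply/asboolP.
Qed.

Lemma place_over u : U u -> exists2 v, ext_places v & restr v = u.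
Proof.
have [chi [fib [_ fibP]]] := fibers_exist.
move=> /fibP[]; case: (fib u) => [/= n0|v l _ memE _ _ _]; first by move: n_gt0; rewrite -n0.
by have := memE v; rewrite inE eqxx => /esym/asboolP[Vv vu]; exists v.
Qed.

Lemma ext_place_type v : ext_places v ->
  (~ ext_archimedean v /\ ultrametric v) \/ (ext_archimedean v /\ bounded_coloring v).
Proof.
have [chi [fib [_ fibP]]] := fibers_exist.
move=> Vv; have [av Uv] := Vv; have [_ memE _ loc _] := fibP _ Uv.
have /loc[[nA uv]|[Av cv]] : v \in fib (restr v) by rewrite memE; apply/asboolP.
  by left; split=> // -[_].
by right; split.
Qed.

Lemma ext_archimedean_finite : finite_set ext_archimedean.
Proof.
have [_ _ _ _ finA] := base.
have -> : ext_archimedean = \bigcup_(u in A `&` U) [set v | ext_places v /\ restr v = u].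
  apply/seteqP; split=> [v [Vv Av]|v [u [Au Uu] [Vv vu]]]; last by split; rewrite // -/(restr v) vu.
  by exists (restr v); split=> //; case: Vv.
apply: bigcup_finite; first exact: finite_setIl.
by move=> u [_ Uu]; apply: finite_places_over.
Qed.

(** By integrality, a nonarchimedean pole of x lies over a pole of one of the
    coefficients of chi x, and each of these has finitely many poles. *)
Lemma ext_poles_finite x : finite_set [set v | ext_places v /\ 1 < v x].
Proof.
have [chi [fib [chiP fibP]]] := fibers_exist.
have [_ _ PF _ _] := base.
have [mchi schi rchi] := chiP x.
have /choice[l lP] : forall k, exists l : seq (F -> R),
    forall u, U u -> u \notin l -> u (chi x)`_k <= 1.
  move=> k; have [c0|/PF[l [_ l1 _]]] := eqVneq ((chi x)`_k) 0.
    by exists [::] => u Uu _; have [Uabs _ _ _ _] := base; rewrite c0 (av0 (Uabs u Uu)).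
  by exists l => u Uu ul; rewrite l1.
have fin : finite_set (ext_archimedean `|`
    \bigcup_(k in `I_n.+1) \bigcup_(u in U `&` [set` l k]) [set v | ext_places v /\ restr v = u]).
  rewrite finite_setU; split; first exact: ext_archimedean_finite.
  apply: bigcup_finite; first exact: finite_II.
  move=> k _; apply: bigcup_finite; first exact/finite_setIr/finite_seq.
  by move=> u [Uu _]; apply: finite_places_over.
apply: sub_finite_set fin => v [Vv vx].
have [[_ uv]|[Av _]] := ext_place_type Vv; last by left.
right; apply: contrapT => nv; have [av Uv] := Vv; move: vx; rewrite ltNge; case/negP.
apply: (ultrametric_integral av uv (p := map_poly (in_alg K) (chi x))) => // [|k].
  by rewrite map_monic.
rewrite coef_map; have [kn|nk] := ltnP k n.+1; last first.
  by rewrite nth_default ?schi //= scale0r (av0 av).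
apply: (lP k (restr v) Uv); apply/negP => vl; apply: nv; exists k => //.
by exists (restr v).
Qed.

(** The product formula for the norm of x, distributed over the places above
    those of F: c v counts the conjugates that define v. The places outside T
    contribute nonpositive terms, whence the inequality. *)
Lemma ext_product_formula x (T : seq (K -> R)) : x != 0 -> uniq T ->
  (forall v, v \in T -> ext_places v) ->
  (forall v, ext_places v -> v \notin T -> v x <= 1) ->
  exists c : (K -> R) -> R, (forall v, v \in T -> 1 <= c v <= n%:R) /\
    0 <= \sum_(v <- T) c v * ln (v x).
Proof.
have [chi [fib [chiP fibP]]] := fibers_exist.
have [Uabs _ PF _ _] := base => x0 uT TV xT.
case: T => [|v0 T'] in uT TV xT *.
  by exists (fun=> 1); split=> //; rewrite big_nil.
set T := v0 :: T' in uT TV xT *.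
pose N := (chi x)`_0.
have vx0 v : ext_places v -> 0 < v x by move=> [av _]; apply: av_gt0.
have inU v : ext_places v -> U (restr v) by case.
have v0V : ext_places v0 by apply: TV; rewrite inE eqxx.
have N0 : N != 0.
  have [_ memE prodE _ _] := fibP _ (inU v0 v0V).
  rewrite -(av_eq0 (Uabs _ (inU v0 v0V))) /N -prodE; apply: lt0r_neq0.
  rewrite big_seq; apply: prodr_gt0 => v; rewrite memE => /asboolP[+ _].
  exact: vx0.
have [l0 [l0U l01 l0S]] := PF N N0.
pose L := undup ([seq restr v | v <- T] ++ l0).
have LU u : u \in L -> U u.
  rewrite mem_undup mem_cat => /orP[/mapP[v vT ->]|/l0U//].
  exact/inU/TV.
have SL : \sum_(u <- L) ln (u N) = 0.
  by apply: l0S => //; [exact: undup_uniq | move=> u ul; rewrite mem_undup mem_cat ul orbT].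
pose m := flatten [seq fib u | u <- L].
have mV v : v \in m -> ext_places v.
  move=> /flattenP[_ /mapP[u uL ->]]; have [_ memE _ _ _] := fibP u (LU u uL).
  by rewrite memE => /asboolP[].
have Tm v : v \in T -> v \in m.
  move=> vT; have rL : restr v \in L by rewrite mem_undup mem_cat map_f.
  apply/flattenP; exists (fib (restr v)); first exact: map_f.
  have [_ memE _ _ _] := fibP _ (LU _ rL).
  by rewrite memE; apply/asboolP; split=> //; apply: TV.
have Sm : \sum_(v <- m) ln (v x) = 0.
  apply: etrans SL; rewrite big_flatten big_map /=; apply: eq_big_seq => u /LU Uu.
  have [_ memE prodE _ _] := fibP u Uu; rewrite /N -prodE.
  have : forall v, v \in fib u -> 0 < v x.
    by move=> v; rewrite memE => /asboolP[+ _]; apply: vx0.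
  elim: (fib u) => [|v s IH] pos; first by rewrite !big_nil ln1.
  have pos' v' : v' \in s -> 0 < v' x by move=> v's; apply: pos; rewrite inE v's orbT.
  rewrite !big_cons lnM ?posrE ?IH //; first by apply: pos; rewrite inE eqxx.
  by rewrite big_seq; apply: prodr_gt0 => v' /pos'.
exists (fun v => (count_mem v m)%:R); split=> [v vT|].
  rewrite ler1n -has_count has_pred1 Tm //= ler_nat.
  rewrite /m count_flatten sumnE big_map big_map.
  have rL : restr v \in L by rewrite mem_undup mem_cat map_f.
  rewrite (bigD1_seq (restr v)) ?undup_uniq //= big1_seq ?addn0.
    have [<- _ _ _ _] := fibP _ (LU _ rL); exact: count_size.
  move=> u /andP[ur uL]; have [_ memE _ _ _] := fibP u (LU u uL).
  apply/count_memPn; rewrite memE; apply/asboolP => -[_ vu].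
  by rewrite vu eqxx in ur.
have E : \sum_(v <- undup m) (count_mem v m)%:R * ln (v x) = 0.
  apply: etrans Sm; rewrite -[RHS]big_undup_iterop_count; apply: eq_bigr => v _.
  by rewrite Monoid.iteropE iter_addr_0 mulr_natl.
have -> : \sum_(v <- T) (count_mem v m)%:R * ln (v x)
    = \sum_(v <- undup m | v \in T) (count_mem v m)%:R * ln (v x).
  rewrite -[RHS]big_filter; apply: perm_big.
  apply: uniq_perm; [exact: uT | by rewrite filter_uniq ?undup_uniq | ].
  by move=> v; rewrite mem_filter mem_undup; case: (boolP (v \in T)) => // /Tm ->.
move/eqP: E; rewrite (bigID (fun v => v \in T)) /= addr_eq0 => /eqP ->.
rewrite oppr_ge0 big_seq_cond; apply: sumr_le0 => v.
rewrite mem_undup => /andP[vm vT]; rewrite mulr_ge0_le0 //.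
by apply: ln_le0; apply: xT => //; apply: mV.
Qed.

(** The coefficients of chi x are symmetric functions of the conjugates of x. *)
Lemma ext_large_place x r : (forall u, ~ A u) -> 1 <= r ->
  (forall v, ext_places v -> v x <= r) ->
  exists p : {poly F}, [/\ p \is monic, root (map_poly (in_alg K) p) x
    & forall u k, U u -> u p`_k <= r ^+ n].
Proof.
move=> nA r1 hr; have [chi [fib [chiP fibP]]] := fibers_exist.
have [mchi _ rchi] := chiP x; exists (chi x); split=> // u k Uu.
have [_ memE _ _ bnd] := fibP u Uu; apply: bnd => // v.
by rewrite memE => /asboolP[Vv _]; apply: hr.
Qed.

End Extension.

(** * Local degrees *)

Section LocalDegree.
Variables (R : realType) (s : global_base) (K : fieldExtType (base_field s)) (v : K -> R).
Hypothesis av : absolute_value v.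

Let F := base_field s.

Let dense n (f : 'I_n -> K) := forall x (eps : R), 0 < eps ->
  exists a : 'I_n -> F, v (x - \sum_(i < n) a i *: f i) < eps.

Let vZ (a : F) (x : K) : v (a *: x) = v (in_alg K a) * v x.
Proof. by rewrite -(avM av) /= -scalerAl mul1r. Qed.

Let av_alg : absolute_value (fun a : F => v (in_alg K a)).
Proof. exact: (av_comp (in_alg K) av). Qed.

Let dense_basis : exists n (f : 'I_n -> K), dense f.
Proof.
exists (\dim {:K}), (fun i => (vbasis {:K})`_i) => x eps eps0.
exists (fun i => coord (vbasis {:K}) i x).
by rewrite -coord_vbasis ?memvf // subrr (av0 av).
Qed.

(** The coordinates with respect to a dense family of least size are bounded:
    otherwise a vector of the family could be approximated by combinations of
    the others, which would then be dense on their own. *)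
Let dense_bounded : exists n (f : 'I_n -> K), dense f /\
  forall i, exists2 C : R, 0 < C &
    forall a : 'I_n -> F, v (in_alg K (a i)) <= C * v (\sum_(j < n) a j *: f j).
Proof.
have exn : exists n, `[< exists f : 'I_n -> K, dense f >].
  by have [n [f df]] := dense_basis; exists n; apply/asboolP; exists f.
have [n /asboolP[f df] nmin] := ex_minnP exn.
exists n, f; split=> // i; apply: contrapT => nC.
case: n => [|n] in f df nmin i nC *; first by move: nC; case: i.
suff /nmin : `[< exists g : 'I_n -> K, dense g >] by rewrite ltnn.
apply/asboolP; exists (fun j => f (lift i j)) => x eps eps0.
have half0 : 0 < eps / 2 by rewrite divr_gt0.
have [c hc] := df x (eps / 2) half0.
pose C := 2 * (1 + v (in_alg K (c i))) / eps.
have ci0 := av_ge0 av (in_alg K (c i)).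
have C0 : 0 < C by rewrite divr_gt0 // mulr_gt0 // ltr_pwDl.
have [a ha] : exists a : 'I_n.+1 -> F,
    C * v (\sum_(j < n.+1) a j *: f j) < v (in_alg K (a i)).
  apply: contrapT => /forallNP h; apply: nC; exists C => // a.
  by rewrite leNgt; apply/negP/h.
have ai0 : a i != 0.
  apply: contraTneq ha => ->; rewrite (av0 av_alg) -leNgt.
  by rewrite mulr_ge0 ?(ltW C0) // (av_ge0 av).
exists (fun j => c (lift i j) - c i * (a i)^-1 * a (lift i j)).
set S := \sum_(j < n.+1) a j *: f j in ha.
have -> : x - \sum_(j < n) (c (lift i j) - c i * (a i)^-1 * a (lift i j)) *: f (lift i j)
    = (x - \sum_(j < n.+1) c j *: f j) + (c i * (a i)^-1) *: S.
  rewrite /S !(bigD1_ord i) //= scalerDr scalerA divfK //.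
  have -> : \sum_(j < n) (c (lift i j) - c i * (a i)^-1 * a (lift i j)) *: f (lift i j)
      = \sum_(j < n) c (lift i j) *: f (lift i j)
        - (c i * (a i)^-1) *: (\sum_(j < n) a (lift i j) *: f (lift i j)).
    rewrite scaler_sumr -sumrB; apply: eq_bigr => j _.
    by rewrite scalerBl scalerA.
  by ring.
apply: le_lt_trans (avD av _ _) _; rewrite vZ.
have -> : eps = eps / 2 + eps / 2 by field.
apply: ltr_leD => //; rewrite (avM av_alg) (avV av_alg).
have uai : 0 < v (in_alg K (a i)) by apply: (av_gt0 av_alg).
have : 2 * (1 + v (in_alg K (c i))) * v S < v (in_alg K (a i)) * eps.
  by move: ha; rewrite /C mulrAC ltr_pdivrMr.
have := av_ge0 av S.
move: (v S) (v (in_alg K (a i))) (v (in_alg K (c i))) uai ci0 => Z X Y X0 Y0 Z0 h.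
by rewrite mulrAC ler_pdivrMr //; nra.
Qed.

Let null_forP (x : nat -> K) : null_for v x <->
  forall eps : R, 0 < eps -> exists N : nat, forall m, (N <= m)%N -> v (x m) < eps.
Proof.
split=> [/cvgrPdist_lt h eps /h[N _ hN]|h].
  by exists N => m le_Nm; have := hN m le_Nm; rewrite /= sub0r normrN ger0_norm // av_ge0.
apply/cvgrPdist_lt => eps /h[N hN]; exists N => // m /= le_Nm.
by rewrite sub0r normrN ger0_norm ?hN // av_ge0.
Qed.

Let null_for_alg (x : nat -> F) :
  (forall eps : R, 0 < eps -> exists N : nat, forall m, (N <= m)%N -> v (in_alg K (x m)) < eps) ->
  null_for (fun a : F => v (in_alg K a)) x.
Proof.
move=> h; apply/cvgrPdist_lt => eps /h[N hN]; exists N => // m /= le_Nm.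
by rewrite sub0r normrN ger0_norm ?hN // av_ge0.
Qed.

(** Bounded coordinates turn approximations of a Cauchy sequence into Cauchy
    sequences of coordinates, so a minimal dense family is a basis of K_v. *)
Lemma completion_basis_exists : exists n (e : 'I_n -> nat -> K), completion_basis v e.
Proof.
have [n [f [df fC]]] := dense_bounded; exists n, (fun i _ => f i); split.
- by move=> i eps eps0; exists 0%N => m k _ _; rewrite subrr (av0 av).
- move=> x cx; have /choice[a ha] : forall m : nat, exists a : 'I_n -> F,
      v (x m - \sum_(i < n) a i *: f i) < m.+1%:R^-1.
    by move=> m; apply: df; rewrite invr_gt0.
  have small eps : 0 < eps -> exists N : nat, forall m, (N <= m)%N -> m.+1%:R^-1 < eps :> R.
    move=> eps0; exists (Num.truncn eps^-1) => m le_m.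
    rewrite invf_plt ?posrE //; apply: lt_le_trans (truncnS_gt _) _.
    by rewrite ler_nat ltnS.
  exists (fun i m => a m i).
    move=> i eps eps0; have [C C0 hC] := fC i.
    pose del := eps / C / 3; have del0 : 0 < del by rewrite !divr_gt0.
    have [N1 h1] := cx del del0; have [N2 h2] := small del del0.
    exists (maxn N1 N2) => m k; rewrite !geq_max => /andP[m1 m2] /andP[k1 k2].
    have := hC (fun i => a m i - a k i).
    have -> : \sum_(j < n) (a m j - a k j) *: f j = (x m - x k)
        - (x m - \sum_(j < n) a m j *: f j) + (x k - \sum_(j < n) a k j *: f j).
      under eq_bigr do rewrite scalerBl.
      by rewrite sumrB; ring.
    move=> h; apply: le_lt_trans h _.
    have -> : eps = C * (del + del + del) by rewrite /del; field; rewrite gt_eqF.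
    rewrite ltr_pM2l //; apply: le_lt_trans (avD av _ _) _; apply: ltrD; last first.
      exact: lt_trans (ha k) (h2 k k2).
    apply: le_lt_trans (avB av _ _) _; apply: ltrD; first exact: h1.
    exact: lt_trans (ha m) (h2 m m2).
  apply/null_forP => eps /small[N hN]; exists N => m /hN; apply: lt_trans; exact: ha.
- move=> a ca /null_forP nul i; have [C C0 hC] := fC i.
  apply: null_for_alg => eps eps0; have [N hN] := nul (eps / C) (divr_gt0 eps0 C0).
  exists N => m /hN h; apply: le_lt_trans (hC (fun j => a j m)) _.
  by rewrite mulrC -ltr_pdivlMr.
Qed.

Lemma local_degree_gt0 : (0 < local_degree v)%N.
Proof.
rewrite /local_degree; set P := [set n | _].
have exP : exists n, P n by have [n [e he]] := completion_basis_exists; exists n, e.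
have [e [_ sp _]] : P (xget 0%N P) := xgetPex 0%N exP.
rewrite lt0n; apply/eqP => n0.
have [|a _ /null_forP] := sp (fun=> 1).
  by move=> eps eps0; exists 0%N => m k _ _; rewrite subrr (av0 av).
move=> /(_ 1 ltr01)[N /(_ N (leqnn _))].
have -> : \sum_(i < xget 0%N P) a i N *: e i N = 0.
  by apply: big1 => i _; have := ltn_ord i; rewrite {2}n0.
by rewrite subr0 (av1 av) ltxx.
Qed.

Lemma weight_ge : (\dim {:K})%:R^-1 <= weight v.
Proof.
rewrite /weight ler_peMl ?invr_ge0 ?ler0n // ler1n.
exact: local_degree_gt0.
Qed.

End LocalDegree.

(** * Local dynamics: escape and size of orbit points *)

Section LogPlus.
Variable R : realType.
Implicit Types t e : R.

Definition logplus t : R := ln (Num.max 1 t).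

Lemma logplus_ge0 t : 0 <= logplus t.
Proof. by rewrite ln_ge0 // le_max lexx. Qed.

Lemma le_expR_logplus t : t <= expR (logplus t).
Proof. by rewrite lnK ?posrE ?lt_max ?ltr01 // le_max lexx orbT. Qed.

Lemma logplus_le t e : 0 <= e -> t <= expR e -> logplus t <= e.
Proof.
move=> e0 te; rewrite -[leRHS]expRK ler_ln ?posrE ?expR_gt0 ?lt_max ?ltr01 //.
by rewrite ge_max te andbT -expR0 ler_expR.
Qed.

Lemma logplus_mono t t' : t <= t' -> logplus t <= logplus t'.
Proof. by move=> tt'; apply: logplus_le (logplus_ge0 _) (le_trans tt' (le_expR_logplus _)). Qed.

Lemma logplus_gt0 t : 0 < logplus t -> 1 < t /\ t = expR (logplus t).
Proof.
rewrite /logplus; have [t1|t1] := leP t 1; first by rewrite ln1 ltxx.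
by move=> _; split=> //; rewrite lnK // posrE (lt_trans ltr01).
Qed.

Lemma logplus_eq0 t : t <= 1 -> logplus t = 0.
Proof. by move=> t1; rewrite /logplus max_l // ln1. Qed.

Lemma ln_le_logplus t : ln t <= logplus t.
Proof.
have [t0|t0] := leP t 0; first by rewrite ln0 // logplus_ge0.
by rewrite ler_ln ?posrE ?lt_max ?ltr01 // le_max lexx orbT.
Qed.

End LogPlus.

(** The triangle inequality in the form shared by both kinds of absolute
    values: A is 1 for the ultrametric ones, and 2 always works. *)
Definition quasi_ultrametric (R : realType) (L : fieldType) (A : R) (v : L -> R) : Prop :=
  forall x y, v (x + y) <= A * Num.max (v x) (v y).

Lemma quasi_ultrametric2 (R : realType) (L : fieldType) (v : L -> R) :
  absolute_value v -> quasi_ultrametric 2 v.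
Proof.
move=> av x y; apply: le_trans (avD av x y) _; rewrite mulr_natl mulr2n.
by apply: lerD; rewrite le_max lexx ?orbT.
Qed.

Lemma quasi_ultrametric1 (R : realType) (L : fieldType) (v : L -> R) :
  ultrametric v -> quasi_ultrametric 1 v.
Proof. by move=> uv x y; rewrite mul1r. Qed.

Lemma large_log_bounds (R : realType) (d a beta l : R) :
  2 <= d -> 0 <= a -> 0 <= beta -> d * (2 * a) + beta < d * l ->
  [/\ 2 * a < l, 0 < l, l <= d * l - 2 * a, 2 * a + l < d * l & 2 * a + beta < d * l].
Proof.
move=> d2 a0 b0 hl; have d0 : 0 < d by lra.
have l2a : 2 * a < l by rewrite -(ltr_pM2l d0); lra.
have dl : 2 * l <= d * l by rewrite ler_pM2r //; lra.
have da : 2 * (2 * a) <= d * (2 * a) by rewrite ler_wpM2r //; lra.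
by split; lra.
Qed.

Lemma escape_log_step (R : realType) (d a l l' : R) :
  2 <= d -> 0 <= a -> d * l - 2 * a <= l' -> d * (l - 2 * a) <= l' - 2 * a.
Proof.
move=> d2 a0 hl; have da : 2 * (2 * a) <= d * (2 * a) by rewrite ler_wpM2r //; lra.
lra.
Qed.

Section LocalDynamics.
Variables (R : realType) (K : fieldType) (v : K -> R) (a : R) (d : nat) (b : K).
Hypotheses (av : absolute_value v) (a0 : 0 <= a) (d2 : (2 <= d)%N).
Hypothesis qv : quasi_ultrametric (expR a) v.

Variable beta : R.
Hypotheses (b0 : 0 <= beta) (vb : v b <= expR beta).

Lemma quasi_le x y (e : R) : v x <= expR e -> v y <= expR e -> v (x + y) <= expR (a + e).
Proof.
move=> hx hy; apply: le_trans (qv x y) _.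
by rewrite expRD ler_pM2l ?expR_gt0 // ge_max hx.
Qed.

Lemma quasi_le3 x y z : v (x + y + z) <= expR (2 * a) * Num.max (v x) (Num.max (v y) (v z)).
Proof.
have A1 : 1 <= expR a by rewrite -expR0 ler_expR.
have hx : v (x + y) <= expR a * Num.max (v x) (Num.max (v y) (v z)).
  apply: le_trans (qv x y) _; rewrite ler_pM2l ?expR_gt0 //.
  by rewrite ge_max !le_max !lexx ?orbT.
apply: le_trans (qv _ _) _; rewrite expRM_natl expr2 -mulrA ler_pM2l ?expR_gt0 // ge_max hx /=.
apply: (@le_trans _ _ (Num.max (v x) (Num.max (v y) (v z)))).
  by rewrite !le_max lexx ?orbT.
by rewrite ler_peMl // !le_max (av_ge0 av).
Qed.

(** y runs through the first coordinates of an orbit, in either direction. *)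
Definition henon_step (y0 y1 y2 : K) : Prop :=
  v y2 <= expR (2 * a) * Num.max (v y0) (Num.max (v y1 ^+ d) (v b)) /\
  v y1 ^+ d <= expR (2 * a) * Num.max (v y2) (Num.max (v y0) (v b)).

Lemma henon_step_forward y0 y1 y2 : y2 = y0 + y1 ^+ d + b ->
  henon_step y0 y1 y2 /\ henon_step y2 y1 y0.
Proof.
move=> E.
have E0 : y0 = y2 + - y1 ^+ d + - b by rewrite E; ring.
have E1 : y1 ^+ d = y2 + - y0 + - b by rewrite E; ring.
have E1' : y1 ^+ d = - y0 + y2 + - b by rewrite E; ring.
split; split.
- by rewrite -(avX av) {1}E; apply: quasi_le3.
- by rewrite -(avX av) {1}E1 -(avN av y0) -(avN av b); apply: quasi_le3.
- by rewrite -(avX av) {1}E0 -(avN av (y1 ^+ d)) -(avN av b); apply: quasi_le3.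
- by rewrite -(avX av) {1}E1' -(avN av y0) -(avN av b); apply: quasi_le3.
Qed.

Lemma henon_step_growth y0 y1 y2 : henon_step y0 y1 y2 ->
  logplus (Num.max (v y1) (v y2)) <= d%:R * logplus (Num.max (v y0) (v y1)) + (2 * a + beta).
Proof.
move=> [h _]; have := le_expR_logplus (Num.max (v y0) (v y1)).
rewrite ge_max; move: (logplus _) (logplus_ge0 (Num.max (v y0) (v y1))) => l l0 /andP[e0 e1].
have dl0 : l <= d%:R * l by rewrite ler_peMl // ler1n ltnW.
have dl1 : 0 <= d%:R * l by apply: le_trans dl0.
have sum0 : 0 <= 2 * a + beta by rewrite addr_ge0 // mulr_ge0.
apply: logplus_le; first by rewrite addr_ge0.
rewrite ge_max; apply/andP; split.
  by apply: le_trans e1 _; rewrite ler_expR (le_trans dl0) // lerDl.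
apply: le_trans h _.
have -> : d%:R * l + (2 * a + beta) = 2 * a + (d%:R * l + beta) by ring.
rewrite expRD ler_pM2l ?expR_gt0 // !ge_max; apply/and3P; split.
- by apply: le_trans e0 _; rewrite ler_expR (le_trans dl0) // lerDl.
- apply: (@le_trans _ _ (expR (d%:R * l))); last by rewrite ler_expR lerDl.
  by rewrite expRM_natl lerXn2r ?nnegrE ?(av_ge0 av) ?expR_ge0.
- by apply: le_trans vb _; rewrite ler_expR lerDr.
Qed.

Let d2R : 2 <= d%:R :> R. Proof. by rewrite ler_nat. Qed.

Let d0R : 0 < d%:R :> R. Proof. by apply: lt_le_trans d2R. Qed.

Let large_log l := @large_log_bounds R d%:R a beta l d2R a0 b0.

Lemma escape_step y0 y1 y2 : henon_step y0 y1 y2 -> v y0 <= v y1 ->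
  d%:R * (2 * a) + beta < d%:R * ln (v y1) ->
  d%:R * ln (v y1) - 2 * a <= ln (v y2) /\ v y1 <= v y2.
Proof.
move=> [_ h] y01 hl; set l := ln (v y1) in hl *.
have [l2a l0 l1 l2 l3] := large_log hl.
have vy1 : 0 < v y1.
  by rewrite ltNge; apply/negP => /ln0 le0; move: l0; rewrite /l le0 ltxx.
have y1E : v y1 = expR l by rewrite lnK.
have key : expR (d%:R * l - 2 * a) <= v y2.
  have hd : expR (d%:R * l) <= expR (2 * a) * Num.max (v y2) (Num.max (v y0) (v b)).
    by rewrite expRM_natl -y1E.
  have hm : expR (d%:R * l - 2 * a) <= Num.max (v y2) (Num.max (v y0) (v b)).
    by rewrite expRD expRN ler_pdivrMr ?expR_gt0 // [leRHS]mulrC.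
  move: hm; rewrite !le_max => /or3P[//|h0|hb].
    by have := le_trans h0 y01; rewrite y1E ler_expR lerBlDl leNgt l2.
  by have := le_trans hb vb; rewrite ler_expR lerBlDl leNgt l3.
split; last by apply: le_trans key; rewrite y1E ler_expR.
by rewrite -[leLHS]expRK ler_ln ?posrE ?expR_gt0 // (lt_le_trans (expR_gt0 _) key).
Qed.

(** Once an orbit is large and does not decrease, y^d dominates the recursion
    and the logarithmic size is multiplied by d at each step. *)
Lemma escape (z : nat -> K) (J : nat) :
  (forall j, (j < J)%N -> henon_step (z j) (z j.+1) (z j.+2)) ->
  v (z 0%N) <= v (z 1%N) -> d%:R * (2 * a) + beta < d%:R * ln (v (z 1%N)) ->
  d%:R ^+ J * (ln (v (z 1%N)) - 2 * a) <= ln (v (z J.+1)) - 2 * a.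
Proof.
move=> hz z01 hl.
suff : forall j, (j <= J)%N ->
    [/\ d%:R ^+ j * (ln (v (z 1%N)) - 2 * a) <= ln (v (z j.+1)) - 2 * a,
        v (z j) <= v (z j.+1) & d%:R * (2 * a) + beta < d%:R * ln (v (z j.+1))].
  by move=> /(_ J (leqnn J))[].
elim=> [|j IH] le_jJ; first by rewrite expr0 mul1r.
have [h1 h2 h3] := IH (ltnW le_jJ).
have [k1 k2] := escape_step (hz j le_jJ) h2 h3.
have [_ _ l1 _ _] := large_log h3.
split=> //; last by apply: lt_le_trans h3 _; rewrite ler_pM2l // (le_trans l1).
rewrite exprS -mulrA; apply: le_trans (_ : _ <= d%:R * (ln (v (z j.+1)) - 2 * a)) _.
  by rewrite ler_pM2l.
exact: escape_log_step k1.
Qed.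

(** A point of an orbit that is large at v grows from there on, forward or
    backward; hence its size is controlled by the two far ends of the orbit. *)
Lemma orbit_point_bound (y : nat -> K) (N k E : nat) :
  (forall i, y i.+2 = y i + y i.+1 ^+ d + b) ->
  (N <= k)%N -> (k < N + N)%N -> (k < N + E)%N ->
  logplus (v (y k)) <= 2 * a + Num.max (beta / d%:R)
    (d%:R ^+ E * (logplus (Num.max (v (y 0%N)) (v (y 1%N))) / d%:R ^+ N
      + logplus (Num.max (v (y (N + N)%N)) (v (y (N + N).+1))) / d%:R ^+ N)).
Proof.
move=> yE le_Nk lt_k lt_kE.
have dX0 m : 0 < d%:R ^+ m :> R by rewrite exprn_gt0.
have d1 : 1 <= d%:R :> R by apply: le_trans d2R; rewrite ler1n.
have steps i : henon_step (y i) (y i.+1) (y i.+2) /\ henon_step (y i.+2) (y i.+1) (y i).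
  exact/henon_step_forward.
set Gm := logplus _ / _; set Gp := logplus (Num.max (v (y (N + N)%N)) _) / _.
have Gm0 : 0 <= Gm by rewrite divr_ge0 ?logplus_ge0 // ltW.
have Gp0 : 0 <= Gp by rewrite divr_ge0 ?logplus_ge0 // ltW.
rewrite -lerBlDl le_max.
have [h|h] := leP (d%:R * logplus (v (y k))) (d%:R * (2 * a) + beta).
  by rewrite ler_pdivlMr // mulrC mulrBr lerBlDl h.
apply/orP; right.
have l0 : 0 < logplus (v (y k)) by have [_] := large_log h.
have [_ yk] := logplus_gt0 l0.
have lE : ln (v (y k)) = logplus (v (y k)) by rewrite {1}yk expRK.
have E1 : 1 <= d%:R ^+ E :> R by rewrite exprn_ege1.
have sub2a x : x - 2 * a <= x by rewrite lerBlDr lerDl mulr_ge0 //.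
have [fwd|bwd] := ltP (v (y k)) (v (y k.+1)).
  have ll : logplus (v (y k)) <= ln (v (y k.+1)).
    have vk0 : 0 < v (y k) by rewrite yk expR_gt0.
    by rewrite -lE ler_ln ?posrE ?(ltW fwd) // (lt_trans vk0).
  pose J := (N + N - k.+1)%N.
  have JE : (k + J.+1 = N + N)%N by rewrite addnS -addSn subnKC.
  have esc : d%:R ^+ J * (ln (v (y k.+1)) - 2 * a) <= ln (v (y (N + N)%N)) - 2 * a.
    have := @escape (fun j => y (k + j)%N) J; rewrite /= addn0 addn1 JE; apply.
    - by move=> j _; rewrite !addnS; exact: (steps _).1.
    - exact: ltW.
    - by apply: lt_le_trans h _; rewrite ler_pM2l.
  have GpE : ln (v (y (N + N)%N)) <= d%:R ^+ N * Gp.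
    rewrite mulrCA divff ?gt_eqF // mulr1; apply: le_trans (ln_le_logplus _) _.
    by apply: logplus_mono; rewrite le_max lexx.
  rewrite -(ler_pM2l (dX0 J)).
  apply: (@le_trans _ _ (d%:R ^+ N * Gp)).
    apply: le_trans (_ : _ <= d%:R ^+ J * (ln (v (y k.+1)) - 2 * a)) _.
      by rewrite ler_pM2l // lerD2r.
    by apply: le_trans esc _; apply: le_trans GpE.
  have leJ : (N <= J + E)%N.
    by rewrite /J -(leq_add2l k.+1) addnA subnKC // addnC -addnA leq_add2l.
  rewrite [leRHS]mulrA -exprD; apply: ler_pM; rewrite ?(ltW (dX0 _)) //; last by rewrite lerDr.
  by rewrite ler_weXn2l.
have esc : d%:R ^+ k * (ln (v (y k)) - 2 * a) <= ln (v (y 0%N)) - 2 * a.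
  have := @escape (fun j => y (k.+1 - j)%N) k; rewrite subSS !subn0 subnn; apply=> //.
    move=> j lt_jk; rewrite (subSn (ltnW lt_jk)) !subSS -(subnSK lt_jk).
    exact: (steps _).2.
  by rewrite lE.
have GmE : ln (v (y 0%N)) <= d%:R ^+ N * Gm.
  rewrite mulrCA divff ?gt_eqF // mulr1; apply: le_trans (ln_le_logplus _) _.
  by apply: logplus_mono; rewrite le_max lexx.
apply: (@le_trans _ _ Gm); last first.
  by rewrite (le_trans (_ : _ <= Gm + Gp)) ?lerDl // ler_peMl // addr_ge0.
rewrite -(ler_pM2l (dX0 k)) -lE; apply: le_trans esc _.
apply: (@le_trans _ _ (d%:R ^+ N * Gm)); first exact: le_trans GmE.
by rewrite ler_wpM2r // ler_weXn2l.
Qed.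

End LocalDynamics.

(** * Local dynamics: clusters and contraction *)

(** The exponents that occur when two orbit points with the same itinerary are
    compared: rho bounds the points, eta separates clusters, and gam stands
    for log |b| / d^2. *)
Lemma contraction_exponents (R : realType) (d a gam : R) :
  2 <= d -> 0 <= a -> 0 < gam -> 16 * (d + 2) * a <= gam ->
  let rho := 2 * a + d * gam in let eta := 4 * a + 3 / 2 * gam in
  [/\ d * a + (a + rho) < d * eta,
      a + (a + rho) < d * (d * gam),
      a + (a + eta + 2 * (d * a) + (d - 2) * rho) < - (d * a) + (d - 1) * (d * gam - a)
    & (a + (a + eta)) - (- (d * a) + (d - 1) * (d * gam - a) - a) <= - (d * (d * gam) / 16)].
Proof.
move=> d2 a0 g0 ga rho eta.
have da : 2 * a <= d * a by rewrite ler_wpM2r.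
have dg : 2 * gam <= d * gam by rewrite ler_pM2r.
have ddg : 2 * (d * gam) <= d * (d * gam) by rewrite ler_pM2r //; nra.
have ga' : 16 * (d * a) + 32 * a <= gam by move: ga; rewrite -!mulrA mulrDl; lra.
by rewrite /rho /eta; split; nra.
Qed.

Lemma pred_sub_succ d i : (i.+1 < d)%N -> (d.-1 - i.+1 + i + 2 = d)%N.
Proof. lia. Qed.

Section Clusters.
Variables (R : realType) (K : fieldType) (v : K -> R) (a : R).
Hypotheses (av : absolute_value v) (a0 : 0 <= a).
Hypothesis qv : quasi_ultrametric (expR a) v.

Lemma quasi_leB x y (e : R) : v x <= expR e -> v y <= expR e -> v (x - y) <= expR (a + e).
Proof. by move=> hx hy; apply: quasi_le => //; rewrite avN. Qed.

Lemma quasi_sum n (f : 'I_n -> K) (e : R) : (forall i, v (f i) <= expR e) ->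
  v (\sum_(i < n) f i) <= expR (n%:R * a + e).
Proof.
elim: n f => [|n IH] f hf; first by rewrite big_ord0 (av0 av) expR_ge0.
rewrite big_ord_recr -natr1 mulrDl mul1r addrAC addrC; apply: quasi_le => //.
  exact: IH.
by apply: le_trans (hf _) _; rewrite ler_expR lerDr mulr_ge0.
Qed.

(** The values of a monic polynomial of degree m cannot all be small at m + 1
    well separated points, by divided differences. *)
Lemma separated_values (g : {poly K}) (m : nat) (z : nat -> K) (eta e : R) :
  g \is monic -> size g = m.+1 ->
  (forall i k, (i < k)%N -> (k <= m)%N -> expR eta < v (z i - z k)) ->
  (forall i, (i <= m)%N -> v g.[z i] <= expR e) -> m%:R * eta <= m%:R * a + e.
Proof.
elim: m g e => [|m IH] g e mg sg sep hg.
  have g1 : g = 1.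
    have gC : g = (g`_0)%:P by apply: size1_polyC; rewrite sg.
    by move/monicP: mg; rewrite lead_coefE sg gC /= coefC eqxx => ->.
  have := hg 0%N (leqnn _); rewrite g1 -polyC1 hornerC (av1 av) -{1}expR0 ler_expR.
  by rewrite !mul0r add0r.
have : root (g - g.[z m.+1]%:P) (z m.+1) by rewrite /root !hornerE subrr.
case/factor_theorem => g1 g1E.
have szc : (size (- g.[z m.+1]%:P : {poly K}) < size g)%N.
  by rewrite size_polyN (leq_ltn_trans (size_polyC_leq1 _)) // sg.
have mg1 : g1 \is monic.
  have : g1 * ('X - (z m.+1)%:P) \is monic.
    by rewrite -g1E monicE lead_coefDl // -monicE.
  by rewrite monicMr // monicXsubC.
have sg1 : size g1 = m.+1.
  have := size_Mmonic (monic_neq0 mg1) (monicXsubC (z m.+1)).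
  by rewrite -g1E (size_polyDl szc) sg size_XsubC addn2 => -[<-].
have := IH g1 (a + e - eta) mg1 sg1 _ _ => h.
suff : m%:R * eta <= m%:R * a + (a + e - eta) by rewrite -natr1 !mulrDl !mul1r; lra.
apply: h => [i k ik km|i im]; first by apply: sep => //; apply: leqW.
have far := sep i m.+1 im (leqnn _).
have gi : v (g1.[z i] * (z i - z m.+1)) <= expR (a + e).
  have -> : g1.[z i] * (z i - z m.+1) = g.[z i] - g.[z m.+1].
    have := congr1 (fun p => p.[z i]) g1E.
    by rewrite /= !hornerE => <-.
  by apply: quasi_leB; apply: hg => //; apply: leqW.
rewrite (avM av) in gi; rewrite expRD expRN ler_pdivlMr ?expR_gt0 //.
by apply: le_trans gi; rewrite ler_wpM2l ?(av_ge0 av) // ltW.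
Qed.

(** A maximal set of points at mutual distance more than exp eta has at most d
    elements, by divided differences; a point takes the color of an element of
    this set near it. *)
Lemma cluster_coloring (I : finType) (pts : I -> K) (g : {poly K}) (d : nat) (eta e : R) :
  g \is monic -> size g = d.+1 -> (forall i, v g.[pts i] <= expR e) ->
  d%:R * a + e < d%:R * eta ->
  exists col : I -> 'I_d.+1, forall i k, col i = col k -> v (pts i - pts k) <= expR (a + eta).
Proof.
move=> mg sg hg he.
pose far (S : {set I}) := [forall i in S, forall k in S, (i != k) ==> (expR eta < v (pts i - pts k))].
have far0 : far finset.set0 by apply/forallP => i; rewrite inE.
have [S /maxsetP[farS maxS] _] := maxset_exists far0.
have farP T i k : far T -> i \in T -> k \in T -> i != k -> expR eta < v (pts i - pts k).
  by move=> /forallP/(_ i)/implyP h iT kT ik; move/forallP: (h iT) => /(_ k)/implyP/(_ kT)/implyP/(_ ik).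
have cardS : (#|S| <= d)%N.
  rewrite leqNgt; apply/negP => ltdS.
  have [i0 i0S] : exists i, i \in S by apply/card_gt0P; apply: leq_ltn_trans ltdS.
  suff : d%:R * eta <= d%:R * a + e by rewrite leNgt he.
  apply: (separated_values (z := fun k => pts (nth i0 (enum S) k)) mg sg) => // i k ik kd.
  have kS : (k < size (enum S))%N by rewrite -cardE (leq_ltn_trans kd).
  have iS : (i < size (enum S))%N by apply: ltn_trans kS.
  have nthS j : (j < size (enum S))%N -> nth i0 (enum S) j \in S.
    by move=> jS; rewrite -mem_enum mem_nth.
  apply: (farP S _ _ farS (nthS i iS) (nthS k kS)).
  by rewrite nth_uniq ?enum_uniq // ltn_eqF.
have /choice[rep repP] : forall i, exists s, s \in S /\ v (pts i - pts s) <= expR eta.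
  move=> i; apply: contrapT => /forallNP h.
  have hi s : s \in S -> expR eta < v (pts i - pts s).
    by move=> sS; rewrite ltNge; apply/negP => hs; apply: (h s).
  have iS : i \notin S.
    by apply/negP => /hi; rewrite subrr (av0 av) ltNge expR_ge0.
  suff : i |: S = S by move=> E; rewrite -E !inE eqxx in iS.
  apply: maxS; last exact: finset.subsetUr.
  apply/forallP => k; apply/implyP; rewrite !inE => /orP[/eqP->|kS].
    apply/forallP => l; apply/implyP; rewrite !inE => /orP[/eqP->|lS]; first by rewrite eqxx.
    by apply/implyP => _; apply: hi.
  apply/forallP => l; apply/implyP; rewrite !inE => /orP[/eqP->|lS]; apply/implyP => kl.
    by rewrite -(avN av) opprB; apply: hi.
  exact: farP farS kS lS kl.
exists (fun i => inord (index (rep i) (enum S))) => i k /(congr1 val) /=.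
have ind l : (index (rep l) (enum S) < d.+1)%N.
  by rewrite ltnS (leq_trans _ cardS) // cardE index_size.
have repS l : rep l \in enum S by rewrite mem_enum; case: (repP l).
rewrite !inordK // => E.
have repE : rep i = rep k by rewrite -(nth_index (rep i) (repS i)) E nth_index.
have -> : pts i - pts k = (pts i - pts (rep i)) - (pts k - pts (rep k)) by rewrite repE; ring.
by apply: quasi_leB; have [] := repP i; have [] := repP k.
Qed.

(** Close points whose neighbours in the orbit are close as well are very
    close: y^d - y'^d is governed by the neighbours, and it equals y - y' times
    a factor close to d y^(d-1). *)
Lemma close_points_contract (d : nat) (b : K) (gam : R) (y y' : nat -> K) :
  (2 <= d)%N -> expR (- (d%:R * a)) <= v d%:R -> 0 < gam -> 16 * (d%:R + 2) * a <= gam ->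
  v b = expR (d%:R * (d%:R * gam)) ->
  let rho := 2 * a + d%:R * gam in let eta := 4 * a + 3 / 2 * gam in
  y 2%N = y 0%N + y 1%N ^+ d + b -> y' 2%N = y' 0%N + y' 1%N ^+ d + b ->
  (forall i, (i <= 2)%N -> v (y i) <= expR rho) ->
  (forall i, (i <= 2)%N -> v (y' i) <= expR rho) ->
  (forall i, (i <= 2)%N -> v (y i - y' i) <= expR (a + eta)) ->
  v (y 1%N - y' 1%N) <= expR (- (d%:R * (d%:R * gam) / 16)).
Proof.
move=> d2 vd g0 ga vb rho eta yE yE' hy hy' hyy'.
have d2R : 2 <= d%:R :> R by rewrite ler_nat.
have [_ c2 c3 c4] := contraction_exponents d2R a0 g0 ga.
rewrite -/rho -/eta in c2 c3 c4.
have d0R : 0 < d%:R :> R by apply: lt_le_trans d2R.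
set x := y 1%N; set x' := y' 1%N.
have xd : x ^+ d + b = y 2%N - y 0%N by rewrite yE /x; ring.
have vxd : v (x ^+ d + b) <= expR (a + rho) by rewrite xd; apply: quasi_leB; apply: hy.
have diff : v (x ^+ d - x' ^+ d) <= expR (a + (a + eta)).
  have -> : x ^+ d - x' ^+ d = (y 2%N - y' 2%N) - (y 0%N - y' 0%N).
    by rewrite yE yE' /x /x'; ring.
  by apply: quasi_leB; apply: hyy'.
(* Since |x^d + b| is much smaller than |b|, |x| is about |b|^(1/d). *)
have vx : expR (d%:R * gam - a) <= v x.
  have : expR (d%:R * (d%:R * gam) - a) <= v x ^+ d.
    have := qv (x ^+ d + b) (- x ^+ d); rewrite addrAC subrr add0r vb.
    rewrite (avN av) (avX av) expRD expRN ler_pdivrMr ?expR_gt0 // [leRHS]mulrC.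
    rewrite maxEle; case: ifP => // _ h.
    have h2 : v (x ^+ d + b) * expR a <= expR (a + (a + rho)).
      by rewrite [leRHS]expRD mulrC ler_pM2l ?expR_gt0.
    by have := le_trans h h2; rewrite ler_expR leNgt c2.
  move=> h; rewrite -(@ler_pXn2r _ d) ?nnegrE ?expR_ge0 ?(av_ge0 av) ?(ltnW d2) //.
  apply: le_trans h; rewrite -expRM_natl ler_expR mulrBr lerD2l lerN2.
  by rewrite ler_peMl // (le_trans _ d2R) // ler1n.
have hx m : v (x ^+ m) <= expR (m%:R * rho).
  by rewrite (avX av) expRM_natl lerXn2r ?nnegrE ?(av_ge0 av) ?expR_ge0 // hy.
have hx' m : v (x' ^+ m) <= expR (m%:R * rho).
  by rewrite (avX av) expRM_natl lerXn2r ?nnegrE ?(av_ge0 av) ?expR_ge0 // hy'.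
have vM u u' (e e' : R) : v u <= expR e -> v u' <= expR e' -> v (u * u') <= expR (e + e').
  by move=> hu hu'; rewrite (avM av) expRD ler_pM ?(av_ge0 av).
pose q := \sum_(i < d) x ^+ (d.-1 - i) * x' ^+ i.
pose r := \sum_(i < d) x ^+ (d.-1 - i) * (x' ^+ i - x ^+ i).
have vr : v r <= expR (a + eta + 2 * (d%:R * a) + (d%:R - 2) * rho).
  have -> : a + eta + 2 * (d%:R * a) + (d%:R - 2) * rho
      = d%:R * a + (a + eta + d%:R * a + (d%:R - 2) * rho) by ring.
  apply: quasi_sum => -[[|i] lt_id] /=; first by rewrite !expr0 subrr mulr0 (av0 av) expR_ge0.
  rewrite subrXX /=.
  have hsum : v (\sum_(j < i.+1) x' ^+ (i - j) * x ^+ j) <= expR (i.+1%:R * a + i%:R * rho).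
    apply: quasi_sum => j; have := vM _ _ _ _ (hx' (i - j)%N) (hx j).
    by rewrite -mulrDl -natrD subnK // -ltnS.
  have hx0 : v (x' - x) <= expR (a + eta) by rewrite -(avN av) opprB; apply: hyy'.
  apply: le_trans (vM _ _ _ _ (hx (d.-1 - i.+1)%N) (vM _ _ _ _ hx0 hsum)) _.
  have := congr1 (fun m => m%:R : R) (pred_sub_succ lt_id); rewrite !natrD => dE.
  have -> : (d.-1 - i.+1)%N%:R = d%:R - 2 - i%:R :> R by rewrite -dE; ring.
  rewrite ler_expR.
  have : i.+1%:R * a <= d%:R * a by rewrite ler_wpM2r // ler_nat ltnW.
  by move: (i.+1%:R * a) (d%:R * a) (a + eta) (rho) => A B C D hAB; clear -hAB; lra.
have vq : expR (- (d%:R * a) + (d%:R - 1) * (d%:R * gam - a) - a) <= v q.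
  have lead : d%:R * x ^+ d.-1 = q - r.
    rewrite /q /r -sumrB (eq_bigr (fun=> x ^+ d.-1)) => [|i _].
      by rewrite sumr_const card_ord mulr_natl.
    by rewrite mulrBr opprB addrC subrK -exprD subnK // -ltnS prednK // (ltn_trans _ d2).
  have low : expR (- (d%:R * a) + (d%:R - 1) * (d%:R * gam - a)) <= v (d%:R * x ^+ d.-1).
    rewrite (avM av) (avX av) expRD ler_pM ?expR_ge0 //.
    have -> : d%:R - 1 = d.-1%:R :> R by rewrite -subn1 natrB // (ltn_trans _ d2).
    by rewrite expRM_natl lerXn2r ?nnegrE ?(av_ge0 av) ?expR_ge0.
  rewrite [X in X <= _]expRD expRN ler_pdivrMr ?expR_gt0 // [leRHS]mulrC.
  have := le_trans low (_ : _ <= expR a * Num.max (v q) (v r)).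
  rewrite lead -{1}(avN av r) => /(_ (qv _ _)).
  rewrite maxEle; case: ifP => // _ h.
  have h2 : expR a * v r <= expR (a + (a + eta + 2 * (d%:R * a) + (d%:R - 2) * rho)).
    by rewrite [leRHS]expRD ler_pM2l ?expR_gt0.
  by have := le_trans h h2; rewrite ler_expR leNgt c3.
have q0 : 0 < v q by apply: lt_le_trans vq; apply: expR_gt0.
apply: le_trans (_ : _ <= expR (a + (a + eta)) / v q) _.
  by rewrite ler_pdivlMr // -(avM av); move: diff; rewrite subrXX.
apply: le_trans (_ : _ <= expR (a + (a + eta))
    / expR (- (d%:R * a) + (d%:R - 1) * (d%:R * gam - a) - a)) _.
  by rewrite ler_pM2l ?expR_gt0 // lef_pV2 ?posrE ?expR_gt0.
by rewrite -expRN -expRD ler_expR.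
Qed.

End Clusters.

(** * Heights and canonical heights *)

Section RealSequences.
Variable R : realType.

(** Telescoping the bound makes u_N / D^N + C / D^N nonincreasing. *)
Lemma scaled_sequence_cvg (u : nat -> R) (D C : R) : 2 <= D -> 0 <= C ->
  (forall N, 0 <= u N) -> (forall N, u N.+1 <= D * u N + C) ->
  cvgn (fun N => u N / D ^+ N).
Proof.
move=> D2 C0 u0 uS; have D0 : 0 < D by lra.
have DX m : 0 < D ^+ m by rewrite exprn_gt0.
have Cto0 : cvgn (fun N => C * D^-1 ^+ N).
  apply: is_cvgMr; apply: cvgP; apply: cvg_expr.
  by rewrite ger0_norm ?invr_ge0 ?ltW // invf_lt1 //; lra.
have scvg : cvgn (fun N => u N / D ^+ N + C * D^-1 ^+ N).
  apply: nonincreasing_is_cvgn.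
    apply/nonincreasing_seqP => N; rewrite !exprVn exprS invfM !mulrA.
    have h : u N.+1 / D / D ^+ N <= (u N + C / D) / D ^+ N.
      rewrite ler_pM2r ?invr_gt0 // ler_pdivrMr // mulrDl divfK ?gt_eqF //.
      by rewrite [u N * D]mulrC; apply: uS.
    have h2 : C / D / D ^+ N <= (C - C / D) / D ^+ N.
      rewrite ler_pM2r ?invr_gt0 // lerBrDl -mulr2n -[C / D *+ 2]mulr_natl mulrCA.
      by rewrite ler_piMr // ler_pdivrMr // mul1r.
    apply: le_trans (lerD h h2) _.
    by rewrite -!mulrDl -addrA [C / D + _]addrC subrK mulrDl.
  exists 0 => _ [N _ <-]; rewrite addr_ge0 ?divr_ge0 ?(ltW (DX _)) //.
  by rewrite mulr_ge0 // exprn_ge0 // invr_ge0 ltW.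
rewrite (_ : (fun N => _) = (fun N => u N / D ^+ N + C * D^-1 ^+ N) \- (fun N => C * D^-1 ^+ N)).
  exact: is_cvgB.
by apply/funext => N /=; rewrite addrK.
Qed.

(** Both heights are small at one and the same level N, which is why the two
    limits are compared with their terms simultaneously. *)
Lemma frequently_below_limit (f g : nat -> R) (e : R) : cvgn f -> cvgn g ->
  limn f + limn g < e -> forall N0, exists2 N, (N0 <= N)%N & f N + g N < e.
Proof.
move=> cf cg lt_e N0; have cfg : (f n + g n) @[n --> \oo] --> limn f + limn g by apply: cvgD.
have [N _ hN] := cvgr_lt _ cfg _ lt_e.
exists (maxn N0 N); first exact: leq_maxl.
by apply: (hN (maxn N0 N)); rewrite /= leq_maxr.
Qed.

End RealSequences.

Section Heights.
Variables (R : realType) (K : fieldType) (V Ar : set (K -> R)) (w : (K -> R) -> R).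
Hypothesis Vabs : forall v, V v -> absolute_value v.
Hypothesis Vult : forall v, V v -> ~ Ar v -> ultrametric v.
Variable n : R.
Hypotheses (n1 : 1 <= n) (wge : forall v, V v -> n^-1 <= w v).
Variables (d : nat) (b : K).
Hypothesis d2 : (2 <= d)%N.

Definition weil_height (x : K) : R := \sum_(v \in V) w v * logplus (v x).

Definition weil_height2 (P : K * K) : R :=
  \sum_(v \in V) w v * logplus (Num.max (v P.1) (v P.2)).

Let n0 : 0 < n. Proof. by apply: lt_le_trans n1. Qed.

Lemma place_weight_gt0 v : V v -> 0 < w v.
Proof. by move=> /wge; apply: lt_le_trans; rewrite invr_gt0. Qed.

Lemma finite_place_sum (T : seq (K -> R)) (f : (K -> R) -> R) : uniq T ->
  (forall v, v \in T -> V v) -> (forall v, V v -> v \notin T -> f v <= 1) ->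
  \sum_(v \in V) w v * logplus (f v) = \sum_(v <- T) w v * logplus (f v).
Proof.
move=> uT TV hf; rewrite (fsbigE T) //=.
- rewrite big_seq_cond [RHS]big_seq; apply: eq_bigl => v.
  by case: (boolP (v \in T)) => // /TV vV; rewrite mem_set.
- by move=> v Vv vT; rewrite logplus_eq0 ?mulr0 // hf.
Qed.

Lemma weighted_term_le (T : seq (K -> R)) (f : (K -> R) -> R) v :
  (forall v, v \in T -> V v) -> uniq T -> (forall v, v \in T -> 0 <= f v) -> v \in T ->
  f v <= n * \sum_(v <- T) w v * f v.
Proof.
move=> TV uT f0 vT; rewrite (bigD1_seq v) //= mulrDr.
have wv := wge (TV v vT).
have h1 : f v <= n * (w v * f v).
  rewrite mulrA ler_peMl ?f0 //; apply: le_trans (_ : n * n^-1 <= _).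
    by rewrite divff ?gt_eqF.
  by rewrite ler_pM2l.
apply: le_trans h1 _; rewrite lerDl mulr_ge0 ?(ltW n0) // big_seq_cond; apply: sumr_ge0 => u.
by move=> /andP[uT' _]; rewrite mulr_ge0 ?f0 // (ltW (place_weight_gt0 (TV _ uT'))).
Qed.

Lemma unweighted_sum_le (T : seq (K -> R)) (f : (K -> R) -> R) :
  (forall v, v \in T -> V v) -> (forall v, v \in T -> 0 <= f v) ->
  \sum_(v <- T) f v <= n * \sum_(v <- T) w v * f v.
Proof.
move=> TV f0; rewrite mulr_sumr big_seq [leRHS]big_seq; apply: ler_sum => v vT.
rewrite mulrA ler_peMl ?f0 //; apply: le_trans (_ : n * n^-1 <= _).
  by rewrite divff ?gt_eqF.
by rewrite ler_pM2l //; apply: wge; apply: TV.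
Qed.

Let integral_at (v : K -> R) (P : K * K) := v P.1 <= 1 /\ v P.2 <= 1.

Let henon_integral v P : V v -> ultrametric v -> v b <= 1 -> integral_at v P ->
  integral_at v (henon d b P) /\ integral_at v (henon_inv d b P).
Proof.
move=> /Vabs av uv vb [P1 P2].
have vX x : v x <= 1 -> v (x ^+ d) <= 1.
  by move=> hx; rewrite (avX av) exprn_ile1 // (av_ge0 av).
have vD x y : v x <= 1 -> v y <= 1 -> v (x + y) <= 1.
  by move=> hx hy; apply: le_trans (uv _ _) _; rewrite ge_max hx.
by split; split=> //=; apply: (vD); rewrite ?(avN av) //; apply: vD; rewrite ?(avN av) ?vX.
Qed.

Let iter_integral v P k : V v -> ultrametric v -> v b <= 1 -> integral_at v P ->
  integral_at v (iter k (henon d b) P) /\ integral_at v (iter k (henon_inv d b) P).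
Proof.
move=> Vv uv vb hP; elim: k => [|k [h1 h2]] //=.
by split; [have [] := henon_integral Vv uv vb h1 | have [] := henon_integral Vv uv vb h2].
Qed.

Section LowHeight.
Variables (P : K * K) (T : seq (K -> R)).
Hypotheses (uT : uniq T) (TV : forall v, v \in T -> V v).
Hypothesis offT : forall v, V v -> v \notin T ->
  [/\ ultrametric v, v b <= 1, v P.1 <= 1 & v P.2 <= 1].

Let off_le1 v k : V v -> v \notin T ->
  integral_at v (iter k (henon d b) P) /\ integral_at v (iter k (henon_inv d b) P).
Proof. by move=> Vv /(offT Vv)[uv vb P1 P2]; apply: iter_integral. Qed.

Let ln2 : 0 <= ln (2 : R). Proof. by rewrite ln_ge0 // ler1n. Qed.

Let quasi2 v : V v -> quasi_ultrametric (expR (ln 2)) v.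
Proof. by move=> Vv; rewrite lnK ?posrE //; apply: quasi_ultrametric2; apply: Vabs. Qed.

Let growth_const := \sum_(v <- T) w v * (2 * ln 2 + logplus (v b)).

Let growth_const_ge0 : 0 <= growth_const.
Proof.
rewrite /growth_const big_seq; apply: sumr_ge0 => v vT.
have wv := place_weight_gt0 (TV vT).
by apply: mulr_ge0; [exact: ltW | apply: addr_ge0; rewrite ?logplus_ge0 // mulr_ge0].
Qed.

Let height_orbitE k (f : K * K -> K * K) :
  (forall v k, V v -> v \notin T -> integral_at v (iter k f P)) ->
  weil_height2 (iter k f P) = \sum_(v <- T) w v * logplus (Num.max (v (iter k f P).1) (v (iter k f P).2)).
Proof.
move=> h; apply: finite_place_sum => // v Vv vT.
by have [h1 h2] := h v k Vv vT; rewrite ge_max h1.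
Qed.

Let height_orbit_ge0 Q : 0 <= \sum_(v <- T) w v * logplus (Num.max (v Q.1) (v Q.2)).
Proof.
rewrite big_seq; apply: sumr_ge0 => v vT.
by rewrite mulr_ge0 ?logplus_ge0 // (ltW (place_weight_gt0 (TV vT))).
Qed.

Let height_cvg (f : K * K -> K * K) :
  (forall v k, V v -> v \notin T -> integral_at v (iter k f P)) ->
  (forall v Q, V v -> logplus (Num.max (v (f Q).1) (v (f Q).2))
     <= d%:R * logplus (Num.max (v Q.1) (v Q.2)) + (2 * ln 2 + logplus (v b))) ->
  cvgn (fun N => weil_height2 (iter N f P) / d%:R ^+ N).
Proof.
move=> hint hgrow; apply: (@scaled_sequence_cvg _ _ _ growth_const) => // [|N|N].
- by rewrite ler_nat.
- by rewrite height_orbitE.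
- rewrite !height_orbitE // /growth_const mulr_sumr -big_split /= big_seq [leRHS]big_seq.
  apply: ler_sum => v vT; rewrite mulrCA -mulrDr ler_pM2l ?(place_weight_gt0 (TV vT)) //.
  by apply: hgrow; apply: TV.
Qed.

Lemma canonical_heights_cvg :
  cvgn (fun N => weil_height2 (iter N (henon d b) P) / d%:R ^+ N) /\
  cvgn (fun N => weil_height2 (iter N (henon_inv d b) P) / d%:R ^+ N).
Proof.
have step v (x y z : K) : V v -> z = x + y ^+ d + b ->
    henon_step v (ln 2) d b x y z /\ henon_step v (ln 2) d b z y x.
  by move=> Vv; apply: henon_step_forward; [exact: Vabs | exact: ln2 | exact: quasi2].
split; apply: height_cvg => [v k Vv vT|v [x y] Vv].
- exact: (off_le1 k Vv vT).1.
- have := (step v x y (x + y ^+ d + b) Vv erefl).1.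
  exact: (henon_step_growth (Vabs Vv) ln2 d2 (logplus_ge0 _) (le_expR_logplus _)).
- exact: (off_le1 k Vv vT).2.
- have E : y = (y - x ^+ d - b) + x ^+ d + b by ring.
  have := (step v _ _ _ Vv E).2.
  move/(henon_step_growth (Vabs Vv) ln2 d2 (logplus_ge0 _) (le_expR_logplus _)).
  by rewrite /= [Num.max (v x) _]maxC [Num.max (v y) _]maxC.
Qed.

(** Local contribution, at level N, of an orbit with first coordinates y. *)
Definition end_size (y : nat -> K) (N : nat) (v : K -> R) : R :=
  logplus (Num.max (v (y 0%N)) (v (y 1%N))) / d%:R ^+ N
  + logplus (Num.max (v (y (N + N)%N)) (v (y (N + N).+1))) / d%:R ^+ N.

(** A small canonical height gives an orbit segment of length 2N, centred at P,
    the logarithmic sizes of whose ends add up to less than eps d^N. *)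
Lemma low_height_orbit (eps : R) (N0 : nat) :
  limn (fun N => weil_height2 (iter N (henon d b) P) / d%:R ^+ N)
    + limn (fun N => weil_height2 (iter N (henon_inv d b) P) / d%:R ^+ N) < eps ->
  exists N (y : nat -> K), [/\ (N0 <= N)%N,
    forall i, y i.+2 = y i + y i.+1 ^+ d + b,
    forall i, iter i (henon d b) P = (y (N + i)%N, y (N + i).+1),
    forall v k, V v -> v \notin T -> v (y k) <= 1
  & \sum_(v <- T) w v * end_size y N v < eps].
Proof.
have [cp cm] := canonical_heights_cvg.
move=> /(frequently_below_limit cp cm)/(_ N0)[N le_N lt_eps].
pose Q := iter N (henon_inv d b) P.
pose y k := (iter k (henon d b) Q).1.
have yE k : iter k (henon d b) Q = (y k, y k.+1).
  by rewrite /y /=; case: (iter k _ Q).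
have PE i : iter i (henon d b) P = iter (N + i) (henon d b) Q.
  rewrite addnC iterD; congr (iter i _ _); rewrite /Q.
  elim: N {le_N lt_eps Q y yE} => // N IH.
  by rewrite iterSr iterS henon_invK.
exists N, y; split=> //.
- by move=> i; rewrite PE yE.
- move=> v k Vv vT; have [uv vb _ _] := offT Vv vT.
  have [_ hQ] := off_le1 N Vv vT.
  by have [[]] := iter_integral k Vv uv vb hQ.
- move: lt_eps; rewrite !height_orbitE; first last.
  + by move=> v k Vv vT; have [] := off_le1 k Vv vT.
  + by move=> v k Vv vT; have [] := off_le1 k Vv vT.
  rewrite PE yE -/Q (_ : Q = (y 0%N, y 1%N)) /=; last by rewrite -yE.
  congr (_ < _); rewrite addrC !mulr_suml -big_split /=; apply: eq_bigr => v _.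
  by rewrite mulrDr !mulrA.
Qed.

End LowHeight.

End Heights.

(** At a place where b is large, finitely many colors describe the itinerary of
    an orbit piece, and orbit points with the same itinerary nearly coincide. *)
Lemma itinerary_contraction (R : realType) (K : fieldType) (v : K -> R) (a beta : R)
    (d L : nat) (b : K) (z : nat -> K) :
  absolute_value v -> 0 <= a -> quasi_ultrametric (expR a) v -> (2 <= d)%N ->
  expR (- (d%:R * a)) <= v d%:R -> 0 < beta -> 16 * (d%:R + 2) * a <= beta / d%:R ^+ 2 ->
  v b = expR beta -> (forall i, z i.+2 = z i + z i.+1 ^+ d + b) ->
  (forall i, (i < L.+4.+2)%N -> v (z i) <= expR (2 * a + beta / d%:R)) ->
  exists col : nat -> 'I_d.+1, forall i j, (i <= L)%N -> (j <= L)%N ->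
    (forall m : 'I_4, col (i + m)%N = col (j + m)%N) ->
    v (z i.+2 - z j.+2) <= expR (- (beta / 16)) /\ v (z i.+3 - z j.+3) <= expR (- (beta / 16)).
Proof.
move=> av a0 qv d2 vd beta0 hgam vb zE hz.
have d2R : 2 <= d%:R :> R by rewrite ler_nat.
have d0 : 0 < d%:R :> R by apply: lt_le_trans d2R.
pose gam := beta / d%:R ^+ 2.
have gam0 : 0 < gam by rewrite divr_gt0 // exprn_gt0.
have dgam : d%:R * gam = beta / d%:R by rewrite /gam; field; rewrite gt_eqF.
have ddgam : d%:R * (d%:R * gam) = beta by rewrite dgam mulrC divfK // gt_eqF.
have [c1 _ _ _] := contraction_exponents d2R a0 gam0 hgam.
rewrite -dgam in hz.
set rho := 2 * a + d%:R * gam in c1 hz; set eta := 4 * a + 3 / 2 * gam in c1.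
have szg : size ('X^d + b%:P) = d.+1 by rewrite size_XnaddC // ltnW.
have mg : 'X^d + b%:P \is monic by rewrite monicXnaddC // ltnW.
have [i|c cP] := @cluster_coloring _ _ v a av qv 'I_L.+4
    (fun i => z i.+1) _ d eta (a + rho) mg szg _ c1.
  rewrite hornerD hornerXn hornerC.
  have -> : z i.+1 ^+ d + b = z i.+2 - z i by rewrite zE; ring.
  have i4 := ltn_ord i.
  by apply: (quasi_leB av) => //; apply: hz; rewrite ?ltnS //; apply: leqW; apply: ltnW.
exists (fun i => c (inord i)) => i j iL jL same.
have lt4 k m : (k <= L)%N -> (m < 4)%N -> (k + m < L.+4)%N.
  by move=> kL m4; rewrite -addn4 -addnS; apply: leq_add.
have close m : (m < 4)%N -> v (z (i + m).+1 - z (j + m).+1) <= expR (a + eta).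
  move=> m4; have := cP _ _ (same (Ordinal m4)).
  by rewrite /= !inordK // lt4.
have hzi k m : (k <= L)%N -> (m < 4)%N -> v (z (k + m).+1) <= expR rho.
  by move=> kL m4; apply: hz; rewrite ltnS; apply: leqW; apply: lt4.
have succ4 m : (m <= 2)%N -> (m.+1 < 4)%N by [].
have lt24 m : (m <= 2)%N -> (m < 4)%N by move=> m2; apply: leqW.
rewrite -ddgam; split.
- have := @close_points_contract _ _ v a av a0 qv d b gam (fun m => z (i + m).+1)
    (fun m => z (j + m).+1) d2 vd gam0 hgam; rewrite ddgam !addn0 !addn1 !addn2; apply=> // m m2.
  + by apply: hzi => //; apply: lt24.
  + by apply: hzi => //; apply: lt24.
  + by apply: close; apply: lt24.
- have := @close_points_contract _ _ v a av a0 qv d b gam (fun m => z (i + m.+1).+1)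
    (fun m => z (j + m.+1).+1) d2 vd gam0 hgam.
  rewrite ddgam !addn1 !addn2 !addn3; apply=> // m m2.
  + by apply: hzi.
  + by apply: hzi.
  + by apply: close.
Qed.

Lemma contraction_total (R : realType) (n s W th h a Sb X : R) :
  1 <= n -> 0 <= s -> 1 <= W -> th = (64 * W * (s + 1) * (n + 1))^-1 ->
  192 * W * n * s * a <= h -> 0 < h -> h <= W * Sb -> X <= h / (64 * W) ->
  s * (n * (3 * a + th * h)) + (s * (th * h) - Sb) / 16 + X < 0.
Proof.
move=> n1 s0 W1 thE ha h0 hSb hX.
have W0 : 0 < W by lra.
have sn0 : 0 < 64 * W * (s + 1) * (n + 1) by rewrite !mulr_gt0 //; lra.
pose u := h / W; have hE : h = u * W by rewrite /u divfK // gt_eqF.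
have u0 : 0 < u by rewrite divr_gt0.
have hSb' : u <= Sb by rewrite ler_pdivrMr // mulrC.
have hX' : X <= u / 64.
  by move: hX; rewrite (_ : h / (64 * W) = u / 64) // /u; field; rewrite gt_eqF.
have ha' : 192 * n * s * a <= u.
  rewrite -(ler_pM2r W0) -hE; apply: le_trans ha; rewrite le_eqVlt; apply/orP; left.
  by apply/eqP; ring.
pose q := th * h.
have q0 : 0 <= q by rewrite mulr_ge0 ?(ltW h0) // thE invr_ge0 ltW.
have qE : q * ((s + 1) * (n + 1)) = u / 64.
  rewrite /q thE /u; field; rewrite !gt_eqF //; lra.
rewrite -/q.
have e1 : s * (n * (3 * a + q)) + s * q <= u / 64 + q * ((s + 1) * (n + 1)).
  rewrite -subr_ge0; have -> : u / 64 + q * ((s + 1) * (n + 1)) - (s * (n * (3 * a + q)) + s * q)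
     = (u - 192 * n * s * a) / 64 + q * (n + 1) by field.
  have nn : 0 <= n + 1 by lra.
  by apply: addr_ge0; [rewrite divr_ge0 // subr_ge0 | apply: mulr_ge0].
have sq0 : 0 <= s * q by rewrite mulr_ge0.
move: e1 sq0 hX' hSb' u0; rewrite qE.
move: (s * (n * (3 * a + q))) (s * q) => A B e1 B0 hX2 hS2 u0; clear -e1 B0 hX2 hS2 u0; lra.
Qed.

Lemma large_place_exponent (R : realType) (n c beta q q' X : R) :
  1 <= n -> 1 <= c -> 0 <= beta -> 0 <= q' -> 0 <= q -> 0 <= X ->
  c * - (beta / 16) <= n * q' + (q - beta) / 16 + n * X.
Proof.
move=> n1 c1 b0 q0 q0' X0.
have h1 : 0 <= n * q' by rewrite mulr_ge0 // (le_trans ler01).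
have h2 : 0 <= n * X by rewrite mulr_ge0 // (le_trans ler01).
have h3 : beta / 16 <= c * (beta / 16) by rewrite ler_peMl // divr_ge0.
by rewrite mulrN; lra.
Qed.

Lemma small_place_exponent (R : realType) (n c a beta q X : R) :
  0 <= c -> c <= n -> 0 <= a -> 0 <= beta -> beta <= q -> 0 <= X ->
  c * (3 * a + beta + X) <= n * (3 * a + q) + (q - beta) / 16 + n * X.
Proof.
move=> c0 cn a0 b0 bq X0.
have h : c * (3 * a + beta + X) <= n * (3 * a + q + X).
  by apply: ler_pM => //; lra.
by apply: le_trans h _; rewrite [X in X <= _]mulrDr; lra.
Qed.

(** * The height gap over an abstract system of places *)

Lemma joint_coloring (R : realType) (K : fieldType) (l : seq (K -> R)) (r eps : R) :
  0 < eps -> (forall v, v \in l -> bounded_coloring v) ->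
  exists (T : finType) (col : K -> T), forall v, v \in l -> forall x y,
    v x <= r -> v y <= r -> col x = col y -> v (x - y) <= eps.
Proof.
move=> eps0; elim: l => [|v l IH] hl.
  by exists unit, (fun=> tt).
have [|T [col colP]] := IH; first by move=> u ul; apply: hl; rewrite inE ul orbT.
have [|T' [col' colP']] := hl v _ r eps eps0; first by rewrite inE eqxx.
exists (T * T')%type, (fun x => (col x, col' x)) => u.
rewrite inE => /orP[/eqP->|ul] x y hx hy [e e']; first exact: colP'.
exact: (colP u ul).
Qed.

Lemma pigeonhole (T : finType) (f : nat -> T) :
  exists i j, [/\ (i < j)%N, (j <= #|T|)%N & f i = f j].
Proof.
apply: contrapT => h; have inj : injective (fun i : 'I_#|T|.+1 => f i).
  move=> i j fij; apply: val_inj; apply/eqP; rewrite eqn_leq; apply: contrapT => /negP.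
  rewrite negb_and -!ltnNge => /orP[ij|ij]; apply: h.
    by exists (j : nat), (i : nat); split; rewrite // -ltnS.
  by exists (i : nat), (j : nat); split; rewrite // -ltnS.
by have := leq_card _ inj; rewrite card_ord ltnn.
Qed.

Lemma periodic_of_repeat (K : fieldType) (d : nat) (b : K) (P : K * K) (B i j : nat) :
  (i < j)%N -> (j <= i + B)%N -> iter i (henon d b) P = iter j (henon d b) P ->
  periodic_at_most d b B P.
Proof.
move=> ij jB E; exists (j - i)%N; split; [by rewrite subn_gt0 | by rewrite leq_subLR | ].
have inj : injective (iter i (henon d b)).
  by elim: (i) => [|m IH] x y //= /(can_inj (henonK d b))/IH.
by apply: inj; rewrite -iterD subnKC // ltnW.
Qed.

Lemma mem_list (T : eqType) (A : set T) (l : seq T) : A = [set` l] -> forall x, x \in l <-> A x.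
Proof. by move=> ->. Qed.

(** V and w stand for the places of a global field K of degree n and their
    weights, and Ar for the archimedean places. *)
Section HeightGap.
Variables (R : realType) (K : fieldType) (V Ar : set (K -> R)) (w : (K -> R) -> R) (n : R).
Hypothesis Vabs : forall v, V v -> absolute_value v.
Hypothesis Vult : forall v, V v -> ~ Ar v -> ultrametric v.
Hypothesis ArV : Ar `<=` V.
Hypotheses (n1 : 1 <= n) (wge : forall v, V v -> n^-1 <= w v).
Hypothesis poles : forall x, finite_set [set v | V v /\ 1 < v x].
Hypothesis product_formula : forall x (T : seq (K -> R)), x != 0 -> uniq T ->
  (forall v, v \in T -> V v) -> (forall v, V v -> v \notin T -> v x <= 1) ->
  exists c : (K -> R) -> R, (forall v, v \in T -> 1 <= c v <= n) /\
    0 <= \sum_(v <- T) c v * ln (v x).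
Variable d : nat.
Hypothesis d2 : (2 <= d)%N.

Let n0 : 0 < n. Proof. by apply: lt_le_trans n1. Qed.

Definition henon_height (b : K) (P : K * K) : R :=
  limn (fun N => weil_height2 V w (iter N (henon d b) P) / d%:R ^+ N)
  + limn (fun N => weil_height2 V w (iter N (henon_inv d b) P) / d%:R ^+ N).

Lemma finite_support_exists (S0 : seq (K -> R)) (b : K) (P : K * K) :
  (forall v, v \in S0 -> V v) -> (forall v, Ar v -> v \in S0) ->
  exists T : seq (K -> R), [/\ uniq T, forall v, v \in T -> V v, {subset S0 <= T}
    & forall v, V v -> v \notin T -> [/\ ultrametric v, v b <= 1, v P.1 <= 1 & v P.2 <= 1]].
Proof.
move=> SV ArS.
have [lb lbE] := iffLR (finite_seqP _) (poles b).
have [l1 l1E] := iffLR (finite_seqP _) (poles P.1).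
have [l2 l2E] := iffLR (finite_seqP _) (poles P.2).
exists (undup (S0 ++ lb ++ l1 ++ l2)); split.
- exact: undup_uniq.
- move=> v; rewrite mem_undup !mem_cat.
  by move=> /or4P[/SV//|/(mem_list lbE)[]//|/(mem_list l1E)[]//|/(mem_list l2E)[]//].
- by move=> v vS; rewrite mem_undup mem_cat vS.
- move=> v Vv; rewrite mem_undup !mem_cat !negb_or.
  have le1 x (l : seq (K -> R)) : [set v | V v /\ 1 < v x] = [set` l] -> v \notin l -> v x <= 1.
    by move=> lE vl; rewrite leNgt; apply/negP => vx; case/negP: vl; exact/(mem_list lE).
  move=> /and4P[vS /(le1 _ _ lbE) ? /(le1 _ _ l1E) ? /(le1 _ _ l2E) ?]; split=> //.
  by apply: Vult => // /ArS; apply/negP.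
Qed.

(** An element that is small at enough places to have negative total logarithm
    is zero. As the multiplicities c v are only known to lie between 1 and n,
    gam v bounds c * kappa v for all of them. *)
Lemma product_formula_vanishing (x : K) (T : seq (K -> R)) (kappa gam : (K -> R) -> R) :
  uniq T -> (forall v, v \in T -> V v) -> (forall v, V v -> v \notin T -> v x <= 1) ->
  (forall v, v \in T -> v x <= expR (kappa v)) ->
  (forall v c, v \in T -> 1 <= c -> c <= n -> c * kappa v <= gam v) ->
  \sum_(v <- T) gam v < 0 -> x = 0.
Proof.
move=> uT TV offT hk hg neg; apply/eqP; apply: contraTT neg => x0; rewrite -leNgt.
have [c [hc pos]] := product_formula x0 uT TV offT; apply: le_trans pos _.
rewrite big_seq [leRHS]big_seq; apply: ler_sum => v vT.
have /andP[c1 cn] := hc v vT; apply: le_trans (hg v (c v) vT c1 cn).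
rewrite ler_pM2l ?(lt_le_trans _ c1) //.
have vx : 0 < v x by apply: av_gt0 => //; apply: Vabs; apply: TV.
by rewrite -[leRHS]expRK ler_ln ?posrE ?expR_gt0 // hk.
Qed.

Section Level.
Variables (b : K) (T : seq (K -> R)) (y : nat -> K) (N E : nat) (e : R).
Hypotheses (uT : uniq T) (TV : forall v, v \in T -> V v).
Hypothesis yE : forall i, y i.+2 = y i + y i.+1 ^+ d + b.
Hypothesis EN : (E <= N)%N.
Hypothesis ends : \sum_(v <- T) w v * end_size d y N v < e.

Lemma end_size_ge0 (v : K -> R) : 0 <= end_size d y N v.
Proof. by rewrite addr_ge0 // divr_ge0 ?logplus_ge0 // exprn_ge0. Qed.

Lemma end_size_lt (v : K -> R) : v \in T -> end_size d y N v < n * e.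
Proof.
move=> vT; apply: (@le_lt_trans _ _ (n * \sum_(v <- T) w v * end_size d y N v)); last by rewrite ltr_pM2l.
by apply: (weighted_term_le n1 (@wge) (@TV) uT) => // u _; apply: end_size_ge0.
Qed.

Lemma end_size_sum_lt : \sum_(v <- T) end_size d y N v < n * e.
Proof.
apply: (@le_lt_trans _ _ (n * \sum_(v <- T) w v * end_size d y N v)); last by rewrite ltr_pM2l.
by apply: (unweighted_sum_le n1 (@wge) (@TV)) => u _; apply: end_size_ge0.
Qed.

(** The E points of the orbit that follow P are bounded in terms of b and of the
    ends of the segment. *)
Lemma window_bound (v : K -> R) a k : V v -> 0 <= a -> quasi_ultrametric (expR a) v ->
  (N <= k)%N -> (k < N + E)%N ->
  v (y k) <= expR (2 * a + Num.max (logplus (v b) / d%:R) (d%:R ^+ E * end_size d y N v)).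
Proof.
move=> Vv a0 qv le_Nk lt_kE; apply: le_trans (le_expR_logplus _) _; rewrite ler_expR.
apply: (orbit_point_bound (Vabs Vv) a0 d2 qv (logplus_ge0 _) (le_expR_logplus _) yE le_Nk _ lt_kE).
by apply: leq_trans lt_kE _; rewrite leq_add2l.
Qed.

Lemma max_le_sum (v : K -> R) : Num.max (logplus (v b) / d%:R) (d%:R ^+ E * end_size d y N v)
  <= logplus (v b) + d%:R ^+ E * end_size d y N v.
Proof.
have X0 : 0 <= d%:R ^+ E * end_size d y N v by rewrite mulr_ge0 ?end_size_ge0 // exprn_ge0.
have d1 : 1 <= d%:R :> R by rewrite ler1n ltnW.
rewrite ge_max; apply/andP; split; last by rewrite lerDr logplus_ge0.
apply: (@le_trans _ _ (logplus (v b))); last by rewrite lerDl.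
by rewrite ler_pdivrMr ?(lt_le_trans _ d1) // ler_peMr ?logplus_ge0.
Qed.

End Level.

Lemma orbit_difference_off (T : seq (K -> R)) (y : nat -> K) (i j : nat) (v : K -> R) :
  (forall v k, V v -> v \notin T -> v (y k) <= 1) ->
  (forall v, V v -> v \notin T -> ultrametric v) ->
  V v -> v \notin T -> v (y i - y j) <= 1.
Proof.
move=> h u Vv vT; apply: le_trans (u v Vv vT _ _) _.
by rewrite (avN (Vabs Vv)) ge_max !h.
Qed.

Lemma weil_heightE (b : K) (T : seq (K -> R)) : uniq T -> (forall v, v \in T -> V v) ->
  (forall v, V v -> v \notin T -> v b <= 1) ->
  weil_height V w b = \sum_(v <- T) w v * logplus (v b).
Proof. by move=> uT TV h; apply: finite_place_sum. Qed.

(** When b has bounded height, the points that follow P are bounded at every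
    place, and by the pigeonhole principle two of them are so close together at
    all archimedean places that the product formula makes them equal. *)
Lemma archimedean_gap (C0 : R) : 0 <= C0 -> (exists v, Ar v) -> finite_set Ar ->
  (forall v, Ar v -> bounded_coloring v) ->
  exists2 eps : R, 0 < eps & exists2 B : nat, (0 < B)%N &
    forall b P, weil_height V w b <= C0 -> ~ periodic_at_most d b B P ->
      eps <= henon_height b P.
Proof.
move=> C00 [v0 Av0] finA colA.
have [S0 S0E] := iffLR (finite_seqP _) finA.
have memS := mem_list S0E.
pose Z := n * n * (C0 + 1) + 1.
have Z0 : 0 < Z by rewrite ltr_pwDr // !mulr_ge0 ?(ltW n0) // addr_ge0.
pose rho := 2 * ln 2 + (n * C0 + 1) : R.
have [|T0 [col colP]] := @joint_coloring R K S0 (expR rho) (expR (- Z)) (expR_gt0 _).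
  by move=> v /memS; apply: colA.
pose L := #|{: T0 * T0}|; pose E := L.+2.
have dE0 : 0 < d%:R ^+ E :> R by rewrite exprn_gt0 // ltr0n ltnW.
pose eps := (n * d%:R ^+ E)^-1.
have eps0 : 0 < eps by rewrite invr_gt0 mulr_gt0.
have epsE : d%:R ^+ E * (n * eps) = 1 by rewrite /eps; field; rewrite !gt_eqF.
exists eps => //; exists L.+1 => // b P hb nper.
rewrite leNgt; apply/negP => low; apply: nper.
have [|v /memS//|T [uT TV ST offT]] := @finite_support_exists S0 b P.
  by move=> v /memS/ArV.
have [N [y [EN yE PE off1 ends]]] := low_height_orbit Vabs n1 wge d2 uT TV offT E low.
have offTu v : V v -> v \notin T -> ultrametric v by move=> Vv /(offT v Vv)[].
have htE : weil_height V w b = \sum_(v <- T) w v * logplus (v b).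
  by apply: weil_heightE => // v Vv /(offT v Vv)[].
have ends' := end_size_lt uT TV ends.
have betaC (v : K -> R) : v \in T -> logplus (v b) <= n * C0.
  move=> vT; apply: (@le_trans _ _ (n * weil_height V w b)); last by rewrite ler_pM2l.
  by rewrite htE; apply: (weighted_term_le n1 wge TV uT) => // u _; apply: logplus_ge0.
pose X (v : K -> R) := logplus (v b) + d%:R ^+ E * end_size d y N v.
have XC (v : K -> R) : v \in T -> X v <= n * C0 + 1.
  move=> vT; apply: lerD; first exact: betaC.
  by rewrite -[leRHS]epsE ler_pM2l // ltW // ends'.
have ln20 : 0 <= ln (2 : R) by rewrite ln_ge0 // ler1n.
have vanish k k' : (N <= k)%N -> (k < N + E)%N -> (N <= k')%N -> (k' < N + E)%N ->
    col (y k) = col (y k') -> y k = y k'.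
  move=> k1 k2 k1' k2' ck; apply/eqP; rewrite -subr_eq0; apply/eqP.
  apply: (@product_formula_vanishing _ T (fun v => if v \in S0 then - Z else X v)
     (fun v => (if v == v0 then - Z else 0) + n * X v) uT TV).
  - by move=> v Vv vT; exact: (orbit_difference_off _ _ off1 offTu).
  - move=> v vT; have Vv := TV v vT; case: ifP => [vS|/negP vS].
      have qv : quasi_ultrametric (expR (ln 2)) v.
        by rewrite lnK ?posrE //; apply: quasi_ultrametric2; apply: Vabs.
      have bnd m : (N <= m)%N -> (m < N + E)%N -> v (y m) <= expR rho.
        move=> m1 m2; apply: le_trans (window_bound yE EN Vv ln20 qv m1 m2) _.
        by rewrite ler_expR lerD2l; apply: le_trans (max_le_sum _ _ _ _ _) (XC v vT).
      by apply: (colP v vS) => //; apply: bnd.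
    have uv : ultrametric v by apply: Vult => // /memS.
    have qv : quasi_ultrametric (expR 0) v by rewrite expR0; apply: quasi_ultrametric1.
    have bnd m : (N <= m)%N -> (m < N + E)%N -> v (y m) <= expR (X v).
      move=> m1 m2; apply: le_trans (window_bound yE EN Vv (lexx 0) qv m1 m2) _.
      by rewrite ler_expR mulr0 add0r; apply: max_le_sum.
    by apply: le_trans (uv _ _) _; rewrite (avN (Vabs Vv)) ge_max !bnd.
  - move=> v c vT c1 cn.
    have X0 : 0 <= X v.
      by rewrite addr_ge0 ?logplus_ge0 // mulr_ge0 ?(ltW dE0) // end_size_ge0.
    have c0 : 0 <= c by apply: le_trans c1.
    have nX : 0 <= n * X v by rewrite mulr_ge0 // ltW.
    case: ifP => [vS|vS].
      have cZ : c * - Z <= - Z by rewrite mulrN lerN2 ler_peMl // ltW.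
      have cZ0 : c * - Z <= 0 by rewrite mulr_ge0_le0 // oppr_le0 ltW.
      by case: ifP => _; [apply: (le_trans cZ); rewrite lerDl | apply: (le_trans cZ0); rewrite add0r].
    have -> : (v == v0) = false.
      by apply/eqP => vv0; move: Av0; rewrite -vv0 => /memS; rewrite vS.
    by rewrite add0r ler_wpM2r.
  - rewrite big_split /= -mulr_sumr.
    have v0T : v0 \in T by apply: ST; apply/memS.
    rewrite (bigD1_seq v0) //= eqxx big1 ?addr0; last by move=> v /negbTE ->.
    have hX : \sum_(v <- T) X v <= n * (C0 + 1).
      rewrite big_split /= -mulr_sumr mulrDr mulr1; apply: lerD.
        apply: (@le_trans _ _ (n * weil_height V w b)); last by rewrite ler_pM2l.
        by rewrite htE; apply: (unweighted_sum_le n1 wge TV) => v _; apply: logplus_ge0.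
      apply: (@le_trans _ _ 1); last exact: n1.
      by rewrite -[leRHS]epsE ler_pM2l // ltW // (end_size_sum_lt TV ends).
    have : n * \sum_(v <- T) X v <= n * (n * (C0 + 1)) by rewrite ler_pM2l.
    by rewrite /Z mulrA; lra.
have [i [j [ij jL [e1 e2]]]] := @pigeonhole _ (fun i => (col (y (N + i)%N), col (y (N + i).+1))).
have iL : (i <= L)%N by apply: leq_trans jL; apply: ltnW.
apply: (@periodic_of_repeat _ _ _ _ _ i j) => //.
  by apply: leq_trans jL _; rewrite addnC leqW // leq_addr.
have inW m : (m <= L.+1)%N -> (N <= N + m)%N /\ (N + m < N + E)%N.
  by move=> hm; rewrite leq_addr ltn_add2l ltnS.
have [[i1 i2] [i3 i4]] := (inW i (leqW iL), inW i.+1 iL).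
have [[j1 j2] [j3 j4]] := (inW j (leqW jL), inW j.+1 jL).
rewrite addnS in i3 i4 e2; rewrite addnS in j3 j4 e2.
by rewrite !PE; congr (_, _); apply: vanish.
Qed.


Lemma sum_over_subset (T S0 : seq (K -> R)) (f : (K -> R) -> R) : uniq T -> uniq S0 ->
  {subset S0 <= T} -> \sum_(v <- T) (if v \in S0 then f v else 0) = \sum_(v <- S0) f v.
Proof.
move=> uT uS ST; rewrite -big_mkcond -big_filter; apply: perm_big.
apply: uniq_perm => //; first exact: filter_uniq.
by move=> v; rewrite mem_filter; case: (boolP (v \in S0)) => // /ST.
Qed.

(** Two of the points that follow P have the same itinerary at all places where
    log |b| exceeds th * h(b). There their distance is at most |b|^(-1/16), and
    elsewhere log |b| is too small to compensate, as these places of S0 account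
    for a small part of h(b); the product formula makes the points equal. The
    constant C absorbs the loss a in the triangle inequality. *)
Lemma contraction_gap (S0 : seq (K -> R)) (a : R) :
  uniq S0 -> (forall v, v \in S0 -> V v) -> (forall v, Ar v -> v \in S0) -> 0 <= a ->
  (forall v, v \in S0 -> quasi_ultrametric (expR a) v) ->
  (forall v, v \in S0 -> expR (- (d%:R * a)) <= v d%:R) ->
  exists2 eps : R, 0 < eps & exists2 C : R, 0 <= C & exists2 B : nat, (0 < B)%N &
    forall b P, (forall v, V v -> v \notin S0 -> v b <= 1) -> 0 < weil_height V w b ->
      C * a <= weil_height V w b -> ~ periodic_at_most d b B P ->
      eps * weil_height V w b <= henon_height b P.
Proof.
move=> uS SV ArS a0 qS vdS.
pose s : R := (size S0)%:R; pose W := 1 + \sum_(v <- S0) w v.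
have w0 v : V v -> 0 <= w v by move=> Vv; apply: ltW; apply: (place_weight_gt0 n1 wge).
have wS0 : 0 <= \sum_(v <- S0) w v by rewrite big_seq; apply: sumr_ge0 => v /SV/w0.
have W1 : 1 <= W by rewrite lerDl.
have wW (v : K -> R) : v \in S0 -> w v <= W.
  move=> vS; rewrite /W (bigD1_seq v vS uS) /= addrCA lerDl addr_ge0 // big_seq_cond.
  by apply: sumr_ge0 => u /andP[/SV/w0].
have W0 : 0 < W by apply: lt_le_trans W1.
have s0 : 0 <= s by apply: ler0n.
pose th : R := (64 * W * (s + 1) * (n + 1))^-1.
have th0 : 0 < th.
  by rewrite invr_gt0 mulr_gt0 ?addr_gt0 // mulr_gt0 ?mulr_gt0 // ltr_wpDl.
pose L := #|{: {ffun 'I_(size S0) * 'I_4 -> 'I_d.+1}}|; pose E := L.+4.+2.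
have d0 : 0 < d%:R :> R by rewrite ltr0n ltnW.
have dE0 : 0 < d%:R ^+ E :> R by rewrite exprn_gt0.
pose eps := Num.min (th / d%:R / (n * d%:R ^+ E)) (64 * W * (n * (n * d%:R ^+ E)))^-1.
have nd0 : 0 < n * d%:R ^+ E by rewrite mulr_gt0.
have Wn0 : 0 < 64 * W * (n * (n * d%:R ^+ E)).
  by rewrite mulr_gt0 // mulr_gt0.
have eps0 : 0 < eps by rewrite lt_min divr_gt0 ?divr_gt0 // invr_gt0.
have epsth : n * d%:R ^+ E * eps <= th / d%:R.
  by rewrite mulrC -ler_pdivlMr // ge_min lexx.
have epsW : n * (n * d%:R ^+ E) * eps <= (64 * W)^-1.
  have X0 : 0 < n * (n * d%:R ^+ E) by apply: mulr_gt0.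
  apply: (@le_trans _ _ (n * (n * d%:R ^+ E) * (64 * W * (n * (n * d%:R ^+ E)))^-1)).
    by rewrite ler_pM2l // ge_min lexx orbT.
  by rewrite [(64 * W * _)^-1]invfM mulrCA divff ?mulr1 // gt_eqF.
pose C0 := 16 * (d%:R + 2) * d%:R ^+ 2 / th + 192 * W * n * s.
have C10 : 0 <= 16 * (d%:R + 2) * d%:R ^+ 2 / th.
  by rewrite divr_ge0 ?(ltW th0) // mulr_ge0 ?exprn_ge0 // mulr_ge0 // addr_ge0.
have C20 : 0 <= 192 * W * n * s.
  exact: mulr_ge0 (mulr_ge0 (mulr_ge0 (ler0n _ 192) (ltW W0)) (ltW n0)) s0.
exists eps => //; exists C0; first exact: addr_ge0.
exists L.+1 => // b P bS h0 ha nper; rewrite leNgt; apply/negP => low; apply: nper.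
set h := weil_height V w b in h0 ha low.
have ha1 : 16 * (d%:R + 2) * a <= th * h / d%:R ^+ 2.
  rewrite ler_pdivlMr ?exprn_gt0 // -ler_pdivrMl //; apply: le_trans ha.
  rewrite (_ : th^-1 * _ = 16 * (d%:R + 2) * d%:R ^+ 2 / th * a); last by ring.
  by rewrite ler_wpM2r // lerDl.
have ha2 : 192 * W * n * s * a <= h.
  by apply: le_trans ha; rewrite ler_wpM2r // lerDr.
have [T [uT TV ST offT]] := @finite_support_exists S0 b P SV ArS.
have [N [y [EN yE PE off1 ends]]] := low_height_orbit Vabs n1 wge d2 uT TV offT E low.
have offTu v : V v -> v \notin T -> ultrametric v by move=> Vv /(offT v Vv)[].
have htE : h = \sum_(v <- S0) w v * logplus (v b) by apply: weil_heightE.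
pose beta (v : K -> R) := logplus (v b).
pose G (v : K -> R) := end_size d y N v.
have G0 v : 0 <= G v by apply: end_size_ge0.
have beta0 v : 0 <= beta v by apply: logplus_ge0.
have hW : h <= W * \sum_(v <- S0) beta v.
  rewrite htE mulr_sumr big_seq [leRHS]big_seq; apply: ler_sum => v vS.
  by rewrite ler_wpM2r ?logplus_ge0 // wW.
have GT v : v \in T -> d%:R ^+ E * G v <= th * h / d%:R.
  move=> vT; apply: (@le_trans _ _ (d%:R ^+ E * (n * (eps * h)))).
    by rewrite ler_pM2l // ltW // (end_size_lt uT TV ends).
  have regroup (x t u r : R) : x * (t * (u * r)) = t * x * u * r by ring.
  rewrite regroup.
  by rewrite [leRHS]mulrAC ler_pM2r.
have sumG : n * (d%:R ^+ E * \sum_(v <- T) G v) <= h / (64 * W).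
  apply: (@le_trans _ _ (n * (d%:R ^+ E * (n * (eps * h))))).
    by rewrite !ler_pM2l // ltW // (end_size_sum_lt TV ends).
  have regroup (x t u r : R) : t * (x * (t * (u * r))) = t * (t * x) * u * r by ring.
  rewrite regroup.
  by rewrite [leRHS]mulrC ler_pM2r.
pose z i := y (N + i)%N.
have zE i : z i.+2 = z i + z i.+1 ^+ d + b by rewrite /z !addnS yE.
have zB v a' i : V v -> 0 <= a' -> quasi_ultrametric (expR a') v -> (i < E)%N ->
    v (z i) <= expR (2 * a' + Num.max (beta v / d%:R) (d%:R ^+ E * G v)).
  by move=> Vv a'0 qv iE; apply: (window_bound yE EN Vv a'0 qv); rewrite ?leq_addr // ltn_add2l.
(* Itineraries are recorded only at the places where b is large. *)
have /choice[col colP] : forall p : 'I_(size S0), exists c : nat -> 'I_d.+1,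
    let v := tnth (in_tuple S0) p in th * h < beta v ->
    forall i j, (i <= L)%N -> (j <= L)%N -> (forall m : 'I_4, c (i + m)%N = c (j + m)%N) ->
    v (z i.+2 - z j.+2) <= expR (- (beta v / 16)) /\ v (z i.+3 - z j.+3) <= expR (- (beta v / 16)).
  move=> p /=; set v := tnth _ p; have vS : v \in S0 by apply: mem_tnth.
  have [big|_] := ltP (th * h) (beta v); last by exists (fun=> ord0).
  have b0 : 0 < beta v by apply: lt_trans big; rewrite mulr_gt0.
  have vT := ST v vS; have Vv := SV v vS.
  have [||||c cP] := @itinerary_contraction R K v a (beta v) d L b z (Vabs Vv) a0 (qS v vS) d2
    (vdS v vS) b0.
  - by apply: le_trans ha1 _; rewrite ler_pM2r ?invr_gt0 ?exprn_gt0 // ltW.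
  - by have [_] := logplus_gt0 b0.
  - exact: zE.
  - move=> i iL; apply: le_trans (zB v a i Vv a0 (qS v vS) iL) _.
    rewrite ler_expR lerD2l ge_max lexx /=; apply: le_trans (GT v vT) _.
    by rewrite ler_pM2r ?invr_gt0 // ltW.
  - by exists c.
have [i [j [ij jL eqc]]] := @pigeonhole _
  (fun i => [ffun p : 'I_(size S0) * 'I_4 => col p.1 (i + p.2)%N]).
have iL : (i <= L)%N by apply: leq_trans jL; apply: ltnW.
have same p (m : 'I_4) : col p (i + m)%N = col p (j + m)%N.
  by move: eqc => /ffunP/(_ (p, m)); rewrite !ffunE.
have small v : v \in S0 -> th * h < beta v ->
    v (z i.+2 - z j.+2) <= expR (- (beta v / 16)) /\ v (z i.+3 - z j.+3) <= expR (- (beta v / 16)).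
  move=> vS big; have /tnthP[p vE] : v \in in_tuple S0 by [].
  by have := colP p; rewrite /= -vE => /(_ big i j iL jL (same p)).
pose kap v := if v \in S0 then if th * h < beta v then - (beta v / 16)
  else 3 * a + beta v + d%:R ^+ E * G v else d%:R ^+ E * G v.
have vanish k k' : (k < E)%N -> (k' < E)%N ->
    (forall v, v \in S0 -> th * h < beta v -> v (z k - z k') <= expR (- (beta v / 16))) ->
    z k = z k'.
  move=> kE kE' near; apply/eqP; rewrite -subr_eq0; apply/eqP.
  apply: (@product_formula_vanishing _ T kap
    (fun v => (if v \in S0 then n * (3 * a + th * h) + (th * h - beta v) / 16 else 0)
      + n * (d%:R ^+ E * G v)) uT TV).
  - by move=> v Vv vT; exact: (orbit_difference_off _ _ off1 offTu).
  - move=> v vT; have Vv := TV v vT; rewrite /kap; case: ifP => [vS|/negP vS].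
      case: ifP => [|_]; first exact: near.
      have bnd m : (m < E)%N -> v (z m) <= expR (2 * a + (beta v + d%:R ^+ E * G v)).
        move=> mE; apply: le_trans (zB v a m Vv a0 (qS v vS) mE) _.
        by rewrite ler_expR lerD2l max_le_sum.
      have regroup (t u : R) : 3 * a + t + u = a + (2 * a + (t + u)) by ring.
      rewrite regroup.
      by apply: (quasi_leB (Vabs Vv) (qS v vS)); apply: bnd.
    have uv : ultrametric v by apply: Vult => // /ArS.
    have vb0 : beta v = 0 by apply: logplus_eq0; apply: bS => //; apply/negP.
    have qv : quasi_ultrametric (expR 0) v by rewrite expR0; apply: quasi_ultrametric1.
    have bnd m : (m < E)%N -> v (z m) <= expR (d%:R ^+ E * G v).
      move=> mE; apply: le_trans (zB v 0 m Vv (lexx 0) qv mE) _.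
      by rewrite ler_expR mulr0 add0r vb0 mul0r ge_max lexx mulr_ge0 ?(ltW dE0).
    by apply: le_trans (uv _ _) _; rewrite (avN (Vabs Vv)) ge_max !bnd.
  - move=> v c vT c1 cn; have c0 : 0 <= c by apply: le_trans c1.
    have X0 : 0 <= d%:R ^+ E * G v by rewrite mulr_ge0 ?(ltW dE0).
    have nX : c * (d%:R ^+ E * G v) <= n * (d%:R ^+ E * G v) by rewrite ler_wpM2r.
    rewrite /kap; case: ifP => [vS|vS]; last by rewrite add0r.
    have q0 : 0 <= 3 * a + th * h by rewrite addr_ge0 ?mulr_ge0 ?(ltW h0) ?(ltW th0).
    case: ltP => big.
      by apply: (large_place_exponent n1 c1 (beta0 v) q0 (mulr_ge0 (ltW th0) (ltW h0)) X0).
    exact: small_place_exponent.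
  - rewrite big_split /= sum_over_subset // -!mulr_sumr big_split /= big_const_seq count_predT iter_addr_0.
    apply: le_lt_trans (contraction_total n1 s0 W1 erefl ha2 h0 hW sumG).
    rewrite lerD2r /s !(mulr_natl _ (size S0)) lerD2l -mulr_suml sumrB.
    by rewrite big_const_seq count_predT iter_addr_0.
have lt1 k : (k <= L)%N -> (k.+3 < E)%N by move=> kL; rewrite /E !ltnS; do 2 apply: leqW.
have lt2 k : (k <= L)%N -> (k.+2 < E)%N by move=> kL; rewrite /E !ltnS; do 3 apply: leqW.
apply: (@periodic_of_repeat _ _ _ _ _ i.+2 j.+2) => //.
  by rewrite addnS; apply: leqW; rewrite !addSn !ltnS; apply: leq_trans jL _; rewrite leq_addl.
rewrite !PE -!addnS; congr (_, _); apply: vanish; rewrite ?lt1 ?lt2 //.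
- by move=> v vS big; have [] := small v vS big.
- by move=> v vS big; have [] := small v vS big.
Qed.

End HeightGap.

(** * The height gap over global fields *)

Lemma fraction_poly_pchar (k : fieldType) : [pchar k] =i pred0 -> [pchar {fraction {poly k}}] =i pred0.
Proof.
move=> k0 p; rewrite -(k0 p).
exact: (fmorph_pchar ((@tofrac {poly k} \o polyC) : {rmorphism k -> {fraction {poly k}}}) p).
Qed.

Section GlobalPlaces.
Variables (R : realType) (s : global_base) (K : fieldExtType (base_field s)).

Let U : set (base_field s -> R) := [set u | absolute_value u /\ standard u].

Let n : R := (\dim {:K})%:R.

Let n1 : 1 <= n. Proof. by rewrite /n ler1n; exact: adim_gt0. Qed.

Lemma placesE : places R K = ext_places (K := K) U.
Proof.
apply/seteqP; split=> v [av h]; split=> //; last by case: h.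
by split=> //; exact: (av_comp (in_alg K) av).
Qed.

Lemma heightE (b : K) : height R b = weil_height (@places R s K) (@weight R s K) b.
Proof. by []. Qed.

Lemma place_weight_ge v : places R K v -> n^-1 <= weight v.
Proof. by move=> [av _]; exact: weight_ge. Qed.

Variable A : set (base_field s -> R).
Hypothesis F0 : [pchar base_field s] =i pred0.
Hypothesis base : base_with_places U A.

Let V := places R K.
Let Ar := ext_archimedean U A (K := K).

Lemma places_absolute_value v : V v -> absolute_value v.
Proof. by case. Qed.

Lemma places_ultrametric v : V v -> ~ Ar v -> ultrametric v.
Proof. by rewrite /V placesE => /(ext_place_type F0 base)[[]|[]]. Qed.

Lemma archimedean_place : Ar `<=` V.
Proof. by rewrite /V placesE => v []. Qed.

Lemma places_poles x : finite_set [set v | V v /\ 1 < v x].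
Proof. by rewrite /V placesE; exact: (ext_poles_finite F0 base). Qed.

Lemma places_product_formula x (T : seq (K -> R)) : x != 0 -> uniq T ->
  (forall v, v \in T -> V v) -> (forall v, V v -> v \notin T -> v x <= 1) ->
  exists c : (K -> R) -> R, (forall v, v \in T -> 1 <= c v <= n) /\
    0 <= \sum_(v <- T) c v * ln (v x).
Proof. by rewrite /V placesE; exact: (ext_product_formula F0 base). Qed.

Lemma places_contraction_gap d (S : set (K -> R)) (a : R) : (2 <= d)%N ->
  finite_set S -> S `<=` V -> Ar `<=` S -> 0 <= a ->
  (forall v, S v -> quasi_ultrametric (expR a) v) ->
  (forall v, S v -> expR (- (d%:R * a)) <= v d%:R) ->
  exists2 eps : R, 0 < eps & exists2 C : R, 0 <= C & exists2 B : nat, (0 < B)%N &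
    forall (b : K) P, (forall v, V v -> ~ S v -> v b <= 1) -> 0 < height R b ->
      C * a <= height R b -> ~ periodic_at_most d b B P ->
      eps * height R b <= canonical_height R d b P.
Proof.
move=> d2 /finite_seqP[l lE] SV ArS a0 qS vdS.
have lP v : v \in undup l -> S v by rewrite mem_undup lE.
have Sl v : S v -> v \in undup l by rewrite mem_undup lE.
have [||||||eps eps0 [C C0 [B B0 gap]]] := contraction_gap places_absolute_value
    places_ultrametric n1 place_weight_ge places_poles places_product_formula d2
    (S0 := undup l) (a := a).
- exact: undup_uniq.
- by move=> v /lP/SV.
- by move=> v /ArS/Sl.
- exact: a0.
- by move=> v /lP/qS.
- by move=> v /lP/vdS.
exists eps => //; exists C => //; exists B => // b P bS.
by apply: gap => v Vv /negP vl; apply: bS => // /Sl.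
Qed.

Lemma places_archimedean_gap d (C : R) : (2 <= d)%N -> 0 <= C -> (exists v, Ar v) ->
  exists2 eps : R, 0 < eps & exists2 B : nat, (0 < B)%N &
    forall (b : K) P, height R b <= C -> ~ periodic_at_most d b B P ->
      eps <= canonical_height R d b P.
Proof.
move=> d2 C0 exA.
apply: (archimedean_gap places_absolute_value places_ultrametric archimedean_place n1
  place_weight_ge places_poles places_product_formula d2 C0 exA).
  exact: (ext_archimedean_finite K F0 base).
move=> v Av; have := archimedean_place Av; rewrite /V placesE => Vv.
by have [[]|[]] := ext_place_type F0 base Vv.
Qed.

End GlobalPlaces.

(** Here a is log 2. Contraction handles the b with h(b) large compared with a,
    and the archimedean places handle those of bounded height. *)
Lemma number_field_gap (R : realType) (K : fieldExtType (base_field RationalNumbers)) (d : nat)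
    (S : set (K -> R)) : (2 <= d)%N -> finite_set S -> S `<=` places R K ->
  exists2 eps : R, 0 < eps &
    forall b : K, (forall v, places R K v -> ~ S v -> v b <= 1) ->
      exists2 B : nat, (0 < B)%N &
        forall P : K * K, ~ periodic_at_most d b B P ->
          eps * Num.max (height R b) 1 <= canonical_height R d b P.
Proof.
move=> d2 finS SV.
have F0 : [pchar base_field RationalNumbers] =i pred0 := pchar_num _.
have base : base_with_places [set u : base_field RationalNumbers -> R
  | absolute_value u /\ standard u] [set rat_infinity R] := rat_base_with_places R.
set U := [set u | _] in base.
pose Ar : set (K -> R) := ext_archimedean U [set rat_infinity R] (K := K).
have finA : finite_set Ar := ext_archimedean_finite K F0 base.
have ArV : Ar `<=` places R K by apply: archimedean_place.
have ln20 : 0 <= ln (2 : R) by rewrite ln_ge0 // ler1n.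
have SAV : S `|` Ar `<=` places R K by move=> v [/SV|/ArV].
have [||||eps1 e10 [C C0 [B1 B10 gap1]]] := places_contraction_gap F0 base d2 _ SAV _ ln20.
- by rewrite finite_setU.
- by move=> v Av; right.
- by move=> v /SAV[av _]; rewrite lnK ?posrE //; apply: quasi_ultrametric2.
- move=> v /SAV; rewrite placesE => -[_ Uv].
  have := rat_place_nat_ge (ltnW d2) Uv; rewrite rmorph_nat.
  by rewrite expRN expRM_natl lnK ?posrE.
have exA : exists v, Ar v.
  have [|v Vv vE] := @place_over _ _ _ _ K F0 base (rat_infinity R).
    split; [exact: rat_infinity_abs | by left; exact: rat_infinity_nat].
  by exists v; split.
pose M := C * ln 2 + 1; have M1 : 1 <= M by rewrite lerDr mulr_ge0.
have M0 : 0 < M by apply: lt_le_trans M1.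
have [eps2 e20 [B2 B20 gap2]] := places_archimedean_gap F0 base d2 (ltW M0) exA.
exists (Num.min eps1 (eps2 / M)); first by rewrite lt_min e10 divr_gt0.
move=> b bS; have [hM|hM] := leP (height R b) M.
  exists B2 => // P nper; apply: le_trans (gap2 b P hM nper).
  apply: (@le_trans _ _ (eps2 / M * M)); last by rewrite divfK ?gt_eqF.
  apply: ler_pM; rewrite ?le_max ?ler01 ?orbT ?ge_min ?lexx ?orbT //.
  - by rewrite le_min (ltW e10) ltW // divr_gt0.
  - by rewrite ge_max hM.
have h1 : 1 < height R b by apply: le_lt_trans hM.
exists B1 => // P nper; rewrite max_l ?(ltW h1) //.
apply: le_trans (gap1 b P _ _ _ nper).
- by rewrite ler_pM2r ?(lt_trans _ h1) // ge_min lexx.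
- by move=> v Vv nv; apply: bS => // Sv; apply: nv; left.
- by apply: lt_trans h1.
- by apply: le_trans (ltW hM); rewrite lerDl.
Qed.

(** If b were smaller than exp (1 / 2n) at every place, the coefficients of its
    characteristic polynomial would have size less than e, hence at most 1, as
    the sizes in k(t) are integral powers of e: they would be constants. *)
Lemma nonconstant_height_ge (R : realType) (k : fieldType) (k0 : [pchar k] =i pred0)
    (K : fieldExtType (base_field (RationalFunctions k0))) (b : K) :
  ~ is_constant b ->
  exists2 v, places R K v & expR ((2 * (\dim {:K})%:R)^-1) <= v b.
Proof.
move=> ncb; set n := \dim {:K}.
have n0 : 0 < n%:R :> R by rewrite ltr0n; exact: adim_gt0.
have F0 : [pchar base_field (RationalFunctions k0)] =i pred0 := fraction_poly_pchar k0.
have base := function_base_with_places R k0.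
apply: contrapT => nlarge; apply: ncb.
have [||v Vv|p [mp rp hp]] := @ext_large_place R _ _ _ K F0 base b (expR (2 * n%:R)^-1).
- by move=> u.
- by rewrite -expR0 ler_expR invr_ge0 mulr_ge0 // ltW.
- rewrite leNgt; apply/negP => vb; apply: nlarge; exists v; last exact: ltW.
  by rewrite placesE.
have coefE i : exists a : k, p`_i = tofrac a%:P.
  have [pi0|pi0] := eqVneq p`_i 0; first by exists 0; rewrite pi0 tofrac0.
  suff le1 : forall u : base_field (RationalFunctions k0) -> R,
      absolute_value u /\ standard u -> u p`_i <= 1.
    exact: (function_constant_of_le1 pi0 le1).
  move=> u Uu.
  have [z uz] := function_place_discrete Uu pi0.
  have := hp u i Uu; rewrite uz -expRM_natl ler_expR.
  have -> : n%:R * (2 * n%:R)^-1 = 2^-1 :> R by field; rewrite gt_eqF.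
  move=> hz; rewrite -[leRHS]expR0 ler_expR lerz0 -ltzD1 add0r -(ltr_int R); apply: le_lt_trans hz _.
  by rewrite invf_lt1 // ltr1n.
have [a aE] := choice coefE.
pose q := \poly_(i < size p) a i.
have qE : map_poly (fun c : k => in_alg K (tofrac c%:P)) q = map_poly (in_alg K) p.
  apply/polyP => i; rewrite coef_map_id0; last by rewrite polyC0 tofrac0 rmorph0.
  rewrite coef_map coef_poly; case: ltnP => [_|h]; first by rewrite -aE.
  by rewrite polyC0 tofrac0 [p`_i]nth_default.
exists q; last by rewrite qE.
apply/negP => /eqP q0; move: qE; rewrite q0 map_poly0 => /esym/eqP.
by rewrite map_poly_eq0; apply/negP; apply: monic_neq0.
Qed.

(** Here a is 0, so that contraction works for every b of positive height, and
    the height of a nonconstant b is bounded below. *)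
Lemma function_field_gap (R : realType) (k : fieldType) (k0 : [pchar k] =i pred0)
    (K : fieldExtType (base_field (RationalFunctions k0))) (d : nat) (S : set (K -> R)) :
  (2 <= d)%N -> finite_set S -> S `<=` places R K ->
  exists2 eps : R, 0 < eps &
    forall b : K, (forall v, places R K v -> ~ S v -> v b <= 1) -> ~ is_constant b ->
      exists2 B : nat, (0 < B)%N &
        forall P : K * K, ~ periodic_at_most d b B P ->
          eps * Num.max (height R b) 1 <= canonical_height R d b P.
Proof.
move=> d2 finS SV.
have F0 : [pchar base_field (RationalFunctions k0)] =i pred0 := fraction_poly_pchar k0.
have base : base_with_places [set u : base_field (RationalFunctions k0) -> R
  | absolute_value u /\ standard u] set0 := function_base_with_places R k0.
set U := [set u | _] in base.
have uS v : S v -> ultrametric v.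
  by move=> /SV Vv; apply: (places_ultrametric F0 base Vv) => -[].
have [|||eps e0 [C _ [B B0 gap]]] := places_contraction_gap F0 base d2 finS SV _ (lexx 0).
- by move=> v [].
- by move=> v /uS uv; rewrite expR0; apply: quasi_ultrametric1.
- move=> v /SV; rewrite placesE => -[_ Uv].
  have := function_place_nat (ltnW d2) Uv; rewrite rmorph_nat => ->.
  by rewrite mulr0 oppr0 expR0.
pose n : R := (\dim {:K})%:R.
have n1 : 1 <= n by rewrite ler1n; exact: adim_gt0.
have n0 : 0 < n by apply: lt_le_trans n1.
pose M := 2 * n * n.
have M1 : 1 <= M.
  by rewrite /M mulr_ege1 // mulr_ege1 // ler1n.
have M0 : 0 < M by apply: lt_le_trans M1.
exists (eps / M); first by rewrite divr_gt0.
move=> b bS ncb; exists B => // P nper.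
have hM : 1 <= M * height R b.
  have [v Vv vb] := nonconstant_height_ge R ncb.
  have [l lE] := iffLR (finite_seqP _) (places_poles F0 base b).
  have lP u : u \in undup l <-> places R K u /\ 1 < u b.
    by rewrite mem_undup; apply: (mem_list lE).
  have v1 : 1 < v b by apply: lt_le_trans vb; rewrite expR_gt1 invr_gt0 mulr_gt0.
  have vl : v \in undup l by apply/lP.
  have lV u : u \in undup l -> places R K u by move=> /lP[].
  have bl : logplus (v b) <= n * height R b.
    rewrite heightE (weil_heightE _ (undup_uniq l) lV); last first.
      by move=> u Vu nu; rewrite leNgt; apply/negP => ub; move/negP: nu; apply; apply/lP.
    have b0 (u : K -> R) : u \in undup l -> 0 <= logplus (u b) by rewrite logplus_ge0.
    have term := weighted_term_le n1 (place_weight_ge (K := K)) lV (undup_uniq l) b0 vl.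
    exact: term.
  rewrite /M -mulrA -ler_pdivrMl ?mulr_gt0 // mulr1; apply: le_trans bl.
  rewrite -[leLHS]expRK; apply: le_trans (ln_le_logplus _).
  by rewrite ler_ln ?posrE ?expR_gt0 // (lt_trans ltr01).
have h0 : 0 < height R b by rewrite -(pmulr_rgt0 _ M0); apply: lt_le_trans hM.
apply: le_trans (gap b P bS h0 _ nper); last by rewrite mulr0 ltW.
rewrite -mulrA ler_pM2l // ler_pdivrMl // ge_max hM andbT.
by rewrite ler_peMl // ltW.
Qed.

Theorem theorem1p1 (R : realType) (s : global_base)
    (K : fieldExtType (base_field s)) (d : nat) (S : set (K -> R)) :
  (2 <= d)%N ->
  finite_set S -> S `<=` places R K ->
  exists2 eps : R, 0 < eps &
    forall b : K,
      (forall v, places R K v -> ~ S v -> v b <= 1) ->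
      ~ is_constant b ->
      exists2 B : nat, (0 < B)%N &
        forall P : K * K, ~ periodic_at_most d b B P ->
          eps * Num.max (height R b) 1 <= canonical_height R d b P.
Proof.
case: s K S => [K S d2 finS SV|k k0 K S]; last exact: function_field_gap.
have [eps e0 gap] := number_field_gap d2 finS SV.
by exists eps => // b bS _; apply: gap.
Qed.
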